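(* Let $a^2>0$, $c^2>0$, $b^2\ge 0$ be real constants, let $k\in\mathbb{Z}\setminus\{0\}$, and let $\mathcal{E}$, $S$ and $s_+$ be as defined in the context. For every $L>0$ and $0<R<\infty$ there exists a global minimiser $(u,v)$ of $\mathcal{E}$ on $S$ with $$(u,v)\in \big[C^\infty(0,R)\cap C([0,R])\big]\times\big[C^\infty(0,R)\cap C^1([0,R])\big],$$ and which satisfies the system of ODEs $$u''+\frac{u'}{r}-\frac{k^2u}{r^2} =\frac{u}{L}\left[-a^2+\sqrt{\tfrac{2}{3}}\, b^2 v+c^2\left( u^2+ v^2\right)\right],$$ $$v''+\frac{v'}{r}=\frac{v}{L}\left[-a^2-\frac{1}{\sqrt{6}}b^2 v+c^2\left( u^2+ v^2\right) \right] + \frac{1}{\sqrt{6}\, L} b^2 u^2,\qquad r\in(0,R),$$ together with the boundary conditions $$u(0)=0,\quad v'(0)=0,\quad u(R)=\frac{1}{\sqrt{2}}s_+,\quad v(R)=-\frac{1}{\sqrt{6}}s_+ .$$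
   Context: Set $$s_+ = \frac{ b^2 + \sqrt{b^4+24 a^2 c^2}}{4 c^2}.$$ The reduced energy is $$\mathcal{E}(u,v)=\int_0^R \left[ \frac{1}{2} \left( (u')^2+(v')^2+\frac{k^2}{r^2}u^2 \right) -\frac{a^2}{2L}(u^2 + v^2)+\frac{c^2}{4L}\left(u^2+v^2\right)^2\right]\,r\,dr-\frac{b^2}{3\sqrt{6}\,L }\int_0^R v(v^2 -3u^2)\,r\,dr .$$ It is considered on the admissible set $$S = \left\{ (u,v) : [0,R] \to \mathbb{R}^2 \ \Big|\ \sqrt{r}\, u',\ \sqrt{r}\, v',\ \frac{u}{\sqrt{r}},\ \sqrt{r}\, v \in L^2(0,R), \ u(R)=\frac{s_+}{\sqrt{2}},\ v(R)= -\frac{s_+}{\sqrt{6}} \right\},$$ where $u',v'$ denote weak derivatives on $(0,R)$ (so elements of $S$ have representatives continuous on $(0,R]$). A global minimiser of $\mathcal{E}$ on $S$ is $(u,v)\in S$ with $\mathcal{E}(u,v)\le\mathcal{E}(\tilde u,\tilde v)$ for all $(\tilde u,\tilde v)\in S$. *)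

(* Defs.v *)
From HB Require Import structures.
From mathcomp Require Import all_boot all_order all_algebra.
From mathcomp Require Import all_classical all_reals all_analysis.

Set Implicit Arguments.
Unset Strict Implicit.
Unset Printing Implicit Defensive.

Import Order.TTheory GRing.Theory Num.Theory.
Import numFieldNormedType.Exports.

Local Open Scope classical_set_scope.
Local Open Scope ring_scope.

Section regularity.
Context {R : realType}.
Implicit Types (A : set R) (f g phi : R -> R).

(* Only meaningful for A open: derive1n uses two-sided derivatives. *)
Definition smooth_on A f :=
  forall (n : nat) (x : R), A x -> derivable (derive1n n f) x 1.

(* Difference quotients with increments staying in A; at an endpoint of a
   closed interval A this is the one-sided derivative. *)
Definition has_derivative_within A f (x l : R) :=
  (fun y => (f y - f x) / (y - x)) @ within A x^' --> l.

Definition C1_within A f :=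
  exists2 f' : R -> R,
    forall x, A x -> has_derivative_within A f x (f' x) &
    {within A, continuous f'}.

Definition test_function A phi :=
  [/\ smooth_on setT phi,
      compact (closure [set x | phi x != 0]) &
      closure [set x | phi x != 0] `<=` A].

Definition is_weak_derivative A f g :=
  [/\ locally_integrable A f, locally_integrable A g &
      forall phi, test_function A phi ->
        (\int[lebesgue_measure]_(x in A) (f x * derive1 phi x)%:E =
         - \int[lebesgue_measure]_(x in A) (g x * phi x)%:E)%E].

(* Weak derivatives are unique only almost everywhere: this picks one of them
   (an arbitrary function when there is none). *)
Definition weak_derivative A f : R -> R := get (is_weak_derivative A f).

Definition L2_on A f := f \_ A \in Lfun (@lebesgue_measure R) 2%:E.

End regularity.

Section energy.
Context {R : realType}.
Variables (a b c L rad : R) (k : int).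
Implicit Types u v : R -> R.

Definition s_plus : R :=
  (b ^+ 2 + Num.sqrt (b ^+ 4 + 24 * a ^+ 2 * c ^+ 2)) / (4 * c ^+ 2).

Definition bulk_density u v (r : R) : R :=
  let u' := weak_derivative `]0, rad[ u in
  let v' := weak_derivative `]0, rad[ v in
  2^-1 * (u' r ^+ 2 + v' r ^+ 2 + k%:~R ^+ 2 / r ^+ 2 * u r ^+ 2)
  - a ^+ 2 / (2 * L) * (u r ^+ 2 + v r ^+ 2)
  + c ^+ 2 / (4 * L) * (u r ^+ 2 + v r ^+ 2) ^+ 2.

(* Both integrals converge absolutely on the admissible set, so the extended
   real value is finite there. *)
Definition energy u v : \bar R :=
  (\int[lebesgue_measure]_(r in `]0%R, rad[) (bulk_density u v r * r)%:E
   - (b ^+ 2 / (3 * Num.sqrt 6 * L))%:E *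
     \int[lebesgue_measure]_(r in `]0%R, rad[)
       (v r * (v r ^+ 2 - 3 * u r ^+ 2) * r)%:E)%E.

(* Elements are represented by functions continuous on ]0, rad], which gives
   the boundary values at rad their meaning; values outside ]0, rad] are
   irrelevant. *)
Definition admissible u v :=
  let u' := weak_derivative `]0, rad[ u in
  let v' := weak_derivative `]0, rad[ v in
  [/\ {within `]0, rad], continuous u} /\ {within `]0, rad], continuous v},
      (exists g, is_weak_derivative `]0, rad[ u g) /\
      (exists g, is_weak_derivative `]0, rad[ v g),
      L2_on `]0, rad[ (fun r => Num.sqrt r * u' r) /\
      L2_on `]0, rad[ (fun r => Num.sqrt r * v' r),
      L2_on `]0, rad[ (fun r => u r / Num.sqrt r) /\
      L2_on `]0, rad[ (fun r => Num.sqrt r * v r) &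
      u rad = s_plus / Num.sqrt 2 /\ v rad = - (s_plus / Num.sqrt 6)].

Definition global_minimiser u v :=
  admissible u v /\
  forall u1 v1, admissible u1 v1 -> (energy u v <= energy u1 v1)%E.

End energy.

(* Main.v *)
Require Import Defs.
From mathcomp Require Import all_boot all_order all_algebra.
From mathcomp Require Import all_classical all_reals all_analysis.
From mathcomp Require Import measurable_realfun.
From mathcomp Require Import ring lra.

Set Implicit Arguments.
Unset Strict Implicit.
Unset Printing Implicit Defensive.

Import Order.TTheory GRing.Theory Num.Theory.
Import numFieldNormedType.Exports.

Local Open Scope classical_set_scope.
Local Open Scope ring_scope.

(** The proof is the direct method of the calculus of variations, followed by
    one-dimensional regularity theory.

    Compactness.  The bulk potential is bounded below because its quartic term
    dominates, so along a minimising sequence the Dirichlet integrals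
    int t g^2 of the two components stay bounded ([coercive]).  Completing a
    square with an adjustable weight turns such a bound into
    |w y - w x| <= l M / 2 + (ln y - ln x) / (2 l) for x < y and every l > 0,
    M being the Dirichlet integral ([weighted_increment]).
    Hence the sequence is equicontinuous on every [x, rad] with x > 0 and grows
    at most like a logarithm at 0; in particular t w^4 is bounded by a multiple
    of sqrt t ([weighted_growth]), which makes every lower order term
    integrable.  Passing to the limit along an ultrafilter on nat gives limits
    u and v, locally uniform away from 0 ([weighted_ultra_limit]).  No weak
    limit of the derivatives is taken.

    Equation first, semicontinuity second.  The energy of the n-th pair
    perturbed by s times a fixed pair of test functions is a polynomial of
    degree four in s.  Its linear coefficient contains the derivatives only
    through integrals against test functions, which can be moved back to the
    functions themselves; all coefficients therefore converge, and since the
    energies tend to the infimum the linear coefficient of the limit vanishes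
    ([first_variation]).  So u and v satisfy the Euler-Lagrange equations in
    the sense of distributions without knowing yet that their energy is finite.
    A distributional solution of (t w')' = g with continuous right-hand side is
    classical ([weak_second_order]), which yields continuous fluxes p = t u',
    q = t v' solving a first order system ([el_system]), and a bootstrap makes
    everything smooth in the open interval ([el_system_smooth]).  Smoothness of
    u' and v' makes lower semicontinuity elementary: in
    t g^2 / 2 >= t u' g - t u'^2 / 2, multiplied by a cutoff, the first term on
    the right is again a test function against a weak derivative, and thus
    converges ([limit_minimises]).

    The axis.  Since u^2/t and t u'^2 are integrable and the derivative of u^2
    is at most their sum, u tends to 0 at 0 ([axis_vanishing]).  The flux q of
    v has a derivative O(sqrt t) and takes arbitrarily small values near 0
    because q^2/t is integrable; hence q = O(t^(3/2)) and v' = q/t tends to 0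
    ([axis_flux]), so that v extends to a C^1 function on the closed interval
    with v'(0) = 0 ([C1_axis_extension]). *)


(** * Calculus of smooth functions *)

Section smooth.
Context {R : realType}.
Implicit Types (A : set R) (f g : R -> R) (n : nat).

(** [smooth_on] quantifies over all orders at once; recursion on the order,
    peeling off the innermost derivative, is what allows closure under
    products and inverses to be proved by induction. *)
Fixpoint diffn A n f : Prop :=
  if n is m.+1 then (forall x, A x -> derivable f x 1) /\ diffn A m (derive1 f)
  else True.

Lemma smooth_diffn A f : smooth_on A f <-> forall n, diffn A n f.
Proof.
split.
- move=> sf n; elim: n f sf => [//|n ih] f sf /=; split.
    by move=> x Ax; exact: (sf 0%N).
  by apply: ih => m x Ax; rewrite -derive1Sn; exact: sf.
- move=> df n; elim: n f df => [|n ih] f df x Ax.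
    by have [+ _] := df 1%N; apply.
  by rewrite derive1Sn; apply: ih => // m; have [] := df m.+1.
Qed.

Lemma diffnW A n f : diffn A n.+1 f -> diffn A n f.
Proof.
by elim: n f => [//|n ih] f [df d'f]; split => //; exact: ih.
Qed.

Lemma near_open_eq A f g x : open A -> (forall x, A x -> f x = g x) -> A x ->
  {near x, f =1 g}.
Proof.
move=> oA fg Ax; have : nbhs x A by exact: open_nbhs_nbhs.
by apply: filterS => y; exact: fg.
Qed.

Lemma eq_on_derive1 A f g x : open A -> (forall x, A x -> f x = g x) -> A x ->
  derive1 f x = derive1 g x.
Proof.
move=> oA fg Ax; rewrite !derive1E; apply: near_eq_derive.
exact: near_open_eq Ax.
Qed.

Lemma eq_on_derivable A f g x : open A -> (forall x, A x -> f x = g x) -> A x ->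
  derivable f x 1 -> derivable g x 1.
Proof.
move=> oA fg Ax; apply: near_eq_derivable; exact: near_open_eq Ax.
Qed.

Lemma eq_diffn A n f g : open A -> (forall x, A x -> f x = g x) ->
  diffn A n f -> diffn A n g.
Proof.
move=> oA; elim: n f g => [//|n ih] f g fg [df d'f]; split.
  by move=> x Ax; apply: (eq_on_derivable oA fg Ax); exact: df.
by apply: ih d'f => x Ax; exact: (eq_on_derive1 oA fg Ax).
Qed.

Lemma eq_smooth A f g : open A -> (forall x, A x -> f x = g x) ->
  smooth_on A f -> smooth_on A g.
Proof.
move=> oA fg /smooth_diffn sf; apply/smooth_diffn => n.
exact: eq_diffn (sf n).
Qed.

Lemma diffn_sub A B n f : A `<=` B -> diffn B n f -> diffn A n f.
Proof.
move=> AB; elim: n f => [//|n ih] f [df d'f]; split.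
  by move=> x /AB; exact: df.
exact: ih.
Qed.

Lemma diffn_cst A n (c : R) : open A -> diffn A n (fun=> c).
Proof.
move=> oA; elim: n c => [//|n ih] c; split => //.
apply: (@eq_diffn _ _ (fun=> 0)) => // x _.
by rewrite derive1_cst.
Qed.

Lemma diffnD A n f g : open A -> diffn A n f -> diffn A n g ->
  diffn A n (fun x => f x + g x).
Proof.
move=> oA; elim: n f g => [//|n ih] f g [df d'f] [dg d'g]; split.
  by move=> x Ax; apply: derivableD; [exact: df|exact: dg].
apply: (@eq_diffn _ _ (fun x => derive1 f x + derive1 g x)) => //; last exact: ih.
move=> x Ax; rewrite !derive1E deriveD//; [exact: df|exact: dg].
Qed.

Lemma diffnM A n f g : open A -> diffn A n f -> diffn A n g ->
  diffn A n (fun x => f x * g x).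
Proof.
move=> oA; elim: n f g => [//|n ih] f g df dg; split.
  by move=> x Ax; apply: derivableM; [case: df => + _|case: dg => + _]; apply.
apply: (@eq_diffn _ _ (fun x => f x * derive1 g x + g x * derive1 f x)) => //.
  move=> x Ax; rewrite !derive1E deriveM//;
    [by case: df => + _; apply|by case: dg => + _; apply].
apply: diffnD => //; apply: ih; (try by apply: diffnW); by case: df dg => ? ? [].
Qed.

Lemma diffnZ A n (c : R) f : open A -> diffn A n f -> diffn A n (fun x => c * f x).
Proof. by move=> oA df; apply: diffnM => //; exact: diffn_cst. Qed.

Lemma diffnN A n f : open A -> diffn A n f -> diffn A n (fun x => - f x).
Proof.
move=> oA df; apply: (@eq_diffn _ _ (fun x => -1 * f x)) => //.
  by move=> x _; rewrite mulN1r.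
exact: diffnZ.
Qed.

Lemma diffn_id A n : open A -> diffn A n (fun x => x).
Proof.
case: n => // n oA; split => [x _|]; first exact: derivable_id.
apply: (@eq_diffn _ _ (fun=> 1)) => //; last exact: diffn_cst.
by move=> x _; rewrite derive1_id.
Qed.

Lemma diffnV A n f : open A -> (forall x, A x -> f x != 0) -> diffn A n f ->
  diffn A n (fun x => (f x)^-1).
Proof.
move=> oA f0; elim: n => [//|n ih] df; split.
  move=> x Ax; apply: derivableV; first exact: f0.
  by case: df => + _; apply.
have dfV := ih (diffnW df).
apply: (@eq_diffn _ _ (fun x => - ((f x)^-1 * (f x)^-1 * derive1 f x))) => //.
  move=> x Ax; rewrite !derive1E deriveV ?f0//; last by case: df => + _; apply.
  by rewrite /GRing.scale/= mulNr expr2 invfM.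
apply: diffnN => //; apply: diffnM => //; last by case: df.
exact: diffnM.
Qed.

Lemma is_derive_affine (a b : R) g (x : R) : (forall y, derivable g y 1) ->
  is_derive x 1 (fun x => g (a * x + b)) (a * derive1 g (a * x + b)).
Proof.
move=> dg.
have h : is_derive x 1 (fun x => a * x + b) a.
  by apply: is_derive_eq; rewrite /GRing.scale/= mulr1 ?mulr0 ?addr0.
have hg : is_derive (a * x + b) (1:R) g (derive1 g (a * x + b)).
  by rewrite derive1E; apply/derivableP.
have := @is_derive1_comp _ g (fun x => a * x + b) x _ _ hg h.
by rewrite mulrC.
Qed.

Lemma diffn_affine n (a b : R) f : diffn setT n f ->
  diffn setT n (fun x => f (a * x + b)).
Proof.
have oT : open [set: R] by exact: openT.
elim: n f => [//|n ih] f [df d'f]; split.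
  by move=> x _; have [] := is_derive_affine a b x (fun y => df y I).
apply: (@eq_diffn _ _ (fun x => a * derive1 f (a * x + b))) => //; last first.
  by apply: diffnZ => //; exact: ih.
move=> x _; rewrite [in RHS]derive1E.
by have [_ ->] := is_derive_affine a b x (fun y => df y I).
Qed.

End smooth.

(** * Smooth steps and plateaus *)

Section smooth_step.
Context {R : realType}.
Implicit Types (x t : R) (n : nat).

(** The family t^(-n) e^(-1/t), extended by 0: it is closed under
    differentiation up to linear combinations, so smoothness of the whole family
    follows from one derivative computation. *)
Definition flat n t : R := if 0 < t then t^-1 ^+ n * expR (- t^-1) else 0.

Lemma flat_ge0 n t : 0 <= flat n t.
Proof.
rewrite /flat; case: ifPn => // t0.
by rewrite mulr_ge0 ?expR_ge0// exprn_ge0// invr_ge0 ltW.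
Qed.

(** The quadratic bound gives the vanishing derivative at 0; it
    is one term of the exponential series of 1/t. *)
Lemma flat_le_sqr n t : flat n t <= (n.+2)`!%:R * t ^+ 2.
Proof.
rewrite /flat; case: ifPn => t0; last first.
  by rewrite mulr_ge0// exprn_even_ge0.
have s0 : 0 <= t^-1 by rewrite invr_ge0 ltW.
have := @expR_ge1Dxn R _ n.+1 s0.
rewrite expRN ler_pdivrMr ?expR_gt0// => h.
have {h} : t^-1 ^+ n.+2 / n.+2`!%:R <= expR t^-1.
  by apply: le_trans h; rewrite lerDr.
rewrite ler_pdivrMr ?ltr0n ?fact_gt0// => h.
have -> : t^-1 ^+ n = t^-1 ^+ n.+2 * t ^+ 2.
  by rewrite -addn2 exprD -mulrA -exprMn mulVf ?gt_eqF// expr1n mulr1.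
apply: le_trans (ler_wpM2r (exprn_even_ge0 t (isT : ~~ odd 2)) h) _.
by rewrite [leRHS]mulrC [leRHS]mulrA.
Qed.

Lemma is_derive_flat n x :
  is_derive x 1 (flat n) (- n%:R * flat n.+1 x + flat n.+2 x).
Proof.
have [x0|x0|->] := ltgtP x 0.
- have oA : open [set y : R | y < 0] by exact: open_lt.
  apply: (@near_eq_is_derive _ _ _ (cst 0)).
    apply: (near_open_eq oA _ x0) => y /= y0.
    by rewrite /flat ltNge ltW.
  by apply: is_derive_eq; rewrite /flat ltNge ltW//= mulr0 addr0.
- have oA : open [set y : R | 0 < y] by exact: open_gt.
  apply: (@near_eq_is_derive _ _ _ (fun t => t^-1 ^+ n * expR (- t^-1))).
    apply: (near_open_eq oA _ x0) => y /= y0.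
    by rewrite /flat y0.
  have xn0 : x != 0 by rewrite gt_eqF.
  have dV : is_derive x 1 (fun t : R => t^-1) (- (x^-1 ^+ 2)).
    have dx : derivable (fun t : R => t^-1) x 1.
      by apply: derivableV => //; exact: derivable_id.
    have -> : - (x^-1 ^+ 2) = 'D_1 (fun t : R => t^-1) x.
      have := @deriveV R R id x 1 xn0 (@derivable_id _ _ x 1).
      by rewrite derive_id /GRing.scale/= mulr1 -exprVn => <-.
    exact/derivableP.
  have dE : is_derive x 1 (fun t : R => expR (- t^-1)) (expR (- x^-1) * x^-1 ^+ 2).
    apply: (@is_derive1_comp _ expR (fun t => - t^-1)).
    by rewrite -[X in is_derive _ _ _ X]opprK; exact: is_deriveN.
  have dX : is_derive x 1 (fun t : R => t^-1 ^+ n)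
      (n%:R * x^-1 ^+ n.-1 * - (x^-1 ^+ 2)).
    have -> : (fun t : R => t^-1 ^+ n) = (fun t : R => t^-1) ^+ n.
      by apply/funext => t; rewrite exprfctE.
    exact: (is_deriveX n dV).
  apply: (is_derive_eq (is_deriveM dX dE)).
  rewrite /flat x0 /GRing.scale/=.
  clear dX dE dV; case: n => [|m]; first by rewrite /=; ring.
  by rewrite [m.+1.-1]/= !exprS -[m.+1%:R]natr1; ring.
- have fl0 m : flat m 0 = 0 by rewrite /flat ltxx.
  rewrite !fl0 mulr0 addr0.
  have cv : h^-1 *: (flat n (h *: (1:R) + 0) - flat n 0) @[h --> 0^'] --> (0:R).
    rewrite fl0; apply/cvgrPdist_le => e e0.
    near=> h.
    have h0 : h != 0 by near: h; exact: nbhs_dnbhs_neq.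
    rewrite sub0r normrN subr0 addr0 /GRing.scale/= mulr1 normrM normfV.
    rewrite ler_pdivrMl ?normr_gt0// ger0_norm ?flat_ge0//.
    apply: le_trans (flat_le_sqr n h) _.
    have C0 : 0 < (n.+2)`!%:R :> R by rewrite ltr0n fact_gt0.
    rewrite -[h ^+ 2]real_normK ?num_real// expr2 mulrCA ler_wpM2l//.
    by rewrite -ler_pdivlMl// mulrC; near: h; apply: dnbhs0_le; rewrite divr_gt0.
  by apply: DeriveDef; [apply/cvg_ex; exists 0|exact/cvg_lim].
Unshelve. all: by end_near. Qed.

Lemma diffn_flat k n : diffn setT k (flat n).
Proof.
elim: k n => [//|k ih] n; split.
  by move=> x _; have [] := is_derive_flat n x.
have oT : open [set: R] by exact: openT.
apply: (@eq_diffn _ _ _ (fun x => - n%:R * flat n.+1 x + flat n.+2 x)) => //.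
  by move=> x _; rewrite derive1E; have [_ ->] := is_derive_flat n x.
by apply: diffnD => //; apply: diffnZ.
Qed.

Definition step t : R := flat 0 t / (flat 0 t + flat 0 (1 - t)).

Lemma flat_gt0 n t : 0 < t -> 0 < flat n t.
Proof.
by move=> t0; rewrite /flat t0 mulr_gt0 ?expR_gt0// exprn_gt0// invr_gt0.
Qed.

Lemma step_den_gt0 t : 0 < flat 0 t + flat 0 (1 - t).
Proof.
have [t0|t0] := ltP 0 t; first by rewrite ltr_wpDr ?flat_ge0// flat_gt0.
by rewrite ltr_wpDl ?flat_ge0// flat_gt0// subr_gt0 (le_lt_trans t0).
Qed.

Lemma step_le0 t : t <= 0 -> step t = 0.
Proof. by move=> t0; rewrite /step {1}/flat ltNge t0/= mul0r. Qed.

Lemma step_ge1 t : 1 <= t -> step t = 1.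
Proof.
move=> t1; have t0 : 0 < t by rewrite (lt_le_trans ltr01).
rewrite /step [flat 0 (1 - t)]/flat ltNge subr_le0 t1/= addr0 divff//.
by rewrite gt_eqF// flat_gt0.
Qed.

Lemma step_ge0 t : 0 <= step t.
Proof. by rewrite /step divr_ge0 ?flat_ge0// ltW// step_den_gt0. Qed.

Lemma step_le1 t : step t <= 1.
Proof.
by rewrite /step ler_pdivrMr ?step_den_gt0// mul1r lerDl flat_ge0.
Qed.

Lemma diffn_step k : diffn setT k step.
Proof.
have oT : open [set: R] by exact: openT.
have h : diffn setT k (fun t : R => flat 0 (-1 * t + 1)).
  exact/diffn_affine/diffn_flat.
apply: (@diffnM _ _ _ (flat 0) (fun t => (flat 0 t + flat 0 (1 - t))^-1)) => //.
  exact: diffn_flat.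
apply: diffnV => //; first by move=> t _; rewrite gt_eqF// step_den_gt0.
apply: diffnD => //; first exact: diffn_flat.
apply: eq_diffn h => // t _; congr flat; ring.
Qed.

Lemma derivable_step t : derivable step t 1.
Proof. by have [+ _] := diffn_step 1; apply. Qed.

Lemma derive1_step_out t : t \notin `[0, 1] -> derive1 step t = 0.
Proof.
rewrite in_itv/= negb_and -!ltNge => /orP[t0|t1].
- have oA : open [set y : R | y < 0] by exact: open_lt.
  rewrite (@eq_on_derive1 _ _ step (fun=> 0) t oA _ t0) ?derive1_cst//.
  by move=> y /= /ltW; exact: step_le0.
- have oA : open [set y : R | 1 < y] by exact: open_gt.
  rewrite (@eq_on_derive1 _ _ step (fun=> 1) t oA _ t1) ?derive1_cst//.
  by move=> y /= /ltW; exact: step_ge1.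
Qed.

Lemma continuous_derive1_step : continuous (derive1 step).
Proof.
move=> t; apply/differentiable_continuous/derivable1_diffP.
by have [_ [+ _]] := diffn_step 2; apply.
Qed.

Lemma derive1_step_bounded : exists M : R, forall t, `|derive1 step t| <= M.
Proof.
have cn : {within `[0, 1], continuous (fun t => `|derive1 step t|)}.
  apply: continuous_subspaceT => t.
  by apply: continuous_comp; [exact: continuous_derive1_step|exact: norm_continuous].
have [c _ hc] := EVT_max ler01 cn.
exists `|derive1 step c| => t; have [t01|t01] := boolP (t \in `[0, 1]).
  exact: hc.
by rewrite derive1_step_out// normr0.
Qed.

(** Equal to 1 on [x + e, y], and 0 outside [x, y + e]. *)
Definition plateau x y e t : R := step ((t - x) / e) - step ((t - y) / e).

Lemma diffn_step_affine k x e : diffn setT k (fun t => step ((t - x) / e)).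
Proof.
have oT : open [set: R] by exact: openT.
apply: (@eq_diffn _ _ _ (fun t => step (e^-1 * t + - x * e^-1))) => //.
  by move=> t _; congr step; ring.
exact/diffn_affine/diffn_step.
Qed.

Lemma smooth_plateau x y e : smooth_on setT (plateau x y e).
Proof.
have oT : open [set: R] by exact: openT.
apply/smooth_diffn => k.
apply: diffnD => //; first exact: diffn_step_affine.
apply: diffnN => //; exact: diffn_step_affine.
Qed.

Lemma is_derive_step_affine x e t :
  is_derive t 1 (fun t => step ((t - x) / e)) (e^-1 * derive1 step ((t - x) / e)).
Proof.
have -> : (fun t => step ((t - x) / e)) = (fun t => step (e^-1 * t + - x * e^-1)).
  by apply/funext => u; congr step; ring.
have -> : (t - x) / e = e^-1 * t + - x * e^-1 by ring.
exact: is_derive_affine derivable_step.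
Qed.

Lemma derive1_plateau x y e t : derive1 (plateau x y e) t =
  e^-1 * derive1 step ((t - x) / e) - e^-1 * derive1 step ((t - y) / e).
Proof.
rewrite derive1E.
by have [_ ->] := is_deriveB (is_derive_step_affine x e t) (is_derive_step_affine y e t).
Qed.

Lemma plateau_out x y e t : 0 < e -> x <= y -> t \notin `[x, y + e] ->
  plateau x y e t = 0.
Proof.
move=> e0 xy; rewrite in_itv/= negb_and -!ltNge => /orP[tx|yt]; rewrite /plateau.
  rewrite !step_le0 ?subrr// pmulr_lle0 ?invr_gt0// subr_le0; last exact: ltW.
  exact: le_trans (ltW tx) xy.
rewrite !step_ge1 ?subrr// ler_pdivlMr// mul1r; lra.
Qed.

Lemma plateau_in x y e t : 0 < e -> x + e <= t <= y -> plateau x y e t = 1.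
Proof.
move=> e0 /andP[xt ty]; rewrite /plateau step_ge1; last first.
  by rewrite ler_pdivlMr// mul1r; lra.
by rewrite step_le0 ?subr0// pmulr_lle0 ?invr_gt0// subr_le0.
Qed.

Lemma plateau_01 x y e t : 0 < e -> x + e <= y -> 0 <= plateau x y e t <= 1.
Proof.
move=> e0 xy; rewrite /plateau; have [ty|/ltW yt] := leP t y.
  rewrite (@step_le0 ((t - y) / e)) ?subr0 ?step_ge0 ?step_le1//.
  by rewrite pmulr_lle0 ?invr_gt0// subr_le0.
rewrite (@step_ge1 ((t - x) / e)); last by rewrite ler_pdivlMr// mul1r; lra.
by rewrite subr_ge0 step_le1 gerBl step_ge0.
Qed.

Lemma normr_plateau x y e t : `|plateau x y e t| <= 1.
Proof.
rewrite /plateau ler_norml; apply/andP.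
have := step_ge0 ((t - x) / e); have := step_le1 ((t - x) / e).
have := step_ge0 ((t - y) / e); have := step_le1 ((t - y) / e).
by move=> *; split; lra.
Qed.

End smooth_step.

(** * Real-valued integrals, test functions and weak derivatives *)

Section real_integrals.
Context {R : realType}.
Notation mu := (@lebesgue_measure R).
Implicit Types (D : set R) (f g h : R -> R) (a b x y : R).

Definition intg D f := mu.-integrable D (EFin \o f).

Lemma intg_measurable D f : intg D f -> measurable_fun D f.
Proof. by move=> /integrableP[/measurable_EFinP]. Qed.

Lemma eq_intg D f g : (forall x, D x -> f x = g x) -> measurable D -> intg D f -> intg D g.
Proof.
move=> fg mD; apply: eq_integrable => // x /set_mem Dx.
by rewrite /= fg.
Qed.

Lemma intgD D f g : measurable D -> intg D f -> intg D g ->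
  intg D (fun x => f x + g x).
Proof.
by move=> mD fi gi; have := @integrableD _ _ _ mu D mD _ _ fi gi.
Qed.

Lemma intgZ D c f : measurable D -> intg D f -> intg D (fun x => c * f x).
Proof. by move=> mD fi; have := @integrableZl _ _ _ mu D mD c _ fi. Qed.

Lemma intgB D f g : measurable D -> intg D f -> intg D g ->
  intg D (fun x => f x - g x).
Proof.
by move=> mD fi gi; have := @integrableB _ _ _ mu D mD _ _ fi gi.
Qed.

Lemma intg_le D f g : measurable D -> measurable_fun D f ->
  (forall x, D x -> `|f x| <= g x) -> intg D g -> intg D f.
Proof.
move=> mD mf fg gi; apply: (@le_integrable _ _ _ mu D mD (EFin \o f) (EFin \o g) _ _ gi).
  exact/measurable_EFinP.
by move=> x Dx; rewrite /= lee_fin (le_trans (fg _ Dx))// ler_norm.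
Qed.

Lemma intg_Mb D f g (M : R) : measurable D -> measurable_fun D f ->
  (forall x, D x -> `|f x| <= M) -> intg D g -> intg D (fun x => f x * g x).
Proof.
move=> mD mf fM gi; apply: (@intg_le _ _ (fun x => M * `|g x|)) => //.
- by apply: measurable_funM => //; exact: intg_measurable.
- by move=> x Dx; rewrite normrM ler_wpM2r// fM.
- by apply: intgZ => //; exact: integrable_norm.
Qed.

Lemma intgS D E f : measurable D -> measurable E -> D `<=` E -> intg E f ->
  intg D f.
Proof. by move=> mD mE DE; exact: integrableS. Qed.

Lemma intg_segment a b f : {within `[a, b], continuous f} -> intg `[a, b] f.
Proof.
by move=> cf; apply: continuous_compact_integrable => //; exact: segment_compact.
Qed.

Lemma intg_bounded_oo (r : R) f (M : R) : 0 < r -> measurable_fun `]0, r[ f ->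
  (forall x, 0 < x < r -> `|f x| <= M) -> intg `]0, r[ f.
Proof.
move=> r0 mf fM.
have fin : (mu `]0%R, r[ < +oo)%E.
  by rewrite lebesgue_measure_itv/= lte_fin r0 -EFinB ltry.
apply: measurable_bounded_integrable => //.
exists M; split; first exact: num_real.
by move=> N MN x /= xr; rewrite (le_trans (fM _ xr))// ltW.
Qed.

Lemma within_continuousM D f g : {within D, continuous f} ->
  {within D, continuous g} -> {within D, continuous (fun t => f t * g t)}.
Proof. by move=> cf cg t; apply: cvgM; [exact: cf|exact: cg]. Qed.

Lemma within_continuousN D f : {within D, continuous f} ->
  {within D, continuous (fun t => - f t)}.
Proof. by move=> cf t; apply: cvgN; exact: cf. Qed.

Lemma within_continuous_cst D (c : R) : {within D, continuous (fun=> c)}.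
Proof. by move=> t; exact: cvg_cst. Qed.

Lemma within_continuous_inv (r : R) : {within `]0, r], continuous (fun t : R => t^-1)}.
Proof.
apply: continuous_in_subspaceT => t; rewrite inE/= in_itv/= => /andP[t0 _].
by apply: inv_continuous; rewrite gt_eqF.
Qed.

(** Support in a compact interval inside ]0, r[ is the form in which
    test functions are used; see [test_functionP]. *)
Definition supported a b f := forall t, t \notin `[a, b] -> f t = 0.

Lemma supported_patch D a b f : `[a, b] `<=` D -> supported a b f ->
  f \_ D = f \_ `[a, b].
Proof.
move=> abD sf; apply/funext => x; rewrite !patchE.
case: ifPn => [xD|xD]; case: ifPn => // xab.
  by apply: sf; apply: contra xab => xab; apply/mem_set.
by move/negP: xD => []; apply/mem_set/abD/set_mem.
Qed.

Lemma supported_intg D a b f : measurable D -> `[a, b] `<=` D ->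
  supported a b f -> intg `[a, b] f -> intg D f.
Proof.
move=> mD abD sf; rewrite /intg => /integrable_mkcond h.
apply/integrable_mkcond => //; rewrite restrict_EFin (supported_patch abD)//.
by rewrite -restrict_EFin; exact: h.
Qed.

Lemma supported_Rintegral D a b f : `[a, b] `<=` D -> supported a b f ->
  \int[mu]_(x in D) f x = \int[mu]_(x in `[a, b]) f x.
Proof.
by move=> abD sf; rewrite Rintegral_mkcond (supported_patch abD)// -Rintegral_mkcond.
Qed.

Lemma supportedM a b f g : supported a b f -> supported a b (fun x => g x * f x).
Proof. by move=> sf t tab; rewrite sf// mulr0. Qed.

Lemma supported_derive1 a b f : supported a b f -> supported a b (derive1 f).
Proof.
move=> sf t tab; have oA : open (~` `[a, b]) by apply/closed_openC/interval_closed.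
rewrite (@eq_on_derive1 _ _ f (fun=> 0) t oA) ?derive1_cst//.
  by move=> x /= xab; apply: sf; apply/negP.
by move=> /=; apply/negP.
Qed.

Lemma supported_sub a b a' b' f : a' <= a -> b <= b' -> supported a b f ->
  supported a' b' f.
Proof.
move=> aa bb sf t tab; apply: sf; apply: contra tab.
by rewrite !in_itv/= => /andP[at_ tb]; rewrite (le_trans aa)//= (le_trans tb).
Qed.

Lemma smooth_continuous f : smooth_on setT f -> continuous f.
Proof.
by move=> sf t; apply/differentiable_continuous/derivable1_diffP; exact: (sf 0%N).
Qed.

Lemma smooth_derive1 A f : smooth_on A f -> smooth_on A (derive1 f).
Proof. by move=> sf n x Ax; rewrite -derive1Sn; exact: sf. Qed.

Lemma test_functionP (r : R) f : 0 < r -> test_function `]0, r[ f <->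
  smooth_on setT f /\ exists a b, [/\ 0 < a, a < b, b < r & supported a b f].
Proof.
move=> r0; split.
- move=> [sf cf fr]; split => //; set K := closure _ in cf fr.
  have sK t : ~ K t -> f t = 0.
    move=> nK; apply: contrapT => /eqP ft0; apply: nK.
    exact: subset_closure.
  have [K0|/set0P K0] := eqVneq K set0.
    exists (r / 3), (r / 2); split; [lra|lra|lra|].
    by move=> t _; apply: sK; rewrite K0.
  have cid : {within K, continuous (@idfun R)}.
    by apply: continuous_subspaceT => x; exact: cvg_id.
  have [b /set_mem Kb hb] := compact_EVT_max K0 cf cid.
  have [a /set_mem Ka ha] := compact_EVT_min K0 cf cid.
  have /= := fr _ Ka; rewrite in_itv/= => /andP[a0 ar].
  have /= := fr _ Kb; rewrite in_itv/= => /andP[b0 br].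
  have ab : a <= b by apply: (hb a); exact/mem_set.
  exists a, ((b + r) / 2); split; [lra|lra|lra|].
  move=> t; rewrite in_itv/= negb_and -!ltNge => tab; apply: sK => Kt.
  have := hb _ (mem_set Kt); have := ha _ (mem_set Kt) => /= at_ tb.
  by case/orP: tab => h; lra.
- move=> [sf [a [b [a0 ab br sab]]]].
  have clK : closure [set x | f x != 0] `<=` `[a, b].
    have -> : [set` `[a, b]] = closure `[a, b].
      by apply/closure_id; exact: interval_closed.
    apply: closure_subset => x /= fx0; apply: contraT => xab.
    by move: fx0; rewrite sab ?eqxx.
  split => //.
  - apply: (subclosed_compact _ (@segment_compact _ a b)) => //.
    exact: closed_closure.
  - apply: (subset_trans clK) => x /=; rewrite !in_itv/= => /andP[ax xb].
    by rewrite (lt_le_trans a0 ax) (le_lt_trans xb br).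
Qed.

Lemma segment_sub_oo a b r : 0 < a -> b < r -> `[a, b] `<=` `]0, r[.
Proof.
move=> a0 br x /=; rewrite !in_itv/= => /andP[ax xb].
by rewrite (lt_le_trans a0 ax) (le_lt_trans xb br).
Qed.

Lemma locally_intg r f a b : locally_integrable `]0, r[ f -> 0 < a -> b < r ->
  intg `[a, b] f.
Proof.
move=> [mf _ fi] a0 br; apply/integrableP; split.
  by apply/measurable_EFinP; apply: measurable_funS mf => //; exact: segment_sub_oo.
by apply: fi; [exact: segment_sub_oo|exact: segment_compact].
Qed.

Lemma within_continuous_locally r f : {within `]0, r[, continuous f} ->
  locally_integrable `]0, r[ f.
Proof.
move=> cf; have oI : open (`]0, r[%classic : set R) by exact: interval_open.
split => //; first exact: subspace_continuous_measurable_fun.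
move=> K KI cK.
by have /integrableP[] := continuous_compact_integrable cK (continuous_subspaceW KI cf).
Qed.

Lemma locally_intg_test r f a b h : locally_integrable `]0, r[ f ->
  0 < a -> b < r -> continuous h -> supported a b h ->
  intg `]0, r[ (fun x => f x * h x).
Proof.
move=> lf a0 br ch sh; apply: (@supported_intg _ a b) => //.
- exact: segment_sub_oo.
- exact: supportedM.
have cn : {within `[a, b], continuous (fun t => `|h t|)}.
  apply: continuous_subspaceT => t.
  by apply: continuous_comp; [exact: ch|exact: norm_continuous].
have [ba|ab] := ltP b a.
  by rewrite set_itv_ge -?leNgt ?bnd_simp// /intg; apply: integrable_set0.
have [c _ hc] := EVT_max ab cn.
apply: (@eq_intg _ (fun x => h x * f x)) => //.
  by move=> x _; rewrite mulrC.
apply: (@intg_Mb _ _ _ `|h c|) => //.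
- by apply: measurable_funTS; exact: continuous_measurable_fun.
- exact: locally_intg lf a0 br.
Qed.

Lemma Rintegral_EFin D f : measurable D -> intg D f ->
  (\int[mu]_(x in D) (f x)%:E)%E = (\int[mu]_(x in D) f x)%:E.
Proof. by move=> mD fi; rewrite fineK//; exact: integrable_fin_num. Qed.

(** On test functions all the integrals converge, so the
    extended real identity of the definition becomes a real one. *)
Lemma weak_derivativeP r f g : 0 < r -> is_weak_derivative `]0, r[ f g <->
  [/\ locally_integrable `]0, r[ f, locally_integrable `]0, r[ g &
   forall phi a b, smooth_on setT phi -> 0 < a -> a < b -> b < r ->
     supported a b phi ->
     \int[mu]_(x in `]0, r[) (f x * derive1 phi x) =
     - \int[mu]_(x in `]0, r[) (g x * phi x)].
Proof.
move=> r0; split => -[lf lg fg]; split => //.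
- move=> phi a b sphi a0 ab br sab.
  have tphi : test_function `]0, r[ phi.
    by apply/test_functionP => //; split => //; exists a, b.
  rewrite [in LHS]/Rintegral fg// fineN//.
- move=> phi /test_functionP[//|sphi [a [b [a0 ab br sab]]]].
  have cphi := smooth_continuous sphi.
  have cphi' := smooth_continuous (smooth_derive1 sphi).
  rewrite !Rintegral_EFin//=.
  + by rewrite (fg _ a b).
  + exact: locally_intg_test lg a0 br cphi sab.
  + exact: locally_intg_test lf a0 br cphi' (supported_derive1 sab).
Qed.

Lemma weak_derivative_test (r : R) w g f a b : is_weak_derivative `]0, r[ w g ->
  smooth_on setT f -> 0 < a -> a < b -> b < r -> supported a b f ->
  \int[mu]_(t in `]0, r[) (g t * f t) =
  - \int[mu]_(t in `[a, b]) (w t * derive1 f t).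
Proof.
move=> wg sf a0 ab br sab; have r0 : 0 < r := lt_trans (lt_trans a0 ab) br.
have /weak_derivativeP[//|_ _ /(_ f a b sf a0 ab br sab) E] := wg.
have sub : `[a, b] `<=` `]0, r[ by exact: segment_sub_oo.
rewrite -(supported_Rintegral sub (supportedM w (supported_derive1 sab))).
by rewrite E opprK.
Qed.

End real_integrals.

(** * Weak derivatives of continuous functions *)

Section du_bois_reymond.
Context {R : realType}.
Notation mu := (@lebesgue_measure R).
Implicit Types (D : set R) (f g h w : R -> R) (a b x y e r : R).

Lemma dominated_cvg_Rintegral D (f_ : nat -> R -> R) f g : measurable D ->
  (forall n, measurable_fun D (f_ n)) -> measurable_fun D f ->
  (forall x, D x -> f_ n x @[n --> \oo] --> f x) ->
  (forall n x, D x -> `|f_ n x| <= g x) -> intg D g ->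
  intg D f /\ \int[mu]_(x in D) f_ n x @[n --> \oo] --> \int[mu]_(x in D) f x.
Proof.
move=> mD mf_ mf cvf dom ig.
have [|||||fi _ cv] := @dominated_convergence _ _ _ mu D mD
    (fun n => EFin \o f_ n) (EFin \o f) (EFin \o g).
- by move=> n; apply/measurable_EFinP; exact: mf_.
- exact/measurable_EFinP.
- by apply: aeW => x Dx; apply: cvg_EFin; [exact: nearW|exact: cvf].
- exact: ig.
- by apply: aeW => x n Dx; rewrite /= lee_fin dom.
split => //; apply: fine_cvg; rewrite fineK//; exact: integrable_fin_num.
Qed.

Lemma FTC2_within a b f F : a < b ->
  {within `[a, b], continuous f} -> {within `[a, b], continuous F} ->
  (forall t, t \in `]a, b[ -> is_derive t 1 F (f t)) ->
  \int[mu]_(x in `[a, b]) f x = F b - F a.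
Proof.
move=> ab cf cF dF; rewrite /Rintegral (@continuous_FTC2 _ f F a b)//.
- have /(continuous_within_itvP _ ab)[_ ca cb] := cF.
  by split => // t /dF [].
- by move=> t /dF [_ <-]; rewrite derive1E.
Qed.

Lemma Rintegral_segment_cst a b (c : R) : a <= b ->
  \int[mu]_(x in `[a, b]) c = c * (b - a).
Proof.
move=> ab; rewrite Rintegral_cst//= lebesgue_measure_itv/= lte_fin.
case: ifPn => //=; rewrite -leNgt => ba.
have -> : b = a by lra.
by rewrite subrr mulr0.
Qed.

Lemma le_Rintegral_bound a b f (K : R) : a <= b -> intg `[a, b] f ->
  (forall t, t \in `[a, b] -> `|f t| <= K) ->
  `|\int[mu]_(x in `[a, b]) f x| <= K * (b - a).
Proof.
move=> ab fi fK; rewrite -Rintegral_segment_cst//.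
apply: (le_trans (le_normr_Rintegral _ _)) => //.
apply: le_Rintegral => //.
- exact: integrable_norm.
- by apply: (@intg_segment _ a b (fun=> K)); apply: continuous_subspaceT => ?; exact: cvg_cst.
Qed.

Lemma interior_continuous r w x : {within `]0, r[, continuous w} -> 0 < x < r ->
  {for x, continuous w}.
Proof.
move=> + xr; rewrite continuous_open_subspace; last exact: interval_open.
by apply; rewrite inE/= in_itv.
Qed.

(** The derivative of a rescaled step is a bump of mass 1 on
    [x, x + e]. *)
Lemma step_mollify r w x : {within `]0, r[, continuous w} -> 0 < x < r ->
  forall eps : R, 0 < eps -> exists2 d, 0 < d & forall e, 0 < e <= d -> x + e < r ->
   `|\int[mu]_(t in `]0, r[) (w t * (e^-1 * derive1 step ((t - x) / e))) - w x|
   <= eps.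
Proof.
move=> cw xr eps eps0; have [M hM] := @derive1_step_bounded R.
have M0 : 0 <= M by apply: le_trans (hM 0).
have /cvgrPdist_le/(_ (eps / (M + 1))) := interior_continuous cw xr.
rewrite divr_gt0//; last lra.
move=> /(_ isT)/nbhs_ballP[d /= d0 hd].
exists (d / 2); first by rewrite divr_gt0.
move=> e /andP[e0 ed] xer; have /andP[x0 _] := xr.
set rho := fun t => e^-1 * derive1 step ((t - x) / e).
have crho : continuous rho.
  move=> t; apply: cvgM; first exact: cvg_cst.
  apply: (@continuous_comp _ _ _ (fun t => (t - x) / e) (derive1 step)).
    apply: cvgM; last exact: cvg_cst.
    by apply: cvgB; [exact: cvg_id|exact: cvg_cst].
  exact: continuous_derive1_step.
have srho : supported x (x + e) rho.
  move=> t; rewrite in_itv/= => txe; rewrite /rho derive1_step_out ?mulr0//.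
  by rewrite in_itv/= ler_pdivlMr// mul0r subr_ge0 ler_pdivrMr// mul1r lerBlDl.
have sub : `[x, x + e] `<=` `]0, r[ by exact: segment_sub_oo.
have xe : x < x + e by rewrite ltrDl.
have cws : {within `[x, x + e], continuous w} by exact: continuous_subspaceW cw.
have crs : {within `[x, x + e], continuous rho} by exact: continuous_subspaceT.
have iw : intg `[x, x + e] (fun t => w t * rho t).
  by apply: intg_segment => t; apply: cvgM; [exact: cws|exact: crs].
have irho : \int[mu]_(t in `[x, x + e]) rho t = 1.
  apply: (etrans (@FTC2_within _ _ _ (fun t => step ((t - x) / e)) xe crs _ _)).
  - apply: continuous_subspaceT => t.
    apply/differentiable_continuous/derivable1_diffP.
    by have [] := is_derive_step_affine x e t.
  - by move=> t _; exact: is_derive_step_affine.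
  - rewrite (_ : x + e - x = e); last by ring.
    rewrite divff ?gt_eqF// subrr mul0r.
    by rewrite step_ge1// step_le0// subr0.
rewrite (supported_Rintegral sub (supportedM _ srho)).
have -> : w x = \int[mu]_(t in `[x, x + e]) (w x * rho t).
  by rewrite RintegralZl ?irho ?mulr1//; exact: intg_segment.
rewrite -RintegralB//; last first.
  by apply: intgZ => //; exact: intg_segment.
have -> : eps = eps / e * (x + e - x) by rewrite (_ : x + e - x = e) ?divfK ?gt_eqF//; ring.
apply: le_Rintegral_bound; first exact: ltW.
  by apply: intgB => //; apply: intgZ => //; exact: intg_segment.
move=> t; rewrite in_itv/= => /andP[xt te].
rewrite -mulrBl normrM /rho normrM [`|e^-1|]gtr0_norm ?invr_gt0//.
rewrite mulrCA mulrC ler_pM2r ?invr_gt0//.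
have h1 : `|w t - w x| <= eps / (M + 1).
  rewrite distrC; apply: hd; rewrite /ball/= ltr_norml; lra.
apply: (le_trans (ler_pM _ _ h1 (hM _))) => //.
by rewrite -mulrA ler_piMr ?(ltW eps0)// ler_pdivrMl; lra.
Qed.

(** The fundamental theorem of calculus for weak
    derivatives: test against plateaus that converge to the indicator of
    ]x, y].  The derivative of such a plateau is the difference of two bumps of
    mass 1, at x and at y. *)
Theorem weak_derivative_increment r w g x y : {within `]0, r[, continuous w} ->
  is_weak_derivative `]0, r[ w g -> 0 < x -> x < y -> y < r ->
  \int[mu]_(t in `[x, y]) g t = w y - w x.
Proof.
move=> cw wg x0 xy yr; have r0 : 0 < r by lra.
have /weak_derivativeP[//|lw lg hwg] := wg.
(* bumps of width at most d, so that the plateaus stay inside ]0, r[ and do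
   reach the value 1 *)
pose d : R := Num.min (r - y) (y - x) / 2.
have d0 : 0 < d by rewrite divr_gt0// lt_min; apply/andP; split; lra.
have dry : d < r - y /\ d < y - x.
  rewrite /d; have : 0 < Num.min (r - y) (y - x).
    by rewrite lt_min; apply/andP; split; lra.
  have : Num.min (r - y) (y - x) <= r - y by rewrite ge_min lexx.
  have : Num.min (r - y) (y - x) <= y - x by rewrite ge_min lexx orbT.
  by split; lra.
pose e n : R := d * n.+1%:R^-1.
have e0 n : 0 < e n by rewrite mulr_gt0// invr_gt0 ltr0n.
have ed n : e n <= d by rewrite ler_piMr ?(ltW d0)// invf_le1 ?ler1n// ltr0n.
have cve : e n @[n --> \oo] --> (0:R).
  rewrite -(mulr0 d); apply: cvgM; first exact: cvg_cst.
  exact: cvg_harmonic.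
have cvJ z : 0 < z <= y -> \int[mu]_(t in `]0, r[)
    (w t * ((e n)^-1 * derive1 step ((t - z) / e n))) @[n --> \oo] --> w z.
  move=> /andP[z0 zy]; have zr : 0 < z < r by apply/andP; split; lra.
  apply/cvgrPdist_le => eps eps0.
  have [d' d'0 hd'] := step_mollify cw zr eps0.
  have /cvgrPdist_le/(_ _ d'0) := cve.
  apply: filterS => n; rewrite sub0r normrN gtr0_norm// => en.
  rewrite distrC; apply: hd'; first by rewrite e0.
  by have := ed n; lra.
have lhs n : \int[mu]_(t in `]0, r[) (w t * derive1 (plateau x y (e n)) t) =
  \int[mu]_(t in `]0, r[) (w t * ((e n)^-1 * derive1 step ((t - x) / e n))) -
  \int[mu]_(t in `]0, r[) (w t * ((e n)^-1 * derive1 step ((t - y) / e n))).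
  have iJ z : 0 < z <= y ->
      intg `]0, r[ (fun t => w t * ((e n)^-1 * derive1 step ((t - z) / e n))).
    move=> /andP[z0 zy].
    apply: (@locally_intg_test _ _ _ z (z + d)) => //; first lra.
    - move=> t; apply: cvgM; first exact: cvg_cst.
      apply: (@continuous_comp _ _ _ (fun t => (t - z) / e n) (derive1 step)).
        apply: cvgM; last exact: cvg_cst.
        by apply: cvgB; [exact: cvg_id|exact: cvg_cst].
      exact: continuous_derive1_step.
    - move=> t; rewrite in_itv/= => tze; rewrite derive1_step_out ?mulr0//.
      rewrite in_itv/= ler_pdivlMr// mul0r subr_ge0 ler_pdivrMr// mul1r lerBlDl.
      apply: contra tze => /andP[-> te] /=; apply: (le_trans te).
      by rewrite lerD2l.
  rewrite -RintegralB//; [|apply: iJ; lra|apply: iJ; lra].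
  by apply: eq_Rintegral => t _; rewrite derive1_plateau mulrBr.
have xyd : x + d <= y by lra.
have sb n : supported x (y + d) (plateau x y (e n)).
  move=> t txy; apply: plateau_out => //; first exact: ltW.
  apply: contra txy; rewrite !in_itv/= => /andP[-> te] /=.
  by apply: (le_trans te); rewrite lerD2l.
have rhs n : \int[mu]_(t in `]0, r[) (w t * derive1 (plateau x y (e n)) t) =
    - \int[mu]_(t in `[x, y + d]) (g t * plateau x y (e n) t).
  rewrite (hwg _ x (y + d)) //; [|exact: smooth_plateau|lra|lra].
  congr (- _); apply: (@supported_Rintegral _ _ x (y + d)).
    by apply: segment_sub_oo => //; lra.
  exact: supportedM.
have ig : intg `[x, y + d] g by apply: locally_intg lg _ _ => //; lra.
have mb n : measurable_fun `[x, y + d] (plateau x y (e n)).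
  apply: measurable_funTS; apply: continuous_measurable_fun.
  by apply: smooth_continuous; exact: smooth_plateau.
have mg := intg_measurable ig.
have [||||_ cvR] := @dominated_cvg_Rintegral `[x, y + d]
  (fun n t => g t * plateau x y (e n) t) (g \_ `]x, y]) (fun t => `|g t|)
  (measurable_itv _) _ _ _ _ (integrable_norm ig).
- by move=> n; exact: measurable_funM.
- apply/measurable_restrict => //; apply: measurable_funS mg => //.
- move=> t /=; rewrite in_itv/= => /andP[xt td]; rewrite patchE.
  case: ifPn => [/set_mem/=|txy].
    rewrite in_itv/= => /andP[xt' ty].
    apply: cvg_near_cst.
    have tx0 : 0 < t - x by lra.
    have /cvgrPdist_le/(_ _ tx0) := cve.
    apply: filterS => n; rewrite sub0r normrN gtr0_norm// => en.
    by rewrite plateau_in ?mulr1//; lra.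
  have [tx|tx] := eqVneq t x.
    apply: cvg_near_cst; apply: nearW => n.
    by rewrite /plateau !step_le0 ?subrr ?mulr0// tx ?subrr ?mul0r// pmulr_lle0 ?invr_gt0//; lra.
  have yt : y < t.
    rewrite ltNge; apply: contra txy => ty; apply/mem_set => /=.
    by rewrite in_itv/= lt_neqAle eq_sym tx xt.
  apply: cvg_near_cst.
  have ty0 : 0 < t - y by lra.
  have /cvgrPdist_le/(_ _ ty0) := cve.
  apply: filterS => n; rewrite sub0r normrN gtr0_norm// => en.
  by rewrite /plateau !step_ge1 ?subrr ?mulr0// ler_pdivlMr// mul1r; lra.
- by move=> n t _; rewrite normrM ler_piMr// normr_plateau.
have cvL := cvgB (cvJ x _) (cvJ y _).
have cvL' : \int[mu]_(t in `]0, r[) (w t * derive1 (plateau x y (e n)) t)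
    @[n --> \oo] --> w x - w y.
  by under eq_fun do rewrite lhs; apply: cvL; lra.
have cvR' : \int[mu]_(t in `]0, r[) (w t * derive1 (plateau x y (e n)) t)
    @[n --> \oo] --> - \int[mu]_(t in `[x, y + d]) (g \_ `]x, y]) t.
  by under eq_fun do rewrite rhs; exact: cvgN.
have := cvg_unique _ cvL' cvR'; move=> /(_ (@Rhausdorff R)) E.
rewrite -(opprB (w x)) E opprK -Rintegral_mkcondr.
rewrite (_ : `[x, y + d] `&` `]x, y] = `]x, y])%classic; last first.
  apply/setIidr/subset_itv; rewrite bnd_simp; lra.
rewrite Rintegral_itv_obnd_cbnd//.
by apply: intgS ig => //; apply: subset_itv; rewrite bnd_simp; lra.
Qed.

End du_bois_reymond.

Section weak_derivatives.
Context {R : realType}.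
Notation mu := (@lebesgue_measure R).
Implicit Types (D : set R) (f g h w : R -> R) (a b x y e r : R).

Lemma ae_imp (P Q : R -> Prop) : (forall t, P t -> Q t) ->
  {ae mu, forall t, P t} -> {ae mu, forall t, Q t}.
Proof.
by move=> PQ; apply: filterS; first exact: (ae_filter_ringOfSetsType mu).
Qed.

(** By Lebesgue differentiation, applied on the segments
    [1/n, r - 1/n]. *)
Lemma locally_intg_ae_eq r f g :
  locally_integrable `]0, r[ f -> locally_integrable `]0, r[ g ->
  (forall x y, 0 < x -> x < y -> y < r ->
    \int[mu]_(t in `[x, y]) f t = \int[mu]_(t in `[x, y]) g t) ->
  {ae mu, forall t, 0 < t < r -> f t = g t}.
Proof.
move=> lf lg fg.
have seg a b : 0 < a -> b < r -> {ae mu, forall t, a < t < b -> f t = g t}.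
  move=> a0 br; have iF := locally_intg lf a0 br; have iG := locally_intg lg a0 br.
  have ih : intg `[a, b] (fun t => f t - g t) by exact: intgB.
  have lh : locally_integrable setT ((fun t => f t - g t) \_ `[a, b]).
    exact: integrable_locally_restrict.
  have := lebesgue_differentiation lh.
  apply: ae_imp => t lt /andP[at_ tb].
  set h := _ \_ _ in lh lt.
  have iih : mu.-integrable `[a, b] (EFin \o h).
    apply: (eq_intg _ _ ih) => // s sab.
    by rewrite /h patchE mem_set.
  have at' : (a%:E < t%:E)%E by rewrite lte_fin.
  have [_ +] := @FTC1_lebesgue_pt R h (BLeft a) t b tb iih at' lt.
  rewrite [h t]patchE mem_set/=; last by rewrite in_itv/= !ltW.
  move=> E; apply/eqP; rewrite -subr_eq0 -E; apply/eqP.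
  have oA : open (`]a, b[%classic : set R) by exact: interval_open.
  rewrite (@eq_on_derive1 _ _ _ (fun=> 0) t oA) ?derive1_cst//; last first.
    by rewrite /= in_itv/= at_.
  move=> s /=; rewrite in_itv/= => /andP[as_ sb].
  transitivity (\int[mu]_(x in `[a, s]) (f x - g x)).
    apply: eq_Rintegral => x /[!inE]/=; rewrite in_itv/= => /andP[ax xs].
    by rewrite /h patchE mem_set//= in_itv/= ax (le_trans xs)// ltW.
  rewrite RintegralB//.
  - by rewrite fg ?subrr// (lt_trans sb).
  - by apply: locally_intg lf _ _ => //; rewrite (lt_trans sb).
  - by apply: locally_intg lg _ _ => //; rewrite (lt_trans sb).
have := @ae_foralln _ _ _ mu (fun n t => n.+1%:R^-1 < t < r - n.+1%:R^-1 -> f t = g t).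
have h n : {ae mu, forall t, n.+1%:R^-1 < t < r - n.+1%:R^-1 -> f t = g t}.
  by apply: seg; rewrite ?invr_gt0 ?ltr0n// gtrBl invr_gt0 ltr0n.
move=> /(_ h); apply: ae_imp => t ht /andP[t0 tr].
have [n1 hn1] := ltr_add_invr t0; have [n2 hn2] := ltr_add_invr tr.
apply: (ht (maxn n1 n2)).
have l1 : (maxn n1 n2).+1%:R^-1 <= n1.+1%:R^-1 :> R.
  by rewrite lef_pV2 ?posrE ?ltr0n// ler_nat ltnS leq_maxl.
have l2 : (maxn n1 n2).+1%:R^-1 <= n2.+1%:R^-1 :> R.
  by rewrite lef_pV2 ?posrE ?ltr0n// ler_nat ltnS leq_maxr.
apply/andP; split; first by rewrite (le_lt_trans l1)// -[ltLHS]add0r.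
by rewrite ltrBrDr (le_lt_trans _ hn2)// lerD2l.
Qed.

Lemma weak_derivative_ae_unique r f g1 g2 : {within `]0, r[, continuous f} ->
  is_weak_derivative `]0, r[ f g1 -> is_weak_derivative `]0, r[ f g2 ->
  {ae mu, forall t, 0 < t < r -> g1 t = g2 t}.
Proof.
move=> cf w1 w2; apply: locally_intg_ae_eq; [by case: w1|by case: w2|].
move=> x y x0 xy yr.
by rewrite (weak_derivative_increment cf w1)// (weak_derivative_increment cf w2).
Qed.

Lemma is_derive_continuous_oo r f f' :
  (forall t, t \in `]0, r[ -> is_derive t 1 f (f' t)) ->
  {within `]0, r[, continuous f}.
Proof.
move=> df; rewrite continuous_open_subspace; last exact: interval_open.
move=> t; rewrite inE/= => tr.
by apply/differentiable_continuous/derivable1_diffP; have [] := df _ tr.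
Qed.

(** Integration by parts on a segment containing the support
    of the test function. *)
Lemma C1_weak_derivative r f f' : 0 < r ->
  (forall t, t \in `]0, r[ -> is_derive t 1 f (f' t)) ->
  {within `]0, r[, continuous f'} -> is_weak_derivative `]0, r[ f f'.
Proof.
move=> r0 df cf'; have cf := is_derive_continuous_oo df.
apply/weak_derivativeP => //; split.
- exact: within_continuous_locally.
- exact: within_continuous_locally.
move=> phi a b sphi a0 ab br sab.
have cphi := smooth_continuous sphi.
have cphi' := smooth_continuous (smooth_derive1 sphi).
set a' := a / 2; set b' := (b + r) / 2.
have a'0 : 0 < a' by rewrite /a'; lra.
have aa : a' < a by rewrite /a'; lra.
have bb : b < b' by rewrite /b'; lra.
have b'r : b' < r by rewrite /b'; lra.
have sab' : supported a' b' phi by apply: supported_sub sab; exact: ltW.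
have sub : `[a', b'] `<=` `]0, r[ by exact: segment_sub_oo.
have cfs : {within `[a', b'], continuous f} by exact: continuous_subspaceW cf.
have cfs' : {within `[a', b'], continuous f'} by exact: continuous_subspaceW cf'.
have cps : {within `[a', b'], continuous phi} by exact: continuous_subspaceT.
have cps' : {within `[a', b'], continuous (derive1 phi)} by exact: continuous_subspaceT.
have i1 : intg `[a', b'] (fun t => f t * derive1 phi t).
  by apply: intg_segment => t; apply: cvgM; [exact: cfs|exact: cps'].
have i2 : intg `[a', b'] (fun t => f' t * phi t).
  by apply: intg_segment => t; apply: cvgM; [exact: cfs'|exact: cps].
rewrite (supported_Rintegral sub (supportedM _ (supported_derive1 sab'))).
rewrite (supported_Rintegral sub (supportedM _ sab')).
apply/eqP; rewrite -addr_eq0 -RintegralD//; apply/eqP.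
have ab' : a' < b' by lra.
have dF t : t \in `]a', b'[ -> is_derive t 1 (fun t => f t * phi t)
    (f t * derive1 phi t + f' t * phi t).
  move=> tab; have dft := df t (sub _ (subset_itv_oo_cc tab)).
  have dphi : is_derive t 1 phi (derive1 phi t).
    by rewrite derive1E; apply/derivableP; exact: (sphi 0%N).
  apply: (is_derive_eq (is_deriveM dft dphi)).
  by rewrite /GRing.scale/= [phi t * _]mulrC.
have cF : {within `[a', b'], continuous (fun t => f t * phi t)}.
  by move=> t; apply: cvgM; [exact: cfs|exact: cps].
have cF' : {within `[a', b'], continuous (fun t => f t * derive1 phi t + f' t * phi t)}.
  by move=> t; apply: cvgD; apply: cvgM;
    [exact: cfs|exact: cps'|exact: cfs'|exact: cps].
have -> := FTC2_within ab' cF' cF dF.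
rewrite (sab a') ?(sab b') ?mulr0 ?subrr//.
  by rewrite in_itv/= negb_and -!ltNge bb orbT.
by rewrite in_itv/= negb_and -!ltNge aa.
Qed.

Lemma weak_derivativeD r f1 g1 f2 g2 : 0 < r ->
  is_weak_derivative `]0, r[ f1 g1 -> is_weak_derivative `]0, r[ f2 g2 ->
  is_weak_derivative `]0, r[ (fun t => f1 t + f2 t) (fun t => g1 t + g2 t).
Proof.
move=> r0 /weak_derivativeP[//|lf1 lg1 h1] /weak_derivativeP[//|lf2 lg2 h2].
apply/weak_derivativeP => //; split; [exact: locally_integrableD..|].
move=> phi a b sphi a0 ab br sab.
have cphi := smooth_continuous sphi.
have cphi' := smooth_continuous (smooth_derive1 sphi).
have sab' := supported_derive1 sab.
under eq_Rintegral do rewrite mulrDl.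
under [in RHS]eq_Rintegral do rewrite mulrDl.
rewrite RintegralD//; [|exact: locally_intg_test sab'..].
rewrite RintegralD//; [|exact: locally_intg_test sab..].
by rewrite (h1 _ a b)// (h2 _ a b)// opprD.
Qed.

End weak_derivatives.

(** * Functions whose derivative is square integrable with weight t *)

Section weighted_bounds.
Context {R : realType}.
Notation mu := (@lebesgue_measure R).
Implicit Types (D E : set R) (f g h w : R -> R) (a b x y r l : R).

Lemma intg_ae D f g : measurable D -> measurable_fun D g ->
  {ae mu, forall t, D t -> f t = g t} -> intg D f ->
  intg D g /\ \int[mu]_(t in D) g t = \int[mu]_(t in D) f t.
Proof.
move=> mD mg fg fi; have mf := intg_measurable fi.
have fge : ae_eq mu D (EFin \o f) (EFin \o g).
  by apply: ae_imp fg => t fgt Dt; rewrite /= fgt.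
have fga : ae_eq mu D (abse \o (EFin \o f)) (abse \o (EFin \o g)).
  by apply: ae_imp fg => t fgt Dt; rewrite /= fgt.
have mfe : measurable_fun D (EFin \o f) by exact/measurable_EFinP.
have mge : measurable_fun D (EFin \o g) by exact/measurable_EFinP.
split; last first.
  by rewrite /Rintegral; congr fine; exact/esym/ae_eq_integral.
apply/integrableP; split => //.
have /integrableP[_] := fi.
congr (_ < +oo)%E; apply: ge0_ae_eq_integral => //.
- by apply: measurableT_comp => //; exact: mfe.
- by apply: measurableT_comp => //; exact: mge.
Qed.

Lemma L2_onP D f : measurable D ->
  L2_on D f <-> measurable_fun D f /\ intg D (fun x => f x ^+ 2).
Proof.
move=> mD; rewrite /L2_on.
have sqE : (fun x => (f \_ D) x ^+ 2) = (fun x => f x ^+ 2) \_ D.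
  by apply/funext => x; rewrite !patchE; case: ifPn => // _; rewrite expr0n.
split=> [l2f|[mf fi]].
  split.
    have := sub_Lfun_mfun l2f; rewrite inE/= => h; apply/(measurable_restrictT f mD); exact: h.
  have := Lfun2_integrable_sqr l2f; rewrite sqE -restrict_EFin.
  by move=> h; apply/integrable_mkcond.
have mfD : measurable_fun setT (f \_ D) by apply/(measurable_restrictT f mD).
apply/andP; split; first by rewrite inE.
rewrite inE/= /finite_norm unlock/= poweR_lty//.
have : intg setT (fun x => (f \_ D) x ^+ 2).
  rewrite sqE /intg -restrict_EFin.
  by have := (@integrable_mkcond _ _ R mu D (EFin \o (fun x => f x ^+ 2)) mD).1 fi.
move/integrableP => [_]; apply: le_lt_trans; apply: ge0_le_integral => //=.
- apply/measurable_EFinP.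
  apply/(@measurableT_comp _ _ _ _ _ _ (fun x : R => x `^ 2)) => //.
  exact/measurableT_comp.
- apply/measurable_EFinP; apply: measurableT_comp => //.
  exact: measurable_funX.
- by move=> t _; rewrite lee_fin powR_mulrn// normrX.
Qed.

Lemma Rintegral_subset_ge0 D E f : measurable D -> measurable E -> D `<=` E ->
  intg E f -> (forall x, E x -> 0 <= f x) ->
  \int[mu]_(x in D) f x <= \int[mu]_(x in E) f x.
Proof.
move=> mD mE DE fi f0; have fiD := intgS mD mE DE fi.
rewrite -lee_fin -!Rintegral_EFin//; apply: ge0_subset_integral => //.
by apply/measurable_EFinP; exact: intg_measurable fi.
Qed.

Lemma within_oc_oo r w : {within `]0, r], continuous w} ->
  {within `]0, r[, continuous w}.
Proof.
apply: continuous_subspaceW => x /=; rewrite !in_itv/= => /andP[-> xr] /=.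
exact: ltW.
Qed.

(** From (s |z| - 1)^2 >= 0. *)
Lemma amgm_weight (s z : R) : 0 < s -> `|z| <= 2^-1 * (s * z ^+ 2) + (2 * s)^-1.
Proof.
move=> s0; rewrite -(ler_pM2l (mulr_gt0 (@ltr0Sn R 1) s0)) mulrDr mulfV; last first.
  by rewrite mulf_neq0// gt_eqF.
rewrite -(@real_normK _ z) ?num_real//.
have := sqr_ge0 (s * `|z| - 1); nra.
Qed.

Lemma intg_inv a b : 0 < a -> a <= b -> intg `[a, b] (fun t => t^-1) /\
  \int[mu]_(t in `[a, b]) t^-1 = ln b - ln a.
Proof.
move=> a0 ab.
have cV : {within `[a, b], continuous (fun t : R => t^-1)}.
  apply: continuous_in_subspaceT => t; rewrite inE/= in_itv/= => /andP[at_ _].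
  by apply: inv_continuous; rewrite gt_eqF// (lt_le_trans a0).
split; first exact: intg_segment.
move: ab; rewrite le_eqVlt => /predU1P[<-|ab].
  by rewrite set_itv1 Rintegral_set1 subrr.
apply: (FTC2_within ab cV) => [|t].
  apply: continuous_in_subspaceT => t; rewrite inE/= in_itv/= => /andP[at_ _].
  by apply: continuous_ln; rewrite (lt_le_trans a0).
rewrite in_itv/= => /andP[at_ _]; apply: is_derive1_ln; exact: lt_trans at_.
Qed.

(** Bound |g| by l t g^2 / 2 + 1 / (2 l t) and integrate.  The
    parameter l trades the Dirichlet integral against the logarithm: l = 1
    gives growth at 0, a small l gives equicontinuity away from 0. *)
Lemma weighted_increment r w g x y l : {within `]0, r], continuous w} ->
  is_weak_derivative `]0, r[ w g -> intg `]0, r[ (fun t => t * g t ^+ 2) ->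
  0 < x -> x <= y -> y <= r -> 0 < l ->
  `|w y - w x| <= l / 2 * \int[mu]_(t in `]0, r[) (t * g t ^+ 2)
                  + (2 * l)^-1 * (ln y - ln x).
Proof.
move=> cw wg ig x0 xy yr l0; have r0 : 0 < r by lra.
set M := \int[mu]_(t in _) _.
have M0 : 0 <= M.
  apply: Rintegral_ge0 => t /=; rewrite in_itv/= => /andP[t0 _].
  by rewrite mulr_ge0 ?sqr_ge0// ltW.
have main z : x < z -> z < r ->
    `|w z - w x| <= l / 2 * M + (2 * l)^-1 * (ln z - ln x).
  move=> xz zr; have sub : `[x, z] `<=` `]0, r[ by exact: segment_sub_oo.
  rewrite -(weak_derivative_increment (within_oc_oo cw) wg)//.
  have ig1 : intg `[x, z] g by case: wg => _ lg _; exact: locally_intg lg _ _.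
  have [iV <-] := intg_inv x0 (ltW xz).
  have ig2 : intg `[x, z] (fun t => t * g t ^+ 2) by apply: intgS ig.
  have le1 : \int[mu]_(t in `[x, z]) (t * g t ^+ 2) <= M.
    apply: Rintegral_subset_ge0 => // t /=; rewrite in_itv/= => /andP[t0 _].
    by rewrite mulr_ge0 ?sqr_ge0// ltW.
  apply: (@le_trans _ _ (\int[mu]_(t in `[x, z]) (l / 2 * (t * g t ^+ 2) +
      (2 * l)^-1 * t^-1))).
    apply: (le_trans (le_normr_Rintegral _ _)) => //.
    apply: le_Rintegral => //.
    - exact: integrable_norm.
    - by apply: intgD => //; apply: intgZ.
    - move=> t /=; rewrite in_itv/= => /andP[xt _].
      have t0 : 0 < t by exact: lt_le_trans xt.
      have := amgm_weight (g t) (mulr_gt0 l0 t0).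
      by move/le_trans; apply; rewrite le_eqVlt; apply/orP; left; apply/eqP;
        rewrite !invfM; ring.
  rewrite RintegralD//; [|exact: intgZ..].
  rewrite RintegralZl// RintegralZl// lerD2r ler_wpM2l// ltW//.
  by rewrite divr_gt0.
move: xy; rewrite le_eqVlt => /predU1P[<-|xy].
  by rewrite !subrr normr0 mulr0 addr0 mulr_ge0// ltW// divr_gt0.
move: yr; rewrite le_eqVlt => /predU1P[yr|]; last exact: main.
subst y.
have cwr : {within `[x, r], continuous w}.
  by apply: continuous_subspaceW cw; apply: subset_itvr; rewrite bnd_simp.
have /(continuous_within_itvP _ xy)[_ _ cr] := cwr.
have cn : `|w z - w x| @[z --> r^'-] --> `|w r - w x|.
  by apply: cvg_norm; apply: cvgB => //; exact: cvg_cst.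
rewrite -(cvg_lim (@Rhausdorff R) cn); apply: limr_le; first exact: cvgP cn.
near=> z; have xz : x < z by near: z; exact: nbhs_left_gt.
have zr : z < r by near: z; exact: nbhs_left_lt.
apply: (le_trans (main z xz zr)); rewrite lerD2l ler_wpM2l//.
  by rewrite invr_ge0 mulr_ge0// ltW.
by rewrite lerD2r ler_ln ?posrE ?(lt_trans x0)// ltW.
Unshelve. all: by end_near. Qed.

(** A logarithm is dominated by an eighth root, whose fourth power is
    the square root. *)
Lemma ln_le_root z : 1 <= z -> exists2 s : R, 1 <= s /\ ln z <= 8 * s &
  s ^+ 4 = Num.sqrt z.
Proof.
move=> z1; have s1 (x : R) : 1 <= x -> 1 <= Num.sqrt x.
  by move=> x1; rewrite -sqrtr1 ler_wsqrtr.
have s2 (x : R) : 1 <= x -> Num.sqrt x ^+ 2 = x.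
  by move=> x1; rewrite sqr_sqrtr// (le_trans ler01).
set s := Num.sqrt (Num.sqrt (Num.sqrt z)).
have s8 : s ^+ 4 = Num.sqrt z.
  by rewrite (exprM s 2 2) /s !s2// !s1.
have hs : 1 <= s by rewrite !s1.
exists s => //; split => //.
have s0 : 0 < s by rewrite (lt_le_trans ltr01).
have -> : ln z = 8 * ln s.
  have <- : s ^+ 8 = z by rewrite (exprM s 4 2) s8 s2.
  by rewrite lnXn// mulr_natl.
rewrite ler_pM2l//.
exact/ltW/ln_sublinear.
Qed.

(** The increment from x to r is at most logarithmic in x, and the
    fourth power of a logarithm is dominated by a square root. *)
Lemma weighted_growth r w g (M : R) : 0 < r -> {within `]0, r], continuous w} ->
  is_weak_derivative `]0, r[ w g -> intg `]0, r[ (fun t => t * g t ^+ 2) ->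
  \int[mu]_(t in `]0, r[) (t * g t ^+ 2) <= M ->
  forall x, 0 < x -> x <= r ->
    w x ^+ 4 * Num.sqrt x <= (`|w r| + M + 4) ^+ 4 * Num.sqrt r.
Proof.
move=> r0 cw wg ig IM x x0 xr.
have M0 : 0 <= M.
  apply: le_trans IM; apply: Rintegral_ge0 => t /=; rewrite in_itv/= => /andP[t0 _].
  by rewrite mulr_ge0 ?sqr_ge0// ltW.
have h := weighted_increment cw wg ig x0 xr (lexx r) ltr01.
have z1 : 1 <= r / x by rewrite ler_pdivlMr// mul1r.
have [s [s1 lns] s4] := ln_le_root z1.
rewrite ln_div ?posrE// in lns.
have ws : `|w x| <= (`|w r| + M + 4) * s.
  have := ler_normB (w r) (w r - w x); rewrite subKr => h2.
  have h3 : `|w r - w x| <= M + 4 * s.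
    apply: (le_trans h); move: IM lns; set I := \int[mu]_(t in _) _ => IM lns.
    rewrite mulr1; lra.
  have : `|w r| <= `|w r| * s by rewrite ler_peMr.
  have : M <= M * s by rewrite ler_peMr.
  by move=> *; apply: (le_trans h2); rewrite mulrDl mulrDl; lra.
have C0 : 0 <= `|w r| + M + 4 by rewrite !addr_ge0.
have w4 : w x ^+ 4 <= (`|w r| + M + 4) ^+ 4 * Num.sqrt (r / x).
  rewrite -s4 -exprMn -[w x ^+ 4]ger0_norm ?exprn_even_ge0// normrX.
  by rewrite lerXn2r// nnegrE// mulr_ge0// (le_trans ler01).
apply: (le_trans (ler_wpM2r (sqrtr_ge0 x) w4)).
rewrite -mulrA -sqrtrM ?divfK ?gt_eqF// divr_ge0// ltW//.
Qed.

End weighted_bounds.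

(** * The energy as the integral of a density *)

Section finite_energy.
Context {R : realType}.
Notation mu := (@lebesgue_measure R).
Variables (a b c L rad : R) (k : int).
Hypotheses (c0 : 0 < c ^+ 2) (L0 : 0 < L) (rad0 : 0 < rad).
Implicit Types (u v gu gv h : R -> R) (x y t : R).

(** The integrand of the energy without the gradient and the k^2 terms;
    the cubic integral is absorbed into it. *)
Definition potential x y : R :=
  - (a ^+ 2 / (2 * L)) * (x ^+ 2 + y ^+ 2)
  + c ^+ 2 / (4 * L) * (x ^+ 2 + y ^+ 2) ^+ 2
  - b ^+ 2 / (3 * Num.sqrt 6 * L) * (y * (y ^+ 2 - 3 * x ^+ 2)).

Lemma normr_cubic x y :
  `|y * (y ^+ 2 - 3 * x ^+ 2)| <= 3 * (x ^+ 2 + y ^+ 2) * `|y|.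
Proof.
rewrite normrM mulrC ler_wpM2r// ler_norml.
by have := sqr_ge0 x; have := sqr_ge0 y => *; apply/andP; split; lra.
Qed.

Lemma potential_coef_ge0 : [/\ 0 <= a ^+ 2 / (2 * L), 0 < c ^+ 2 / (4 * L) &
  0 <= b ^+ 2 / (3 * Num.sqrt 6 * L)].
Proof.
split.
- by rewrite divr_ge0 ?sqr_ge0// mulr_ge0// ltW.
- by rewrite divr_gt0// mulr_gt0.
- by rewrite divr_ge0 ?sqr_ge0// !mulr_ge0 ?sqrtr_ge0// ltW.
Qed.

(** With p = x^2 + y^2 the quadratic and cubic terms are at
    most A p + 3 B p sqrt p, which is dominated by Q p^2 + const. *)
Lemma potential_lower_bound : exists2 C, 0 <= C &
  forall x y, - C <= potential x y.
Proof.
have [A0 Q0 B0] := potential_coef_ge0; rewrite /potential.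
move: (a ^+ 2 / _) (c ^+ 2 / _) (b ^+ 2 / _) A0 Q0 B0 => A Q B A0 Q0 B0.
(* the weight for which |y| <= e p + 1 / (4 e) bounds the cubic term by half
   of the quartic one plus a quadratic one *)
pose e := Q / (6 * B + 1).
have e0 : 0 < e by rewrite divr_gt0//; lra.
have Be : 3 * B * e <= Q / 2.
  by rewrite /e mulrA ler_pdivrMr; nra.
pose D := A + 3 * B / (4 * e).
have D0 : 0 <= D by rewrite addr_ge0// divr_ge0//; lra.
exists (D ^+ 2 / (2 * Q)); first by rewrite divr_ge0 ?sqr_ge0//; lra.
move=> x y; set p := x ^+ 2 + y ^+ 2.
have p0 : 0 <= p by rewrite addr_ge0 ?sqr_ge0.
have hy : `|y| <= e * p + (4 * e)^-1.
  have y2 : `|y| ^+ 2 <= p by rewrite real_normK ?num_real// lerDr sqr_ge0.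
  have e4 : 0 < 4 * e by lra.
  rewrite -(ler_pM2l e4) mulrDr mulfV ?gt_eqF//.
  by have := sqr_ge0 (2 * e * `|y| - 1); nra.
have h1 : B * (y * (y ^+ 2 - 3 * x ^+ 2)) <= 3 * B * e * p ^+ 2 + 3 * B / (4 * e) * p.
  have h := le_trans (ler_norm _) (normr_cubic x y).
  apply: (le_trans (ler_wpM2l B0 h)); rewrite -/p.
  have h2 := ler_wpM2l (mulr_ge0 (mulr_ge0 (ler0n R 3) B0) p0) hy.
  have -> : B * (3 * p * `|y|) = 3 * B * p * `|y| by ring.
  by rewrite (le_trans h2)// le_eqVlt; apply/orP; left; apply/eqP; ring.
have h3 : 3 * B * e * p ^+ 2 <= Q / 2 * p ^+ 2 by rewrite ler_wpM2r ?sqr_ge0.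
have h4 : - (D ^+ 2 / (2 * Q)) <= Q / 2 * p ^+ 2 - D * p.
  have Q2 : 0 < 2 * Q by lra.
  rewrite -mulNr ler_pdivrMr//; have := sqr_ge0 (Q * p - D); nra.
move: h1 h3 h4; rewrite /D; set Z := B * _; set W := 3 * B / _; nra.
Qed.

Lemma quartic_dominates x y : let m := 1 + x ^+ 4 + y ^+ 4 in
  [/\ x ^+ 2 + y ^+ 2 <= m, (x ^+ 2 + y ^+ 2) ^+ 2 <= 2 * m &
      `|y * (y ^+ 2 - 3 * x ^+ 2)| <= 5 * m].
Proof.
move=> m; set p := x ^+ 2 + y ^+ 2.
have pm : p <= m.
  rewrite /p /m (exprM x 2 2) (exprM y 2 2).
  have := sqr_ge0 (x ^+ 2 - 1); have := sqr_ge0 (y ^+ 2 - 1).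
  have := sqr_ge0 (x ^+ 2); have := sqr_ge0 (y ^+ 2); nra.
have p2m : p ^+ 2 <= 2 * m.
  rewrite /p /m (exprM x 2 2) (exprM y 2 2).
  have := sqr_ge0 (x ^+ 2 - y ^+ 2); nra.
split=> //; apply: (le_trans (normr_cubic x y)); rewrite -/p.
have y2 : `|y| ^+ 2 <= p by rewrite real_normK ?num_real// lerDr sqr_ge0.
have := sqr_ge0 (p - `|y|); nra.
Qed.

(** Quartic growth is what [weighted_growth] can integrate. *)
Lemma potential_quartic : exists2 C, 0 <= C &
  forall x y, `|potential x y| <= C * (1 + x ^+ 4 + y ^+ 4).
Proof.
have [A0 Q0 B0] := potential_coef_ge0; rewrite /potential.
move: (a ^+ 2 / _) (c ^+ 2 / _) (b ^+ 2 / _) A0 Q0 B0 => A Q B A0 Q0 B0.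
exists (A + 2 * Q + 5 * B); first by lra.
move=> x y; set p := x ^+ 2 + y ^+ 2; set m := 1 + _ + _.
have p0 : 0 <= p by rewrite addr_ge0 ?sqr_ge0.
have [pm p2m cm] : [/\ p <= m, p ^+ 2 <= 2 * m &
  `|y * (y ^+ 2 - 3 * x ^+ 2)| <= 5 * m] := quartic_dominates x y.
move: cm; set z := y * _ => cm.
apply: (le_trans (ler_normB _ _)).
rewrite [`|B * z|]normrM (ger0_norm B0).
have h1 : `|- A * p + Q * p ^+ 2| <= A * p + Q * p ^+ 2.
  apply: (le_trans (ler_normD _ _)).
  rewrite !normrM normrN (ger0_norm A0) (ger0_norm p0) (gtr0_norm Q0).
  by rewrite expr2.
have := ler_wpM2l A0 pm; have := ler_wpM2l (ltW Q0) p2m.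
by have := ler_wpM2l B0 cm; lra.
Qed.

Definition energy_density u v gu gv t : R :=
  2^-1 * (t * gu t ^+ 2 + t * gv t ^+ 2 + k%:~R ^+ 2 * (u t ^+ 2 / t))
  + t * potential (u t) (v t).

(** A form of admissibility in which the weak derivatives are data
    instead of being chosen by description; the integrability of t v^2 is
    recovered from the growth bound in [admissibleP]. *)
Definition finite_energy u v gu gv : Prop :=
  [/\ {within `]0, rad], continuous u} /\ {within `]0, rad], continuous v},
      is_weak_derivative `]0, rad[ u gu /\ is_weak_derivative `]0, rad[ v gv,
      intg `]0, rad[ (fun t => t * gu t ^+ 2) /\
      intg `]0, rad[ (fun t => t * gv t ^+ 2),
      intg `]0, rad[ (fun t => u t ^+ 2 / t) &
      u rad = s_plus a b c / Num.sqrt 2 /\ v rad = - (s_plus a b c / Num.sqrt 6)].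

Lemma within_measurable u : {within `]0, rad], continuous u} ->
  measurable_fun `]0, rad[ u.
Proof. by move/within_oc_oo; exact: subspace_continuous_measurable_fun. Qed.

(** By [weighted_growth], t u^4 and t v^4 are bounded. *)
Lemma quartic_intg u v gu gv h C : finite_energy u v gu gv ->
  measurable_fun `]0, rad[ h ->
  (forall t, 0 < t < rad -> `|h t| <= C * (1 + u t ^+ 4 + v t ^+ 4)) ->
  intg `]0, rad[ (fun t => t * h t).
Proof.
move=> [[cu cv] [wu wv] [iu iv] _ _] mh hC.
have [Bu hBu] : exists B, forall t, 0 < t -> t <= rad -> u t ^+ 4 * Num.sqrt t <= B.
  by eexists; exact: (weighted_growth rad0 cu wu iu (lexx _)).
have [Bv hBv] : exists B, forall t, 0 < t -> t <= rad -> v t ^+ 4 * Num.sqrt t <= B.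
  by eexists; exact: (weighted_growth rad0 cv wv iv (lexx _)).
apply: (intg_bounded_oo (M := `|C| * (rad + Num.sqrt rad * (`|Bu| + `|Bv|)))) => //.
  by apply: measurable_funM => //; exact: measurable_id.
move=> t /andP[t0 tr].
have h1 := hC t; rewrite t0 tr in h1.
rewrite normrM (gtr0_norm t0).
apply: (le_trans (ler_wpM2l (ltW t0) (h1 isT))).
rewrite mulrCA; set m := 1 + _ + _.
have m0 : 0 <= m by rewrite !addr_ge0// exprn_even_ge0.
apply: (@le_trans _ _ (`|C| * (t * m))).
  by rewrite ler_wpM2r ?ler_norm// mulr_ge0// ltW.
rewrite ler_wpM2l//.
have -> : t * m = t + Num.sqrt t * (u t ^+ 4 * Num.sqrt t + v t ^+ 4 * Num.sqrt t).
  have -> : Num.sqrt t * (u t ^+ 4 * Num.sqrt t + v t ^+ 4 * Num.sqrt t) =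
    Num.sqrt t ^+ 2 * (u t ^+ 4 + v t ^+ 4) by ring.
  by rewrite sqr_sqrtr ?ltW// /m; ring.
apply: lerD; first exact: ltW.
apply: ler_pM; rewrite ?sqrtr_ge0//.
- by rewrite addr_ge0// mulr_ge0 ?sqrtr_ge0// exprn_even_ge0.
- by rewrite ler_wsqrtr// ltW.
- by apply: lerD; apply: le_trans (ler_norm _); [apply: hBu|apply: hBv] => //; exact: ltW.
Qed.

Lemma measurable_potential u v D : measurable_fun D u -> measurable_fun D v ->
  measurable_fun D (fun t => potential (u t) (v t)).
Proof.
move=> mf mv; apply: measurable_funB; last first.
  apply: measurable_funM; first exact: measurable_cst.
  apply: measurable_funM => //; apply: measurable_funB; first exact: measurable_funX.
  apply: measurable_funM; first exact: measurable_cst.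
  exact: measurable_funX.
have mp : measurable_fun D (fun t => u t ^+ 2 + v t ^+ 2).
  by apply: measurable_funD; exact: measurable_funX.
apply: measurable_funD; apply: measurable_funM => //; try exact: measurable_cst.
exact: measurable_funX.
Qed.

Lemma energy_density_intg u v gu gv : finite_energy u v gu gv ->
  intg `]0, rad[ (energy_density u v gu gv).
Proof.
move=> fe; have [[cu cv] _ [iu iv] ivt _] := fe.
apply: intgD => //.
  by apply: intgZ => //; apply: intgD => //; [exact: intgD|exact: intgZ].
have [C _ hC] := potential_quartic.
apply: (quartic_intg fe (C := C)) => //.
by apply: measurable_potential; exact: within_measurable.
Qed.
End finite_energy.

Section energy_value.
Context {R : realType}.
Notation mu := (@lebesgue_measure R).
Variables (a b c L rad : R) (k : int).
Hypotheses (c0 : 0 < c ^+ 2) (L0 : 0 < L) (rad0 : 0 < rad).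
Implicit Types (u v gu gv h : R -> R) (x y t : R).
Local Notation finite_energy := (finite_energy a b c rad).
Local Notation edens := (energy_density a b c L k).
Local Notation potential := (potential a b c L).
Local Notation I := (`]0, rad[%classic : set R).

Lemma ae_conj (P Q : R -> Prop) : {ae mu, forall t, P t} ->
  {ae mu, forall t, Q t} -> {ae mu, forall t, P t /\ Q t}.
Proof. exact: (@filterI _ _ (ae_filter_ringOfSetsType mu)). Qed.

(** Weak derivatives agree almost everywhere, so neither
    finiteness nor the value of the energy depends on their choice. *)
Lemma finite_energy_ae u v gu gv hu hv : finite_energy u v gu gv ->
  is_weak_derivative `]0, rad[ u hu -> is_weak_derivative `]0, rad[ v hv ->
  finite_energy u v hu hv /\
  \int[mu]_(t in `]0, rad[) edens u v hu hv t =
  \int[mu]_(t in `]0, rad[) edens u v gu gv t.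
Proof.
move=> fe wu' wv'; have [[cu cv] [wu wv] [iu iv] ivt bd] := fe.
have aeu := weak_derivative_ae_unique (within_oc_oo cu) wu wu'.
have aev := weak_derivative_ae_unique (within_oc_oo cv) wv wv'.
have mhu : measurable_fun I hu by case: wu' => _ [].
have mhv : measurable_fun I hv by case: wv' => _ [].
have fe' : finite_energy u v hu hv.
  split => //; split.
    apply: (intg_ae _ _ _ iu).1 => //.
      by apply: measurable_funM => //; exact: measurable_funX.
    by apply: ae_imp aeu => t hut /=; rewrite in_itv/= => /hut ->.
  apply: (intg_ae _ _ _ iv).1 => //.
    by apply: measurable_funM => //; exact: measurable_funX.
  by apply: ae_imp aev => t hvt /=; rewrite in_itv/= => /hvt ->.
split => //.
have i1 := energy_density_intg k c0 L0 rad0 fe.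
have i2 := energy_density_intg k c0 L0 rad0 fe'.
apply: (intg_ae _ _ _ i1).2 => //; first exact: intg_measurable.
apply: (ae_imp _ (ae_conj aeu aev)) => t [hut hvt] /=; rewrite in_itv/= => tr.
by rewrite /energy_density hut// hvt.
Qed.

Lemma energyE u v gu gv : finite_energy u v gu gv ->
  energy a b c L rad k u v = (\int[mu]_(t in `]0, rad[) edens u v gu gv t)%:E.
Proof.
move=> fe0; have [_ [wu0 wv0] _ _ _] := fe0.
set U := weak_derivative `]0, rad[ u; set V := weak_derivative `]0, rad[ v.
have wU : is_weak_derivative `]0, rad[ u U by apply: getPex; exists gu.
have wV : is_weak_derivative `]0, rad[ v V by apply: getPex; exists gv.
have [fe <-] := finite_energy_ae fe0 wU wV.
have [[cu cv] _ [iu iv] ivt _] := fe.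
have mu_ := within_measurable cu; have mv_ := within_measurable cv.
have [A0 Q0 B0] := potential_coef_ge0 a b c0 L0.
have m4 t : 0 < 1 + u t ^+ 4 + v t ^+ 4.
  by rewrite -addrA ltr_pwDl// addr_ge0// exprn_even_ge0.
have mp : measurable_fun I (fun t => u t ^+ 2 + v t ^+ 2).
  by apply: measurable_funD; exact: measurable_funX.
have icub : intg I (fun t => t * (v t * (v t ^+ 2 - 3 * u t ^+ 2))).
  apply: (quartic_intg rad0 fe (C := 5)) => //.
    apply: measurable_funM => //; apply: measurable_funB; first exact: measurable_funX.
    apply: measurable_funM; first exact: measurable_cst.
    exact: measurable_funX.
  by move=> t _; have [] := quartic_dominates (u t) (v t).
have iE := energy_density_intg k c0 L0 rad0 fe.
have iB : intg I (fun t => edens u v U V t +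
    b ^+ 2 / (3 * Num.sqrt 6 * L) * (t * (v t * (v t ^+ 2 - 3 * u t ^+ 2)))).
  by apply: intgD => //; apply: intgZ.
have bulkE t : I t -> edens u v U V t +
    b ^+ 2 / (3 * Num.sqrt 6 * L) * (t * (v t * (v t ^+ 2 - 3 * u t ^+ 2))) =
    bulk_density a c L rad k u v t * t.
  move=> /=; rewrite in_itv/= => /andP[t0 _].
  rewrite /energy_density /bulk_density -/U -/V /potential.
  rewrite [k%:~R ^+ 2 / t ^+ 2 * _ in RHS](_ : _ = k%:~R ^+ 2 * (u t ^+ 2 / t) / t); last first.
    by field; rewrite gt_eqF.
  move: (_ / (3 * _ * L)) (_ / (2 * L)) (_ / (4 * L)) => X Y Z.
  have tn0 : t != 0 by rewrite gt_eqF.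
  by field.
rewrite /energy.
rewrite (_ : (\int[mu]_(r in `]0%R, rad[) (bulk_density a c L rad k u v r * r)%:E)%E =
  (\int[mu]_(t in `]0, rad[) (edens u v U V t +
    b ^+ 2 / (3 * Num.sqrt 6 * L) * (t * (v t * (v t ^+ 2 - 3 * u t ^+ 2)))))%:E); last first.
  rewrite -Rintegral_EFin//; apply: eq_integral => t /[!inE] It; congr EFin.
  by rewrite bulkE.
rewrite (_ : (\int[mu]_(r in `]0%R, rad[) (v r * (v r ^+ 2 - 3 * u r ^+ 2) * r)%:E)%E =
  (\int[mu]_(t in `]0, rad[) (t * (v t * (v t ^+ 2 - 3 * u t ^+ 2))))%:E); last first.
  rewrite -Rintegral_EFin//; apply: eq_integral => t _; congr EFin.
  by rewrite mulrC.
rewrite -EFinM -EFinB RintegralD//; last exact: intgZ.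
by rewrite RintegralZl// addrK.
Qed.

(** By [quartic_intg] the integral of t v^2 is finite. *)
Lemma admissibleP u v : admissible a b c rad u v <->
  exists gu gv, finite_energy u v gu gv.
Proof.
set U := weak_derivative `]0, rad[ u; set V := weak_derivative `]0, rad[ v.
have sqE (h : R -> R) t : I t -> (Num.sqrt t * h t) ^+ 2 = t * h t ^+ 2.
  by rewrite /= in_itv/= => /andP[t0 _]; rewrite exprMn sqr_sqrtr// ltW.
have sqE' (h : R -> R) t : I t -> (h t / Num.sqrt t) ^+ 2 = h t ^+ 2 / t.
  by rewrite /= in_itv/= => /andP[t0 _]; rewrite exprMn exprVn sqr_sqrtr// ltW.
have msq : measurable_fun I (@Num.sqrt R).
  by apply: measurable_funTS; apply: continuous_measurable_fun; exact: sqrt_continuous.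
split.
- case=> -[cu cv] [[gu wu0] [gv wv0]] [lu lv] [lut lvt] bd.
  have wU : is_weak_derivative `]0, rad[ u U by apply: getPex; exists gu.
  have wV : is_weak_derivative `]0, rad[ v V by apply: getPex; exists gv.
  exists U, V; split => //.
  + move: lu lv => /L2_onP[//|_ lu] /L2_onP[//|_ lv]; split.
      by apply: eq_intg lu => //; exact: sqE.
    by apply: eq_intg lv => //; exact: sqE.
  + by move: lut => /L2_onP[//|_ lut]; apply: eq_intg lut => //; exact: sqE'.
- move=> [gu [gv fe0]]; have [_ [wu0 wv0] _ _ _] := fe0.
  have wU : is_weak_derivative `]0, rad[ u U by apply: getPex; exists gu.
  have wV : is_weak_derivative `]0, rad[ v V by apply: getPex; exists gv.
  have [fe _] := finite_energy_ae fe0 wU wV.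
  have [[cu cv] _ [iu iv] ivt bd] := fe.
  have mu_ := within_measurable cu; have mv_ := within_measurable cv.
  have mU : measurable_fun I U by case: wU => _ [].
  have mV : measurable_fun I V by case: wV => _ [].
  split => //.
  + by split; [exists gu|exists gv].
  + split; apply/L2_onP => //; split.
    * exact: measurable_funM.
    * by apply: eq_intg iu => // t It; rewrite sqE.
    * exact: measurable_funM.
    * by apply: eq_intg iv => // t It; rewrite sqE.
  + split; apply/L2_onP => //; split.
    * apply: measurable_funM => //.
      apply: subspace_continuous_measurable_fun => //.
      apply: continuous_in_subspaceT => t; rewrite inE/= in_itv/= => /andP[t0 _].
      apply: cvgV; first by rewrite gt_eqF// sqrtr_gt0.
      exact: sqrt_continuous.
    * by apply: eq_intg ivt => // t It; rewrite sqE'.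
    * exact: measurable_funM.
    * apply: (@eq_intg _ _ (fun t => t * v t ^+ 2)) => //.
        by move=> t It; rewrite sqE.
      apply: (quartic_intg rad0 fe (C := 1)) => //; first exact: measurable_funX.
      move=> t _; rewrite ger0_norm ?sqr_ge0// mul1r (exprM _ 2 2) (exprM (v t) 2 2).
      by have := sqr_ge0 (u t ^+ 2); have := sqr_ge0 (v t ^+ 2 - 1);
        have := sqr_ge0 (v t ^+ 2); nra.
Qed.

End energy_value.

(** * Coercivity and minimising sequences *)

Section minimising_sequence.
Context {R : realType}.
Notation mu := (@lebesgue_measure R).
Variables (a b c L rad : R) (k : int).
Hypotheses (c0 : 0 < c ^+ 2) (L0 : 0 < L) (rad0 : 0 < rad).
Implicit Types (u v gu gv h : R -> R) (x y t : R).
Local Notation finite_energy := (finite_energy a b c rad).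
Local Notation edens := (energy_density a b c L k).
Local Notation I := (`]0, rad[%classic : set R).

Lemma intg_cst_oo (C : R) : intg I (fun=> C).
Proof. exact: (intg_bounded_oo (M := `|C|)). Qed.

Lemma intg_linear_oo (C : R) : intg I (fun t => C * t).
Proof.
apply: intgZ => //; apply: (intg_bounded_oo (M := rad)) => // t /andP[t0 tr].
by rewrite gtr0_norm// ltW.
Qed.

Lemma Rintegral_cst_oo (C : R) : \int[mu]_(t in I) C = C * rad.
Proof.
by rewrite Rintegral_cst//= lebesgue_measure_itv/= lte_fin rad0 /= oppr0 addr0.
Qed.

(** The potential is bounded below by a constant, and the rest of the
    density is the sum on the left. *)
Lemma coercive : exists2 C, 0 <= C & forall u v gu gv, finite_energy u v gu gv ->
  2^-1 * (\int[mu]_(t in I) (t * gu t ^+ 2) + \int[mu]_(t in I) (t * gv t ^+ 2)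
         + k%:~R ^+ 2 * \int[mu]_(t in I) (u t ^+ 2 / t)) - C
  <= \int[mu]_(t in I) edens u v gu gv t.
Proof.
have [C C0 hC] := @potential_lower_bound _ a b c L c0 L0.
exists (C * rad * rad) => [|u v gu gv fe].
  by rewrite !mulr_ge0// ltW.
have [_ _ [iu iv] ivt _] := fe.
have iE := energy_density_intg k c0 L0 rad0 fe.
rewrite -Rintegral_cst_oo -RintegralZl// -!RintegralD//; [|exact: intgD|exact: intgZ].
have i1 : intg I (fun t => t * gu t ^+ 2 + t * gv t ^+ 2 + k%:~R ^+ 2 * (u t ^+ 2 / t)).
  by apply: intgD => //; [exact: intgD|exact: intgZ].
rewrite -RintegralZl// -RintegralB//; [|exact: intgZ|exact: intg_cst_oo].
apply: le_Rintegral => //.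
  by apply: intgB => //; [exact: intgZ|exact: intg_cst_oo].
move=> t /=; rewrite in_itv/= => /andP[t0 tr].
rewrite /energy_density lerD2l.
have h1 := ler_wpM2l (ltW t0) (hC (u t) (v t)).
apply: le_trans h1; rewrite mulrN lerN2 mulrC ler_wpM2l//; exact: ltW.
Qed.

(** A linear function and a constant: the linear one vanishes at
    the axis, as the term u^2/t demands. *)
Lemma finite_energy_exists : exists u v gu gv, finite_energy u v gu gv.
Proof.
pose U := s_plus a b c / Num.sqrt 2; pose V := - (s_plus a b c / Num.sqrt 6).
have du (t : R) : is_derive t 1 (fun t => U / rad * t) (U / rad).
  have h : is_derive t (1:R) (fun t : R => t) 1 by exact: is_derive_id.
  apply: (is_derive_eq (is_deriveZ (U / rad) h)).
  by rewrite /GRing.scale/= mulr1.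
have cu : continuous (fun t => U / rad * t).
  move=> t; apply/differentiable_continuous/derivable1_diffP.
  by have [] := du t.
have cc (C : R) : {within `]0, rad[, continuous (fun=> C)}.
  by apply: continuous_subspaceT => t; exact: cvg_cst.
have mC (C : R) : intg I (fun t => t * C).
  by apply: eq_intg (intg_linear_oo C) => // t _; rewrite mulrC.
exists (fun t => U / rad * t), (fun=> V), (fun=> U / rad), (fun=> 0); split.
- by split; apply: continuous_subspaceT => // t; exact: cvg_cst.
- split; apply: C1_weak_derivative => // t _; exact: is_derive_cst.
- by split; exact: mC.
- apply: (eq_intg _ _ (mC ((U / rad) ^+ 2))) => // t /=.
  rewrite in_itv/= => /andP[t0 _]; rewrite exprMn.
  by field; rewrite !gt_eqF.
- by split => //; rewrite divfK// gt_eqF.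
Qed.

Lemma minimising_sequence : exists m : R,
  (forall u v gu gv, finite_energy u v gu gv ->
     m <= \int[mu]_(t in I) edens u v gu gv t) /\
  exists un vn gn hn : nat -> R -> R, forall n,
    finite_energy (un n) (vn n) (gn n) (hn n) /\
    \int[mu]_(t in I) edens (un n) (vn n) (gn n) (hn n) t <= m + n.+1%:R^-1.
Proof.
pose S := [set e : R | exists u v gu gv, finite_energy u v gu gv /\
  e = \int[mu]_(t in I) edens u v gu gv t].
have [C C0 hC] := coercive.
have hlb : has_lbound S.
  exists (- C) => _ [u [v [gu [gv [fe ->]]]]].
  apply: le_trans (hC _ _ _ _ fe); rewrite lerDr mulr_ge0// !addr_ge0//.
  - apply: Rintegral_ge0 => t /=; rewrite in_itv/= => /andP[t0 _].
    by rewrite mulr_ge0 ?sqr_ge0// ltW.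
  - apply: Rintegral_ge0 => t /=; rewrite in_itv/= => /andP[t0 _].
    by rewrite mulr_ge0 ?sqr_ge0// ltW.
  - rewrite mulr_ge0 ?sqr_ge0//; apply: Rintegral_ge0 => t /=.
    by rewrite in_itv/= => /andP[t0 _]; rewrite divr_ge0 ?sqr_ge0// ltW.
have S0 : S !=set0.
  have [u [v [gu [gv fe]]]] := finite_energy_exists.
  by exists (\int[mu]_(t in I) edens u v gu gv t), u, v, gu, gv.
exists (inf S); split.
  move=> u v gu gv fe; apply: ge_inf => //.
  by exists u, v, gu, gv.
have hn (n : nat) : exists p : (R -> R) * (R -> R) * (R -> R) * (R -> R),
    finite_energy p.1.1.1 p.1.1.2 p.1.2 p.2 /\
    \int[mu]_(t in I) edens p.1.1.1 p.1.1.2 p.1.2 p.2 t <= inf S + n.+1%:R^-1.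
  have n0 : 0 < n.+1%:R^-1 :> R by rewrite invr_gt0 ltr0n.
  have [_ [u [v [gu [gv [fe ->]]]]] /ltW lt] := inf_adherent n0 (conj S0 hlb).
  by exists (u, v, gu, gv).
have [p hp] := choice hn.
by exists (fun n => (p n).1.1.1), (fun n => (p n).1.1.2), (fun n => (p n).1.2),
  (fun n => (p n).2).
Qed.

End minimising_sequence.

(** * Limits along an ultrafilter *)

Section ultrafilter_limit.
Context {R : realType}.
Notation mu := (@lebesgue_measure R).
Context (F : set_system nat) {FU : UltraFilter F}.
Implicit Types (f g h w : R -> R) (x y t r : R) (fn wn gn : nat -> R -> R).

(** An ultrafilter that has a cluster point converges to it.  This
    replaces the extraction of diagonal subsequences: one ultrafilter serves
    all points at once. *)
Lemma bounded_ultra_cvg (s : nat -> R) (B : R) : (forall n, `|s n| <= B) ->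
  exists l : R, s n @[n --> F] --> l.
Proof.
move=> sB; have FP : ProperFilter F by exact: ultra_proper.
have : (s @ F) (`[- B, B]%classic : set R).
  by apply: (@filterE _ F) => n; rewrite /= in_itv/= -ler_norml; exact: sB.
move=> /(segment_compact (fmap_proper_filter s FP))[l [_ cl]].
exists l => A Al; have [//|nA] := in_ultra_setVsetC (s @^-1` A) FU.
by have [t [/= nAt At]] := cl (~` A) A nA Al.
Qed.

(** Uniform in n, on [x, r] only: nothing is uniform up to the
    axis. *)
Definition equicontinuous_from wn x r := forall eps, 0 < eps ->
  exists2 d, 0 < d & forall n s t, x <= s -> s <= t -> t <= r -> t - s <= d ->
    `|wn n t - wn n s| <= eps.

(** In [weighted_increment] choose l so small that the
    Dirichlet term is below eps / 2, and then the points so close that the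
    logarithmic term is as well. *)
Lemma weighted_equicontinuous wn gn (M : R) x r : 0 < x ->
  (forall n, {within `]0, r], continuous (wn n)}) ->
  (forall n, is_weak_derivative `]0, r[ (wn n) (gn n)) ->
  (forall n, intg `]0, r[ (fun t => t * gn n t ^+ 2)) ->
  (forall n, \int[mu]_(t in `]0, r[) (t * gn n t ^+ 2) <= M) ->
  equicontinuous_from wn x r.
Proof.
move=> x0 cw wg ig IM eps eps0.
have M1 : 0 < `|M| + 1 by rewrite ltr_wpDl.
pose l : R := eps / (`|M| + 1); have l0 : 0 < l by rewrite divr_gt0.
exists (x * l * eps); first by rewrite !mulr_gt0.
move=> n s t xs st tr tsd; have s0 : 0 < s by exact: lt_le_trans xs.
apply: (le_trans (weighted_increment (cw n) (wg n) (ig n) s0 st tr l0)).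
have -> : eps = eps / 2 + eps / 2 by lra.
apply: lerD.
  have h : l * (\int[mu]_(t in `]0, r[) (t * gn n t ^+ 2)) <= eps.
    rewrite /l mulrAC ler_pdivrMr// ler_wpM2l ?(ltW eps0)//.
    by apply: (le_trans (IM n)); apply: (le_trans (ler_norm _)); lra.
  lra.
have lnts : ln t - ln s <= (t - s) / s.
  have t0 : 0 < t by exact: lt_le_trans st.
  rewrite -ln_div ?posrE//.
  have ->: t / s = 1 + (t - s) / s by field; rewrite gt_eqF.
  by apply: le_ln1Dx; apply: (@lt_le_trans _ _ 0) => //; rewrite divr_ge0 ?subr_ge0// ltW.
have h2 : (t - s) / s <= l * eps.
  rewrite ler_pdivrMr//; apply: (le_trans tsd).
  rewrite -mulrA mulrC ler_wpM2l// mulr_ge0// ltW//.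
have l2 : 0 < (2 * l)^-1 by rewrite invr_gt0 mulr_gt0.
apply: (@le_trans _ _ ((2 * l)^-1 * (l * eps))).
  by rewrite ler_pM2l// (le_trans lnts).
by rewrite le_eqVlt; apply/orP; left; apply/eqP; field; rewrite gt_eqF.
Qed.

Lemma equicontinuous_limit wn w x r : 0 < x ->
  (forall t, 0 < t -> t <= r -> wn n t @[n --> F] --> w t) ->
  equicontinuous_from wn x r -> equicontinuous_from (fun=> w) x r.
Proof.
move=> x0 cv eq eps eps0; have FP : ProperFilter F by exact: ultra_proper.
have [d d0 hd] := eq _ eps0; exists d => // _ s t xs st tr tsd.
have cn : `|wn n t - wn n s| @[n --> F] --> `|w t - w s|.
  by apply: cvg_norm; apply: cvgB; apply: cv; lra.
rewrite -(cvg_lim (@Rhausdorff R) cn); apply: limr_le; first exact: cvgP cn.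
by apply: nearW => n; exact: hd.
Qed.

(** The Arzela-Ascoli argument: convergence on a finite
    grid, spread by equicontinuity. *)
Lemma equicontinuous_uniform wn w x r : 0 < x ->
  (forall t, 0 < t -> t <= r -> wn n t @[n --> F] --> w t) ->
  equicontinuous_from wn x r ->
  forall eps : R, 0 < eps -> \forall n \near F, forall t, x <= t -> t <= r ->
    `|wn n t - w t| <= eps.
Proof.
move=> x0 cv eqn eps eps0; have FP : ProperFilter F by exact: ultra_proper.
have e3 : 0 < eps / 3 by lra.
have [d1 d10 hd1] := eqn _ e3.
have [d2 d20 hd2] := equicontinuous_limit x0 cv eqn e3.
pose d : R := Num.min d1 d2; have d0 : 0 < d by rewrite lt_min d10.
have grid N : \forall n \near F, forall i, (i <= N)%N -> x + i%:R * d <= r ->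
    `|wn n (x + i%:R * d) - w (x + i%:R * d)| <= eps / 3.
  have pt i : \forall n \near F, x + i%:R * d <= r ->
      `|wn n (x + i%:R * d) - w (x + i%:R * d)| <= eps / 3.
    have [xr|xr] := leP (x + i%:R * d) r; last by apply: nearW.
    have p0 : 0 < x + i%:R * d by rewrite ltr_wpDr// mulr_ge0// ltW.
    have /cvgrPdist_le/(_ _ e3) := cv _ p0 xr.
    by apply: filterS => n h _; rewrite distrC.
  elim: N => [|N ih].
    by apply: filterS (pt 0%N) => n h i; rewrite leqn0 => /eqP ->.
  apply: filterS2 ih (pt N.+1) => n h1 h2 i.
  by rewrite leq_eqVlt => /predU1P[->//|]; rewrite ltnS => /h1.
have := grid (Num.truncn ((r - x) / d)); apply: filterS => n hn t xt tr.
(* the grid point just below t *)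
pose i := Num.truncn ((t - x) / d).
have q0 : 0 <= (t - x) / d by rewrite divr_ge0 ?subr_ge0// ltW.
have /andP[i1 i2] := truncn_itv q0.
have hi1 : x + i%:R * d <= t by rewrite -lerBrDl -ler_pdivlMr.
have hi2 : t - (x + i%:R * d) <= d.
  move: i2; rewrite ltr_pdivrMr// -/i -natr1 mulrDl mul1r; lra.
have iN : (i <= Num.truncn ((r - x) / d))%N.
  by apply: le_truncn; rewrite ler_pM2r ?invr_gt0//; lra.
have xi : x <= x + i%:R * d by rewrite lerDl mulr_ge0// ltW.
have h1 := hn _ iN (le_trans hi1 tr).
have h2 : `|wn n t - wn n (x + i%:R * d)| <= eps / 3.
  by apply: hd1 => //; apply: (le_trans hi2); rewrite ge_min lexx.
have h3 : `|w t - w (x + i%:R * d)| <= eps / 3.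
  by apply: (hd2 0%N) => //; apply: (le_trans hi2); rewrite ge_min lexx orbT.
have -> : wn n t - w t = (wn n t - wn n (x + i%:R * d)) +
  (wn n (x + i%:R * d) - w (x + i%:R * d)) - (w t - w (x + i%:R * d)) by ring.
apply: (le_trans (ler_normB _ _)).
have := ler_normD (wn n t - wn n (x + i%:R * d)) (wn n (x + i%:R * d) - w (x + i%:R * d)).
lra.
Qed.

Lemma equicontinuous_within w r : (forall x, 0 < x -> equicontinuous_from (fun=> w) x r) ->
  {within `]0, r], continuous w}.
Proof.
move=> eq; apply/subspace_continuousP => t /=; rewrite in_itv/= => /andP[t0 tr].
apply/cvgrPdist_le => eps eps0.
have t20 : 0 < t / 2 by lra.
have [d d0 hd] := eq _ t20 _ eps0.
rewrite near_withinE; near=> s.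
rewrite /= in_itv/= => /andP[s0 sr].
have : `|t - s| <= Num.min d (t / 2).
  by near: s; apply: cvgr_dist_le => //; rewrite lt_min d0.
rewrite le_min => /andP[h1 h2].
have [st|ts] := leP s t.
  by apply: (hd 0%N) => //; move: h1 h2; rewrite !ler_norml; lra.
by rewrite distrC; apply: (hd 0%N); move: h1 h2; rewrite !ler_norml; lra.
Unshelve. all: by end_near. Qed.

(** The common value at r and the bound on the Dirichlet
    integrals bound the sequence at every point. *)
Lemma weighted_ultra_limit wn gn (M w0 r : R) : 0 < r ->
  (forall n, {within `]0, r], continuous (wn n)}) ->
  (forall n, is_weak_derivative `]0, r[ (wn n) (gn n)) ->
  (forall n, intg `]0, r[ (fun t => t * gn n t ^+ 2)) ->
  (forall n, \int[mu]_(t in `]0, r[) (t * gn n t ^+ 2) <= M) ->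
  (forall n, wn n r = w0) ->
  exists w, [/\ {within `]0, r], continuous w}, w r = w0 &
    forall x eps : R, 0 < x -> 0 < eps -> \forall n \near F, forall t,
      x <= t -> t <= r -> `|wn n t - w t| <= eps].
Proof.
move=> r0 cw wg ig IM wr; have FP : ProperFilter F by exact: ultra_proper.
have pt t : exists l : R, 0 < t -> t <= r -> wn n t @[n --> F] --> l.
  have [t0|t0] := ltP 0 t; last by exists 0.
  have [tr|tr] := leP t r; last by exists 0.
  have [n|l hl] := @bounded_ultra_cvg (fun n => wn n t)
      (`|w0| + (1 / 2 * M + (2 * 1)^-1 * (ln r - ln t))).
    have h := weighted_increment (cw n) (wg n) (ig n) t0 tr (lexx r) ltr01.
    have := ler_normB (wn n r) (wn n r - wn n t); rewrite subKr wr in h * => h2.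
    by apply: (le_trans h2); rewrite lerD2l (le_trans h)// lerD2r ler_wpM2l.
  by exists l.
have [w hw] := choice pt.
have eqn x : 0 < x -> equicontinuous_from wn x r.
  by move=> x0; exact: weighted_equicontinuous IM.
exists w; split.
- apply: equicontinuous_within => x x0.
  by apply: equicontinuous_limit (eqn _ x0).
- apply: (cvg_unique _ (hw r r0 (lexx r))); first exact: Rhausdorff.
  rewrite /= (_ : (fun n => wn n r) = fun=> w0); first exact: cvg_cst.
  by apply/funext => n; exact: wr.
- move=> x eps x0 eps0; apply: equicontinuous_uniform => //; exact: eqn.
Qed.

(** Boundedness of the limit is part of the notion so that it is stable under
    products. *)
Definition ucvg (D : set R) fn f := (exists B : R, forall t, D t -> `|f t| <= B) /\
  forall eps : R, 0 < eps -> \forall n \near F, forall t, D t ->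
    `|fn n t - f t| <= eps.

Lemma ucvg_cst D f : (exists B : R, forall t, D t -> `|f t| <= B) ->
  ucvg D (fun=> f) f.
Proof.
have FP : ProperFilter F by exact: ultra_proper.
move=> fB; split => // eps eps0; apply: nearW => n t _.
by rewrite subrr normr0 ltW.
Qed.

Lemma ucvgD D fn f gn g : ucvg D fn f -> ucvg D gn g ->
  ucvg D (fun n t => fn n t + gn n t) (fun t => f t + g t).
Proof.
have FP : ProperFilter F by exact: ultra_proper.
move=> [[B fB] fu] [[C gC] gu]; split.
  exists (B + C) => t Dt; apply: (le_trans (ler_normD _ _)).
  by rewrite lerD ?fB ?gC.
move=> eps eps0; have e2 : 0 < eps / 2 by lra.
apply: filterS2 (fu _ e2) (gu _ e2) => n h1 h2 t Dt.
have := h1 t Dt; have := h2 t Dt; rewrite !ler_norml; lra.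
Qed.

Lemma ucvgM D fn f gn g : ucvg D fn f -> ucvg D gn g ->
  ucvg D (fun n t => fn n t * gn n t) (fun t => f t * g t).
Proof.
have FP : ProperFilter F by exact: ultra_proper.
move=> [[B fB] fu] [[C gC] gu]; split.
  exists (`|B| * `|C|) => t Dt; rewrite normrM ler_pM//.
    by rewrite (le_trans (fB _ Dt))// ler_norm.
  by rewrite (le_trans (gC _ Dt))// ler_norm.
move=> eps eps0.
pose e : R := Num.min 1 (eps / (1 + `|B| + `|C|)).
have den : 0 < 1 + `|B| + `|C| by rewrite -addrA ltr_pwDl// addr_ge0.
have e0 : 0 < e by rewrite lt_min ltr01/= divr_gt0.
have e1 : e <= 1 by rewrite ge_min lexx.
have e2 : e * (1 + `|B| + `|C|) <= eps.
  by rewrite -ler_pdivlMr// ge_min lexx orbT.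
apply: filterS2 (fu _ e0) (gu _ e0) => n h1 h2 t Dt.
have -> : fn n t * gn n t - f t * g t = (fn n t - f t) * (gn n t - g t) +
  f t * (gn n t - g t) + (fn n t - f t) * g t by ring.
apply: le_trans e2.
have -> : e * (1 + `|B| + `|C|) = e + e * `|B| + e * `|C| by ring.
apply: (le_trans (ler_normD _ _)); apply: lerD; last first.
  rewrite normrM ler_pM//; first exact: h1.
  by rewrite (le_trans (gC _ Dt))// ler_norm.
apply: (le_trans (ler_normD _ _)); apply: lerD; last first.
  rewrite normrM mulrC ler_pM//; first exact: h2.
  by rewrite (le_trans (fB _ Dt))// ler_norm.
rewrite normrM -[leRHS]mul1r ler_pM//; last exact: h2.
by rewrite (le_trans (h1 _ Dt)).
Qed.

Lemma ucvg_integral x y fn f : x <= y -> (forall n, intg `[x, y] (fn n)) ->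
  intg `[x, y] f -> ucvg `[x, y] fn f ->
  \int[mu]_(t in `[x, y]) fn n t @[n --> F] --> \int[mu]_(t in `[x, y]) f t.
Proof.
have FP : ProperFilter F by exact: ultra_proper.
move=> xy ifn if_ [_ fu]; apply/cvgrPdist_le => eps eps0.
have e0 : 0 < eps / (y - x + 1) by rewrite divr_gt0//; lra.
apply: filterS (fu _ e0) => n hn.
rewrite distrC -RintegralB//; last exact: ifn.
apply: (le_trans (@le_Rintegral_bound _ x y _ (eps / (y - x + 1)) xy _ _)).
- exact: intgB.
- by move=> t txy; exact: hn.
- by rewrite mulrAC ler_pdivrMr; nra.
Qed.

End ultrafilter_limit.

(** * Regularity for the weak radial equation *)

Section weak_second_order.
Context {R : realType}.
Notation mu := (@lebesgue_measure R).
Implicit Types (D : set R) (f g h w : R -> R) (a b x y e r t : R).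

(** Integration starts at r because the integrands considered
    may fail to be integrable at 0. *)
Definition backward_primitive r g t : R := - \int[mu]_(s in `[t, r]) g s.

Lemma within_oc_segment r g a : {within `]0, r], continuous g} -> 0 < a ->
  {within `[a, r], continuous g}.
Proof.
by move=> + a0; apply: continuous_subspaceW; apply: subset_itvr; rewrite bnd_simp.
Qed.

Lemma backward_primitiveE r g a t : {within `]0, r], continuous g} ->
  0 < a -> a <= t -> t <= r -> backward_primitive r g t =
  \int[mu]_(s in `[a, t]) g s - \int[mu]_(s in `[a, r]) g s.
Proof.
move=> cg a0 at_ tr; have ig := intg_segment (within_oc_segment cg a0).
rewrite /backward_primitive -opprB; congr (- _).
rewrite (@Rintegral_itvB _ g (BLeft a) (BRight r) t)//.
by rewrite Rintegral_itv_obnd_cbnd//; apply: intgS ig => //;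
  apply: subset_itvr; rewrite bnd_simp.
Qed.

Lemma is_derive_backward_primitive r g t : {within `]0, r], continuous g} ->
  0 < t -> t < r -> is_derive t 1 (backward_primitive r g) (g t).
Proof.
move=> cg t0 tr; have t20 : 0 < t / 2 by lra.
have ig := intg_segment (within_oc_segment cg t20).
have [dF F't] := @continuous_FTC1_closed R g (t / 2) t r tr ig
  (ltac:(lra) : t / 2 < t) (interior_continuous (within_oc_oo cg) (ltac:(lra) : 0 < t < r)).
pose C := \int[mu]_(s in `[t / 2, r]) g s.
apply: (@near_eq_is_derive _ _ _
  (fun z => \int[mu]_(s in `[t / 2, z]) g s - C)).
  have oA : open (`]t / 2, r[%classic : set R) by exact: interval_open.
  apply: (near_open_eq oA) => [z|] /=; rewrite in_itv/=.
    by move=> /andP[z1 z2]; rewrite -backward_primitiveE// ltW.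
  by lra.
have hF : is_derive t 1 (fun z => \int[mu]_(s in `[t / 2, z]) g s) (g t).
  by rewrite -F't derive1E; exact/derivableP.
have hC : is_derive t (1:R) (fun=> C) 0 by exact: is_derive_cst.
by apply: (is_derive_eq (is_deriveB hF hC)); rewrite subr0.
Qed.

Lemma backward_primitive_within r g : {within `]0, r], continuous g} ->
  {within `]0, r], continuous (backward_primitive r g)}.
Proof.
move=> cg; apply/subspace_continuousP => t /=; rewrite in_itv/= => /andP[t0 tr].
have t20 : 0 < t / 2 by lra.
have tt : t / 2 < t by lra.
have ig := intg_segment (within_oc_segment cg t20).
have cF : {within `[t / 2, r], continuous (backward_primitive r g)}.
  have := parameterized_integral_continuous (ltW (lt_le_trans tt tr)) ig.
  move=> cP.
  have : {within `[t / 2, r], continuous (fun z =>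
      parameterized_integral mu (t / 2) z g - \int[mu]_(s in `[t / 2, r]) g s)}.
    by move=> z; apply: cvgB; [exact: cP|exact: cvg_cst].
  apply: subspace_eq_continuous => z; rewrite inE/= in_itv/= => /andP[z1 z2].
  exact: (esym (backward_primitiveE cg t20 z1 z2)).
move/subspace_continuousP : cF => /(_ t); rewrite /= in_itv/= (ltW tt) tr => /(_ isT).
apply: cvg_trans; apply: cvg_app => A.
move=> hA; have {}hA : \forall z \near t, z \in `[t / 2, r] -> A z := hA.
suff : \forall z \near t, z \in `]0, r] -> A z by [].
apply: filterS2 hA (lt_nbhsr tt) => z hz tz.
by rewrite in_itv/= => /andP[z0 zr]; apply: hz; rewrite in_itv/= zr andbT ltW.
Qed.

(** Mean zero is what makes the primitive vanish to the right of
    the support. *)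
Lemma smooth_primitive x y f : x < y -> smooth_on setT f -> supported x y f ->
  \int[mu]_(t in `[x, y]) f t = 0 ->
  exists phi, [/\ smooth_on setT phi, supported x y phi & derive1 phi = f].
Proof.
move=> xy sf fxy f0; have cf := smooth_continuous sf.
have iF p q : intg `[p, q] f by apply: intg_segment; exact: continuous_subspaceT.
pose P t := \int[mu]_(s in `[x - 1, t]) f s.
have P0 t : t <= x -> P t = 0.
  move=> tx; rewrite /P -Rintegral_itv_bndo_bndc; last first.
    by apply: intgS (iF (x - 1) t) => //; apply: subset_itvl; rewrite bnd_simp.
  rewrite (@eq_Rintegral _ _ _ _ _ (fun=> 0)) ?Rintegral_cst ?mul0r// => s.
  rewrite inE/= in_itv/= => /andP[_ st].
  by apply: fxy; rewrite in_itv/= negb_and -ltNge (lt_le_trans st tx).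
have dP t : is_derive t 1 P (f t).
  have [tx|xt] := ltP t x.
    have oA : open [set z : R | z < x] by exact: open_lt.
    apply: (@near_eq_is_derive _ _ _ (fun=> 0)).
      by apply: (near_open_eq oA _ tx) => z /= /ltW /P0.
    have -> : f t = 0 by apply: fxy; rewrite in_itv/= negb_and -ltNge tx.
    exact: is_derive_cst.
  have t1 : t < t + 1 by lra.
  have xt1 : x - 1 < t by lra.
  have [dPt <-] := @continuous_FTC1_closed R f (x - 1) t (t + 1) t1 (iF _ _) xt1 (cf t).
  by rewrite derive1E; exact/derivableP.
have P' : derive1 P = f.
  by apply/funext => t; rewrite derive1E; have [_ ->] := dP t.
exists P; split; last exact: P'.
- move=> [|n] t _; first by have [] := dP t.
  by rewrite derive1Sn P'; exact: sf.
- move=> t; rewrite in_itv/= negb_and -!ltNge => /orP[/ltW/P0//|yt].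
  rewrite /P (@supported_Rintegral _ _ x y)//.
  by apply: subset_itv; rewrite bnd_simp; lra.
Qed.

Lemma derive1_idM (f : R -> R) t : derivable f t 1 ->
  derive1 (fun s => s * f s) t = f t + t * derive1 f t.
Proof.
move=> df; have hid : is_derive t (1:R) (fun s : R => s) 1 by exact: is_derive_id.
have hf : is_derive t 1 f (derive1 f t) by rewrite derive1E; exact/derivableP.
rewrite derive1E; have [_ ->] := is_deriveM hid hf.
by rewrite /GRing.scale/= mulr1 addrC.
Qed.

Lemma smooth_idM (f : R -> R) : smooth_on setT f -> smooth_on setT (fun s => s * f s).
Proof.
have oT : open [set: R] by exact: openT.
move=> /smooth_diffn sf; apply/smooth_diffn => n.
by apply: diffnM => //; exact: diffn_id.
Qed.

Lemma smoothD (f g : R -> R) : smooth_on setT f -> smooth_on setT g ->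
  smooth_on setT (fun s => f s + g s).
Proof.
have oT : open [set: R] by exact: openT.
move=> /smooth_diffn sf /smooth_diffn sg; apply/smooth_diffn => n.
exact: diffnD.
Qed.

Lemma smoothZ (C : R) (f : R -> R) : smooth_on setT f ->
  smooth_on setT (fun s => C * f s).
Proof.
have oT : open [set: R] by exact: openT.
move=> /smooth_diffn sf; apply/smooth_diffn => n.
exact: diffnZ.
Qed.

Lemma unit_mass_plateau r : 0 < r -> exists (f : R -> R) x y,
  [/\ smooth_on setT f, [/\ 0 < x, x < y & y < r], supported x y f &
      \int[mu]_(t in `]0, r[) f t = 1].
Proof.
move=> r0; pose e : R := r / 8; have e0 : 0 < e by rewrite divr_gt0.
have re : r = 8 * e by rewrite /e mulrC divfK.
pose f := plateau e (4 * e) e.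
have sf : smooth_on setT f by exact: smooth_plateau.
have cf := smooth_continuous sf.
have spf : supported e (4 * e + e) f by move=> t; apply: plateau_out => //; lra.
have sub : `[e, 4 * e + e] `<=` `]0, r[ by apply: segment_sub_oo => //; lra.
have iF : intg `]0, r[ f.
  apply: (supported_intg _ sub spf) => //; apply: intg_segment.
  exact: continuous_subspaceT.
have f_ge0 t : 0 <= f t.
  by have /andP[] := @plateau_01 R e (4 * e) e t e0 (ltac:(lra) : e + e <= 4 * e).
have C0 : 0 < \int[mu]_(t in `]0, r[) f t.
  have sub2 : `[e + e, 4 * e] `<=` `]0, r[ by apply: segment_sub_oo => //; lra.
  apply: (lt_le_trans _ (Rintegral_subset_ge0 _ _ sub2 iF _)) => //.
  rewrite (@eq_Rintegral _ _ _ _ _ (fun=> 1)).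
    by rewrite Rintegral_segment_cst; lra.
  by move=> t; rewrite inE/= in_itv/= => te; rewrite /f plateau_in.
exists (fun t => (\int[mu]_(t in `]0, r[) f t)^-1 * f t), e, (4 * e + e).
split.
- exact: smoothZ.
- by split; lra.
- exact: supportedM.
- by rewrite RintegralZl// mulVf// gt_eqF.
Qed.

Lemma continuous_idM (f : R -> R) (D : set R) : {within D, continuous f} ->
  {within D, continuous (fun s => s * f s)}.
Proof.
move=> cf t; apply: cvgM; last exact: cf.
by apply: continuous_subspaceT => s; exact: cvg_id.
Qed.

(** Two applications of the lemma of du Bois-Reymond.  Let H be a
    primitive of g and T xi = int w (t xi)' + int H xi.  The hypothesis says
    that T vanishes on derivatives of test functions, that is on test functions
    of mean zero; hence T xi = B int xi for a constant B.  This means that t w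
    has the weak derivative w + H - B, which is continuous.  So t w is C^1 and
    t w' = H - B. *)
Theorem weak_second_order r w g : 0 < r ->
  {within `]0, r], continuous w} -> {within `]0, r], continuous g} ->
  (forall phi x y, smooth_on setT phi -> 0 < x -> x < y -> y < r ->
     supported x y phi ->
     \int[mu]_(t in `]0, r[) (w t * derive1 (fun s => s * derive1 phi s) t) =
     \int[mu]_(t in `]0, r[) (g t * phi t)) ->
  exists q : R -> R, [/\ {within `]0, r], continuous q},
    forall t, 0 < t < r -> is_derive t 1 w (q t / t) &
    forall t, 0 < t < r -> is_derive t 1 q (g t)].
Proof.
have alg1 (p q s z C : R) : p - C * q = - (s - C * z) -> p + s = (q + z) * C.
  by move=> E; lra.
have alg2 (p q s z : R) : p + s = z -> p - q = - (q + s - z) by move=> E; lra.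
move=> r0 cw cg hw; pose H := backward_primitive r g.
have cH : {within `]0, r], continuous H} by exact: backward_primitive_within.
have dH t : t \in `]0, r[ -> is_derive t 1 H (g t).
  by rewrite in_itv/= => /andP[t0 tr]; exact: is_derive_backward_primitive.
have lw := within_continuous_locally (within_oc_oo cw).
have lH := within_continuous_locally (within_oc_oo cH).
have [xi0 [x0 [y0 [s0 [x00 xy0 yr0] sp0 int1]]]] := unit_mass_plateau r0.
pose T (xi : R -> R) := \int[mu]_(t in `]0, r[) (w t * derive1 (fun s => s * xi s) t) +
  \int[mu]_(t in `]0, r[) (H t * xi t).
have idM (xi : R -> R) : smooth_on setT xi -> derive1 (fun s => s * xi s) =
    (fun t => xi t + t * derive1 xi t).
  by move=> sxi; apply/funext => t; rewrite derive1_idM//; exact: (sxi 0%N).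
have cts (xi : R -> R) : smooth_on setT xi -> continuous xi /\
    continuous (derive1 (fun s => s * xi s)).
  move=> sxi; split; first exact: smooth_continuous.
  exact/smooth_continuous/smooth_derive1/smooth_idM.
have spM (xi : R -> R) x y : supported x y xi -> supported x y (derive1 (fun s => s * xi s)).
  by move=> sp; apply: supported_derive1; exact: supportedM.
have meanT (xi : R -> R) x y : smooth_on setT xi -> 0 < x -> x < y -> y < r ->
    supported x y xi -> T xi = T xi0 * \int[mu]_(t in `]0, r[) xi t.
  move=> sxi xp xy yr sp; set C := \int[mu]_(t in _) xi t.
  (* a common support for xi and the reference function xi0 of mass 1 *)
  pose x1 := Num.min x x0; pose y1 := Num.max y y0.
  have x1p : 0 < x1 by rewrite lt_min xp.
  have y1r : y1 < r by rewrite gt_max yr.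
  have xy1 : x1 < y1.
    by rewrite gt_min lt_max xy.
  have sp' : supported x1 y1 xi.
    by apply: supported_sub sp; [rewrite ge_min lexx|rewrite le_max lexx].
  have sp0' : supported x1 y1 xi0.
    by apply: supported_sub sp0; [rewrite ge_min lexx orbT|rewrite le_max lexx orbT].
  (* the part of mean zero, hence the derivative of a test function *)
  pose eta t := xi t + - C * xi0 t.
  have seta : smooth_on setT eta by apply: smoothD; [exact: sxi|exact: smoothZ].
  have speta : supported x1 y1 eta.
    by move=> t t1; rewrite /eta sp'// sp0'// mulr0 addr0.
  have [cxi cMxi] := cts _ sxi; have [cxi0 cMxi0] := cts _ s0.
  have sub : `[x1, y1] `<=` `]0, r[ by exact: segment_sub_oo.
  have ic (h : R -> R) : continuous h -> supported x1 y1 h -> intg `]0, r[ h.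
    move=> ch sph; apply: (supported_intg _ sub sph) => //; apply: intg_segment.
    exact: continuous_subspaceT.
  have ixi := ic _ cxi sp'; have ixi0 := ic _ cxi0 sp0'.
  have eta0 : \int[mu]_(t in `[x1, y1]) eta t = 0.
    rewrite -(supported_Rintegral sub speta) /eta RintegralD//; last exact: intgZ.
    by rewrite RintegralZl// int1 mulr1 subrr.
  have [phi [sphi spphi phi']] := smooth_primitive xy1 seta speta eta0.
  have := hw phi x1 y1 sphi x1p xy1 y1r spphi; rewrite phi' => E1.
  have /weak_derivativeP[//|_ _ /(_ phi x1 y1 sphi x1p xy1 y1r spphi)] :=
    C1_weak_derivative r0 dH (within_oc_oo cg).
  rewrite phi' => E2.
  have iw (h : R -> R) : continuous h -> supported x1 y1 h -> intg `]0, r[ (fun t => w t * h t).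
    by move=> ch sph; exact: locally_intg_test lw x1p y1r ch sph.
  have iH (h : R -> R) : continuous h -> supported x1 y1 h -> intg `]0, r[ (fun t => H t * h t).
    by move=> ch sph; exact: locally_intg_test lH x1p y1r ch sph.
  have E3 : \int[mu]_(t in `]0, r[) (w t * derive1 (fun s => s * eta s) t) =
    \int[mu]_(t in `]0, r[) (w t * derive1 (fun s => s * xi s) t) -
    C * \int[mu]_(t in `]0, r[) (w t * derive1 (fun s => s * xi0 s) t).
    rewrite -RintegralZl//; last by apply: iw => //; exact: spM.
    rewrite -RintegralB//; [|by apply: iw => //; exact: spM|
      by apply: intgZ => //; apply: iw => //; exact: spM].
    apply: eq_Rintegral => t _; rewrite !idM//.
    have -> : derive1 eta t = derive1 xi t + - C * derive1 xi0 t.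
      rewrite derive1E.
      have h1 : is_derive t 1 xi (derive1 xi t).
        by rewrite derive1E; apply/derivableP; exact: (sxi 0%N).
      have h2 : is_derive t 1 xi0 (derive1 xi0 t).
        by rewrite derive1E; apply/derivableP; exact: (s0 0%N).
      by have [_ ->] := is_deriveD h1 (is_deriveZ (- C) h2).
    by rewrite /eta; ring.
  have E4 : \int[mu]_(t in `]0, r[) (H t * eta t) =
    \int[mu]_(t in `]0, r[) (H t * xi t) - C * \int[mu]_(t in `]0, r[) (H t * xi0 t).
    rewrite -RintegralZl//; last exact: iH.
    rewrite -RintegralB//; [|exact: iH|by apply: intgZ => //; exact: iH].
    by apply: eq_Rintegral => t _; rewrite /eta; ring.
  rewrite /T; move: E1 E2; rewrite E3 E4.
  set I1 := \int[mu]_(t in _) _; set I2 := \int[mu]_(t in _) _.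
  set I3 := \int[mu]_(t in _) (g t * _); set I4 := \int[mu]_(t in _) _.
  set I5 := \int[mu]_(t in _) _ => E1 E2.
  have : I1 - C * I2 = - (I4 - C * I5) by rewrite E1 E2 opprK.
  exact: alg1.
pose B := T xi0.
have wz : is_weak_derivative `]0, r[ (fun t => t * w t) (fun t => w t + H t - B).
  apply/weak_derivativeP => //; split.
  - by apply: within_continuous_locally; apply: continuous_idM; exact: within_oc_oo.
  - apply: within_continuous_locally => t.
    apply: cvgB; last exact: cvg_cst.
    by apply: cvgD; [exact: (within_oc_oo cw)|exact: (within_oc_oo cH)].
  move=> xi x y sxi xp xy yr sp.
  have := meanT xi x y sxi xp xy yr sp; rewrite -/B /T.
  have [cxi cMxi] := cts _ sxi.
  have iw (h : R -> R) : continuous h -> supported x y h -> intg `]0, r[ (fun t => w t * h t).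
    by move=> ch sph; exact: locally_intg_test lw xp yr ch sph.
  have iH (h : R -> R) : continuous h -> supported x y h -> intg `]0, r[ (fun t => H t * h t).
    by move=> ch sph; exact: locally_intg_test lH xp yr ch sph.
  have sub : `[x, y] `<=` `]0, r[ by exact: segment_sub_oo.
  have ixi : intg `]0, r[ xi.
    apply: (supported_intg _ sub sp) => //; apply: intg_segment.
    exact: continuous_subspaceT.
  rewrite (_ : \int[mu]_(t in `]0, r[) (t * w t * derive1 xi t) =
    \int[mu]_(t in `]0, r[) (w t * derive1 (fun s => s * xi s) t) -
    \int[mu]_(t in `]0, r[) (w t * xi t)); last first.
    rewrite -RintegralB//; [|by apply: iw => //; exact: spM|exact: iw].
    by apply: eq_Rintegral => t _; rewrite idM//; ring.
  rewrite (_ : \int[mu]_(t in `]0, r[) ((w t + H t - B) * xi t) =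
    \int[mu]_(t in `]0, r[) (w t * xi t) + \int[mu]_(t in `]0, r[) (H t * xi t) -
    B * \int[mu]_(t in `]0, r[) xi t); last first.
    rewrite -RintegralZl// -RintegralD//; [|exact: iw|exact: iH].
    rewrite -RintegralB//; [|by apply: intgD => //; [exact: iw|exact: iH]|exact: intgZ].
    by apply: eq_Rintegral => t _; ring.
  exact: alg2.
have czo : {within `]0, r[, continuous (fun t => t * w t)}.
  by apply: continuous_idM; exact: within_oc_oo.
exists (fun t => H t - B); split.
- by move=> t; apply: cvgB; [exact: cH|exact: cvg_cst].
- move=> t tr; have /andP[t0 tr'] := tr.
  pose G t := w t + H t - B.
  have cG : {within `]0, r], continuous G}.
    move=> s; apply: cvgB; last exact: cvg_cst.
    by apply: cvgD; [exact: cw|exact: cH].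
  (* near t the function s * w s is an antiderivative of the continuous G *)
  pose x := t / 2; pose y := (t + r) / 2.
  have dz : is_derive t 1 (fun s : R => s * w s) (G t).
    apply: (@near_eq_is_derive _ _ _
      (fun s => backward_primitive r G s + (y * w y - backward_primitive r G y))).
      have oA : open (`]0, y[%classic : set R) by exact: interval_open.
      apply: (near_open_eq oA) => [s|] /=; rewrite in_itv/=; last by rewrite /y; lra.
      move=> /andP[sp sy]; have yr : y < r by rewrite /y; lra.
      have := weak_derivative_increment czo wz sp sy yr.
      rewrite (backward_primitiveE cG sp (lexx s) (ltW (lt_trans sy yr))).
      rewrite (backward_primitiveE cG sp (ltW sy) (ltW yr)).
      by rewrite set_itv1 Rintegral_set1 -/G /G => ->; ring.
    have h1 := is_derive_backward_primitive cG t0 tr'.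
    have h2 : is_derive t (1:R) (fun=> y * w y - backward_primitive r G y) 0.
      exact: is_derive_cst.
    by apply: (is_derive_eq (is_deriveD h1 h2)); rewrite addr0.
  have tn0 : t != 0 by rewrite gt_eqF.
  have dV : is_derive t 1 (fun s : R => s^-1) (- t^-1 ^+ 2).
    apply: DeriveDef; first by apply: derivableV => //; exact: derivable_id.
    have := @deriveV R R id t 1 tn0 (@derivable_id _ _ t 1).
    by rewrite derive_id /GRing.scale/= mulr1 -exprVn => <-.
  apply: (@near_eq_is_derive _ _ _ ((fun s : R => (s * w s) * s^-1) : R -> R)).
    have oA : open [set s : R | 0 < s] by exact: open_gt.
    apply: (near_open_eq oA _ t0) => s /= s0'.
    by rewrite mulrAC divff ?mul1r// gt_eqF.
  apply: (is_derive_eq (is_deriveM dz dV)).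
  by rewrite /GRing.scale/= /G; field.
- move=> t tr; have h1 := dH t (ltac:(by rewrite in_itv/=) : t \in `]0, r[).
  have h2 : is_derive t (1:R) (fun=> B) 0 by exact: is_derive_cst.
  by apply: (is_derive_eq (is_deriveB h1 h2)); rewrite subr0.
Qed.

End weak_second_order.

(** * The first variation *)

Section continuous_uniform_convergence.
Context {R : realType}.
Notation mu := (@lebesgue_measure R).
Context (F : set_system nat) {FU : UltraFilter F}.
Variables (x y : R).
Hypothesis xy : x < y.
Implicit Types (f g : R -> R) (fn gn : nat -> R -> R).

(** Continuity is included so that integrability comes with convergence.
    The closure lemmas are applied mechanically by [cucvg_tac] to polynomial
    expressions. *)
Definition cucvg fn f := [/\ forall n, {within `[x, y], continuous (fn n)},
  {within `[x, y], continuous f} & ucvg F `[x, y] fn f].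

Lemma within_segment_bounded f : {within `[x, y], continuous f} ->
  exists B : R, forall t, t \in `[x, y] -> `|f t| <= B.
Proof.
move=> cf; have cn : {within `[x, y], continuous (fun t => `|f t|)}.
  by move=> t; apply: cvg_norm; exact: cf.
by have [z _ hz] := EVT_max (ltW xy) cn; exists `|f z|.
Qed.

Lemma cucvg_cst f : {within `[x, y], continuous f} -> cucvg (fun=> f) f.
Proof.
move=> cf; split => //; apply: ucvg_cst.
by have [B hB] := within_segment_bounded cf; exists B => t; exact: hB.
Qed.

Lemma cucvgD fn f gn g : cucvg fn f -> cucvg gn g ->
  cucvg (fun n t => fn n t + gn n t) (fun t => f t + g t).
Proof.
move=> [c1 c2 c3] [d1 d2 d3]; split; last exact: ucvgD.
- by move=> n t; apply: cvgD; [exact: c1|exact: d1].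
- by move=> t; apply: cvgD; [exact: c2|exact: d2].
Qed.

Lemma cucvgM fn f gn g : cucvg fn f -> cucvg gn g ->
  cucvg (fun n t => fn n t * gn n t) (fun t => f t * g t).
Proof.
move=> [c1 c2 c3] [d1 d2 d3]; split; last exact: ucvgM.
- by move=> n t; apply: cvgM; [exact: c1|exact: d1].
- by move=> t; apply: cvgM; [exact: c2|exact: d2].
Qed.

Lemma cucvgN fn f : cucvg fn f -> cucvg (fun n t => - fn n t) (fun t => - f t).
Proof.
move=> cf; have c1 : cucvg (fun _ _ => -1) (fun=> -1).
  by apply: cucvg_cst => t; exact: cvg_cst.
have := cucvgM c1 cf.
by under eq_fun do under eq_fun do rewrite mulN1r; under [X in cucvg _ X -> _]eq_fun do rewrite mulN1r.
Qed.

Lemma cucvgX fn f m : cucvg fn f -> cucvg (fun n t => fn n t ^+ m) (fun t => f t ^+ m).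
Proof.
move=> cf; elim: m => [|m ih].
  by apply: cucvg_cst => t; exact: cvg_cst.
have := cucvgM cf ih.
by under eq_fun do under eq_fun do rewrite -exprS; under [X in cucvg _ X -> _]eq_fun do rewrite -exprS.
Qed.

Lemma cucvg_integral fn f : cucvg fn f ->
  \int[mu]_(t in `[x, y]) fn n t @[n --> F] --> \int[mu]_(t in `[x, y]) f t.
Proof.
move=> [c1 c2 c3]; apply: ucvg_integral => //; first exact: ltW.
- by move=> n; exact: intg_segment.
- exact: intg_segment.
Qed.

End continuous_uniform_convergence.

Ltac cucvg_tac hc := lazymatch goal with
  | |- cucvg _ _ _ (fun _ _ => ?C) _ => exact: (hc C)
  | |- cucvg _ _ _ (fun n t => @?A n t + @?B n t) _ =>
      apply: (@cucvgD _ _ _ _ _ A _ B); cucvg_tac hc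
  | |- cucvg _ _ _ (fun n t => @?A n t * @?B n t) _ =>
      apply: (@cucvgM _ _ _ _ _ A _ B); cucvg_tac hc
  | |- cucvg _ _ _ (fun n t => - @?A n t) _ =>
      apply: (@cucvgN _ _ _ _ _ _ A); cucvg_tac hc
  | |- cucvg _ _ _ (fun n t => @?A n t ^+ ?m) _ =>
      apply: (@cucvgX _ _ _ _ _ _ A _ m); cucvg_tac hc
  | |- _ => assumption
  end.

(** Divide by s and let s tend to 0 from both sides. *)
Lemma polynomial4_ge0_linear (R : realType) (c1 c2 c3 c4 : R) :
  (forall s : R, 0 <= s * c1 + s ^+ 2 * c2 + s ^+ 3 * c3 + s ^+ 4 * c4) -> c1 = 0.
Proof.
move=> h; apply/eqP; apply: contraT => c10.
pose C := `|c2| + `|c3| + `|c4| + 1.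
have C0 : 0 < C by rewrite ltr_wpDl// !addr_ge0.
(* so small that at s = e and s = - e the higher terms are at most half of
   the linear one *)
pose e : R := Num.min 1 (`|c1| / (2 * C)).
have c1p : 0 < `|c1| by rewrite normr_gt0.
have e0 : 0 < e by rewrite lt_min ltr01 divr_gt0// mulr_gt0.
have e1 : e <= 1 by rewrite ge_min lexx.
have eC : e * C <= `|c1| / 2.
  have : e <= `|c1| / (2 * C) by rewrite ge_min lexx orbT.
  by rewrite -ler_pdivlMr// => /le_trans; apply; rewrite invfM mulrA.
have h2 : `|c2 + e * c3 + e ^+ 2 * c4| <= C.
  apply: (le_trans (ler_normD _ _)); rewrite /C -addrA; apply: lerD.
    apply: (le_trans (ler_normD _ _)); rewrite lerD2l normrM (gtr0_norm e0).
    by rewrite ler_piMl.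
  rewrite normrM (gtr0_norm (exprn_gt0 _ e0)); apply: (@le_trans _ _ `|c4|); last by lra.
  by rewrite ler_piMl// exprn_ile1// ltW.
have h3 : `|c2 - e * c3 + e ^+ 2 * c4| <= C.
  apply: (le_trans (ler_normD _ _)); rewrite /C -addrA; apply: lerD.
    apply: (le_trans (ler_normB _ _)); rewrite lerD2l normrM (gtr0_norm e0).
    by rewrite ler_piMl.
  rewrite normrM (gtr0_norm (exprn_gt0 _ e0)); apply: (@le_trans _ _ `|c4|); last by lra.
  by rewrite ler_piMl// exprn_ile1// ltW.
have := h e; have := h (- e).
rewrite (_ : _ + _ + _ + _ = e * (- c1 + e * (c2 - e * c3 + e ^+ 2 * c4))); last by ring.
rewrite (_ : e * c1 + _ + _ + _ = e * (c1 + e * (c2 + e * c3 + e ^+ 2 * c4))); last by ring.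
rewrite !pmulr_rge0// => k1 k2.
have m1 : e * (c2 + e * c3 + e ^+ 2 * c4) <= e * C.
  by rewrite ler_wpM2l// ?(ltW e0)// (le_trans (ler_norm _)).
have m2 : e * (c2 - e * c3 + e ^+ 2 * c4) <= e * C.
  by rewrite ler_wpM2l// ?(ltW e0)// (le_trans (ler_norm _)).
have : `|c1| <= `|c1| / 2 by rewrite ler_norml; apply/andP; split; lra.
lra.
Qed.

Lemma variation_inequality (R : realType) (m s J1 J2 C1 C2 C3 C4 E e : R) :
  E <= m + e ->
  m <= E + s * (- J1 + - J2) + s * C1 + s ^+ 2 * C2 + s ^+ 3 * C3 + s ^+ 4 * C4 ->
  0 <= s * (C1 - (J1 + J2)) + s ^+ 2 * C2 + s ^+ 3 * C3 + s ^+ 4 * C4 + e.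
Proof. by move: (s ^+ 2) (s ^+ 3) (s ^+ 4) => t2 t3 t4 h1 h2; lra. Qed.

Section first_variation.
Context {R : realType}.
Notation mu := (@lebesgue_measure R).
Variables (a b c L rad : R) (k : int).
Hypotheses (c0 : 0 < c ^+ 2) (L0 : 0 < L) (rad0 : 0 < rad).
Local Notation finite_energy := (finite_energy a b c rad).
Local Notation edens := (energy_density a b c L k).
Local Notation potential := (potential a b c L).
Local Notation I := (`]0, rad[%classic : set R).
Local Notation cA := (a ^+ 2 / (2 * L)).
Local Notation cQ := (c ^+ 2 / (4 * L)).
Local Notation cB := (b ^+ 2 / (3 * Num.sqrt 6 * L)).
Local Notation cK := (k%:~R ^+ 2 : R).
Implicit Types (u v gu gv phi psi : R -> R).

Definition potential_dx (p q : R) : R :=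
  - (2 * cA * p) + 4 * cQ * (p ^+ 2 + q ^+ 2) * p + 6 * cB * p * q.
Definition potential_dy (p q : R) : R :=
  - (2 * cA * q) + 4 * cQ * (p ^+ 2 + q ^+ 2) * q
  + 3 * cB * (p ^+ 2 + - q ^+ 2).

(** [variation1] to [variation4] are the coefficients of the powers of s
    in the energy density at (u + s phi, v + s psi), except that the linear
    terms containing the weak derivatives are kept apart. *)
Definition variation1 u v phi psi t : R :=
  cK * (u t * phi t * t^-1)
  + t * (potential_dx (u t) (v t) * phi t + potential_dy (u t) (v t) * psi t).
Definition variation2 u v phi psi (dphi dpsi : R -> R) t : R :=
  2^-1 * (t * dphi t ^+ 2 + t * dpsi t ^+ 2 + cK * (phi t ^+ 2 * t^-1))
  + t * (- (cA * (phi t ^+ 2 + psi t ^+ 2))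
    + cQ * ((2 * (u t * phi t + v t * psi t)) ^+ 2
            + 2 * (u t ^+ 2 + v t ^+ 2) * (phi t ^+ 2 + psi t ^+ 2))
    + - (cB * (3 * v t * psi t ^+ 2 + - (3 * v t * phi t ^+ 2)
            + - (6 * u t * phi t * psi t)))).
Definition variation3 u v phi psi t : R :=
  t * (cQ * 4 * (u t * phi t + v t * psi t) * (phi t ^+ 2 + psi t ^+ 2)
    + - (cB * (psi t ^+ 3 + - (3 * phi t ^+ 2 * psi t)))).
Definition variation4 phi psi t : R := t * (cQ * (phi t ^+ 2 + psi t ^+ 2) ^+ 2).

Lemma energy_density_expansion u v gu gv phi psi (dphi dpsi : R -> R) s t : t != 0 ->
  edens (fun t => u t + s * phi t) (fun t => v t + s * psi t)
        (fun t => gu t + s * dphi t) (fun t => gv t + s * dpsi t) t =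
  edens u v gu gv t + s * (gu t * (t * dphi t) + gv t * (t * dpsi t))
  + s * variation1 u v phi psi t + s ^+ 2 * variation2 u v phi psi dphi dpsi t
  + s ^+ 3 * variation3 u v phi psi t + s ^+ 4 * variation4 phi psi t.
Proof.
move=> t0; rewrite /energy_density /variation1 /variation2 /variation3 /variation4
  /potential_dx /potential_dy /potential.
move: cA cQ cB cK => A Q B K.
by field.
Qed.

(** A test function changes neither the boundary values nor the
    behaviour near the axis. *)
Lemma finite_energy_perturb u v gu gv phi psi x y s : finite_energy u v gu gv ->
  smooth_on setT phi -> smooth_on setT psi -> 0 < x -> x < y -> y < rad ->
  supported x y phi -> supported x y psi ->
  finite_energy (fun t => u t + s * phi t) (fun t => v t + s * psi t)
    (fun t => gu t + s * derive1 phi t) (fun t => gv t + s * derive1 psi t).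
Proof.
move=> [[cu cv] [wu wv] [iu iv] ivt [bu bv]] sphi spsi x0 xy yr spphi sppsi.
have sub : `[x, y] `<=` `]0, rad[ by exact: segment_sub_oo.
have wphi f : smooth_on setT f -> is_weak_derivative `]0, rad[ (fun t => s * f t)
    (fun t => s * derive1 f t).
  move=> sf; apply: C1_weak_derivative => //.
    move=> t _; have hf : is_derive t 1 f (derive1 f t).
      by rewrite derive1E; apply/derivableP; exact: (sf 0%N).
    exact: (is_deriveZ s hf).
  apply: continuous_subspaceT => t; apply: cvgM; first exact: cvg_cst.
  exact: (smooth_continuous (smooth_derive1 sf)).
have sq w g f : is_weak_derivative `]0, rad[ w g ->
    intg `]0, rad[ (fun t => t * g t ^+ 2) -> smooth_on setT f -> supported x y f ->
    intg `]0, rad[ (fun t => t * (g t + s * derive1 f t) ^+ 2).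
  move=> [_ lg _] ig sf spf.
  have cf' := smooth_continuous (smooth_derive1 sf).
  have cf2 : continuous (fun t : R => t * derive1 f t).
    by move=> t; apply: cvgM; [exact: cvg_id|exact: cf'].
  have sp2 : supported x y (fun t => t * derive1 f t).
    by apply: supportedM; exact: supported_derive1.
  apply: (@eq_intg _ _ (fun t => t * g t ^+ 2 + (2 * s) * (g t * (t * derive1 f t)) +
    s ^+ 2 * (derive1 f t * (t * derive1 f t)))) => //.
    by move=> t _; ring.
  apply: intgD => //; last first.
    apply: intgZ => //; apply: (supported_intg _ sub (supportedM _ sp2)) => //.
    apply: intg_segment; apply: continuous_subspaceT => t.
    by apply: cvgM; [exact: cf'|exact: cf2].
  apply: intgD => //; apply: intgZ => //.
  exact: (locally_intg_test lg x0 yr cf2 sp2).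
split.
- have cs (f : R -> R) : smooth_on setT f -> {within `]0, rad], continuous (fun t => s * f t)}.
    move=> sf; apply: continuous_subspaceT => t.
    by apply: cvgM; [exact: cvg_cst|exact: smooth_continuous].
  by split=> t; apply: cvgD; [exact: cu|exact: (cs _ sphi)|exact: cv|exact: (cs _ spsi)].
- by split; apply: weak_derivativeD => //; apply: wphi.
- by split; [exact: sq wu _ _ _|exact: sq wv _ _ _].
- have cus : {within `[x, y], continuous u}.
    by apply: continuous_subspaceW (within_oc_oo cu).
  have cps : {within `[x, y], continuous phi}.
    by apply: continuous_subspaceT; exact: smooth_continuous.
  have cVs : {within `[x, y], continuous (fun t : R => t^-1)}.
    apply: continuous_in_subspaceT => t; rewrite inE/= in_itv/= => /andP[xt _].
    by apply: inv_continuous; rewrite gt_eqF// (lt_le_trans x0).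
  have isp (h : R -> R) : {within `[x, y], continuous h} ->
      intg `]0, rad[ (fun t => h t * t^-1 * phi t).
    move=> ch; apply: (supported_intg _ sub (supportedM _ spphi)) => //.
    apply: intg_segment => t; apply: cvgM; last exact: cps.
    by apply: cvgM; [exact: ch|exact: cVs].
  apply: (@eq_intg _ _ (fun t => u t ^+ 2 / t + 2 * s * (u t * t^-1 * phi t) +
    s ^+ 2 * (phi t * t^-1 * phi t))) => //.
    by move=> t _; ring.
  by apply: intgD => //; [apply: intgD => //|]; apply: intgZ => //; exact: isp.
- have rn : rad \notin `[x, y] by rewrite in_itv/= negb_and -!ltNge yr orbT.
  by rewrite spphi// sppsi// !mulr0 !addr0.
Qed.

Context (F : set_system nat) {FU : UltraFilter F}.
Hypothesis Foo : \oo `<=` F.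
Variables (m : R) (un vn gn hn : nat -> R -> R) (u v : R -> R).
Hypothesis m_min : forall u v gu gv, finite_energy u v gu gv ->
  m <= \int[mu]_(t in I) edens u v gu gv t.
Hypothesis fe_n : forall n, finite_energy (un n) (vn n) (gn n) (hn n).
Hypothesis E_n : forall n,
  \int[mu]_(t in I) edens (un n) (vn n) (gn n) (hn n) t <= m + n.+1%:R^-1.
Hypotheses (cu : {within `]0, rad], continuous u})
  (cv : {within `]0, rad], continuous v}).
Hypothesis u_lim : forall x eps : R, 0 < x -> 0 < eps -> \forall n \near F,
  forall t, x <= t -> t <= rad -> `|un n t - u t| <= eps.
Hypothesis v_lim : forall x eps : R, 0 < x -> 0 < eps -> \forall n \near F,
  forall t, x <= t -> t <= rad -> `|vn n t - v t| <= eps.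

Lemma limit_cucvg wn w x y : 0 < x -> x < y -> y < rad ->
  (forall n, {within `]0, rad], continuous (wn n)}) ->
  {within `]0, rad], continuous w} ->
  (forall x eps : R, 0 < x -> 0 < eps -> \forall n \near F,
    forall t, x <= t -> t <= rad -> `|wn n t - w t| <= eps) ->
  cucvg F x y wn w.
Proof.
move=> x0 xy yr cwn cw wlim.
have sub : `[x, y] `<=` `]0, rad].
  by move=> t /=; rewrite !in_itv/= => /andP[xt ty]; lra.
have cws : {within `[x, y], continuous w} by exact: continuous_subspaceW cw.
split => //; first by move=> n; exact: continuous_subspaceW (cwn n).
split; first by have [B hB] := within_segment_bounded xy cws; exists B => t; exact: hB.
have FP : ProperFilter F by exact: ultra_proper.
move=> eps eps0; apply: filterS (wlim _ _ x0 eps0) => n h t /=.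
by rewrite in_itv/= => /andP[xt ty]; apply: h => //; rewrite (le_trans ty)// ltW.
Qed.

Lemma cvg_harmonic_ultra : (n.+1%:R^-1 : R) @[n --> F] --> (0 : R).
Proof. by apply: cvg_trans (@cvg_harmonic R); exact: cvg_app. Qed.

Lemma Rintegral_expansion (f0 f1 f2 g1 g2 g3 g4 : R -> R) (s : R) :
  intg I f0 -> intg I f1 -> intg I f2 -> intg I g1 -> intg I g2 -> intg I g3 ->
  intg I g4 ->
  \int[mu]_(t in I) (f0 t + s * (f1 t + f2 t) + s * g1 t + s ^+ 2 * g2 t
    + s ^+ 3 * g3 t + s ^+ 4 * g4 t) =
  \int[mu]_(t in I) f0 t + s * (\int[mu]_(t in I) f1 t + \int[mu]_(t in I) f2 t)
  + s * \int[mu]_(t in I) g1 t + s ^+ 2 * \int[mu]_(t in I) g2 t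
  + s ^+ 3 * \int[mu]_(t in I) g3 t + s ^+ 4 * \int[mu]_(t in I) g4 t.
Proof.
move=> i0 i1 i2 j1 j2 j3 j4; have mI : measurable I by exact: measurable_itv.
have k0 := intgD mI i0 (intgZ s mI (intgD mI i1 i2)).
have k1 := intgD mI k0 (intgZ s mI j1).
have k2 := intgD mI k1 (intgZ (s ^+ 2) mI j2).
have k3 := intgD mI k2 (intgZ (s ^+ 3) mI j3).
rewrite RintegralD//; last exact: intgZ.
rewrite RintegralD//; last exact: intgZ.
rewrite RintegralD//; last exact: intgZ.
rewrite RintegralD//; last exact: intgZ.
rewrite RintegralD//; last by apply: intgZ => //; exact: intgD.
by rewrite !RintegralZl//; [rewrite RintegralD|exact: intgD].
Qed.

(** The energy of the perturbed n-th pair is at least m and that of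
    the n-th pair is at most m + 1/(n+1), so a polynomial in s of degree four is
    nonnegative up to 1/(n+1).  In the limit its linear coefficient must
    vanish. *)
Lemma first_variation phi psi x y : 0 < x -> x < y -> y < rad ->
  smooth_on setT phi -> smooth_on setT psi ->
  supported x y phi -> supported x y psi ->
  \int[mu]_(t in I) (u t * derive1 (fun s => s * derive1 phi s) t) +
  \int[mu]_(t in I) (v t * derive1 (fun s => s * derive1 psi s) t) =
  \int[mu]_(t in I) variation1 u v phi psi t.
Proof.
move=> x0 xy yr sphi spsi spphi sppsi.
have FP : ProperFilter F by exact: ultra_proper.
have sub : `[x, y] `<=` `]0, rad[ by exact: segment_sub_oo.
have cun n : {within `]0, rad], continuous (un n)} by have [[]] := fe_n n.
have cvn n : {within `]0, rad], continuous (vn n)} by have [[]] := fe_n n.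
have hu := limit_cucvg x0 xy yr cun cu u_lim.
have hv := limit_cucvg x0 xy yr cvn cv v_lim.
have within_smooth (f : R -> R) : smooth_on setT f -> {within `[x, y], continuous f}.
  by move=> sf; apply: continuous_subspaceT; exact: smooth_continuous.
have hphi : cucvg F x y (fun=> phi) phi by apply: cucvg_cst => //; exact: within_smooth.
have hpsi : cucvg F x y (fun=> psi) psi by apply: cucvg_cst => //; exact: within_smooth.
have hdphi : cucvg F x y (fun=> derive1 phi) (derive1 phi).
  by apply: cucvg_cst => //; apply: within_smooth; exact: smooth_derive1.
have hdpsi : cucvg F x y (fun=> derive1 psi) (derive1 psi).
  by apply: cucvg_cst => //; apply: within_smooth; exact: smooth_derive1.
have hid : cucvg F x y (fun _ t => t) (fun t => t).
  by apply: cucvg_cst => //; apply: continuous_subspaceT => t; exact: cvg_id.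
have hV : cucvg F x y (fun _ t => t^-1) (fun t => t^-1).
  apply: cucvg_cst => //.
  apply: continuous_in_subspaceT => t; rewrite inE/= in_itv/= => /andP[xt _].
  by apply: inv_continuous; rewrite gt_eqF// (lt_le_trans x0).
have hc (C : R) : cucvg F x y (fun _ _ => C) (fun=> C).
  by apply: cucvg_cst => // t; exact: cvg_cst.
have h1 : cucvg F x y (fun n => variation1 (un n) (vn n) phi psi) (variation1 u v phi psi).
  by rewrite /variation1 /potential_dx /potential_dy; cucvg_tac hc.
have h2 : cucvg F x y
    (fun n => variation2 (un n) (vn n) phi psi (derive1 phi) (derive1 psi))
    (variation2 u v phi psi (derive1 phi) (derive1 psi)).
  by rewrite /variation2; cucvg_tac hc.
have h3 : cucvg F x y (fun n => variation3 (un n) (vn n) phi psi) (variation3 u v phi psi).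
  by rewrite /variation3; cucvg_tac hc.
have h4 : cucvg F x y (fun n => variation4 phi psi) (variation4 phi psi).
  by rewrite /variation4; cucvg_tac hc.
have sdphi := smooth_idM (smooth_derive1 sphi).
have sdpsi := smooth_idM (smooth_derive1 spsi).
have spd f : supported x y f -> supported x y (fun t => t * derive1 f t).
  by move=> sp; apply: supportedM; exact: supported_derive1.
have spd2 f : supported x y f ->
    supported x y (derive1 (fun t => t * derive1 f t)).
  by move=> sp; apply: supported_derive1; exact: spd.
have spvar (p q : R -> R) : [/\ supported x y (variation1 p q phi psi),
   supported x y (variation2 p q phi psi (derive1 phi) (derive1 psi)),
   supported x y (variation3 p q phi psi) & supported x y (variation4 phi psi)].
  have d0 := supported_derive1 spphi; have d1 := supported_derive1 sppsi.
  by split=> t tn; rewrite /variation1 /variation2 /variation3 /variation4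
    ?(d0 t tn) ?(d1 t tn) (spphi t tn) (sppsi t tn); ring.
have isp f : supported x y f -> {within `[x, y], continuous f} -> intg I f.
  by move=> sp cf; apply: (supported_intg _ sub sp) => //; exact: intg_segment.
pose c1 n := \int[mu]_(t in `[x, y]) variation1 (un n) (vn n) phi psi t.
pose c2 n := \int[mu]_(t in `[x, y])
  variation2 (un n) (vn n) phi psi (derive1 phi) (derive1 psi) t.
pose c3 n := \int[mu]_(t in `[x, y]) variation3 (un n) (vn n) phi psi t.
pose c4 := \int[mu]_(t in `[x, y]) variation4 phi psi t.
pose J n := \int[mu]_(t in `[x, y]) (un n t * derive1 (fun t => t * derive1 phi t) t) +
  \int[mu]_(t in `[x, y]) (vn n t * derive1 (fun t => t * derive1 psi t) t).
have step_n (s : R) n : 0 <= s * (c1 n - J n) + s ^+ 2 * c2 n + s ^+ 3 * c3 n +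
    s ^+ 4 * c4 + n.+1%:R^-1.
  have [_ [wu wv] _ _ _] := fe_n n.
  have fe' := finite_energy_perturb s (fe_n n) sphi spsi x0 xy yr spphi sppsi.
  have iE := energy_density_intg k c0 L0 rad0 (fe_n n).
  have i1 : intg I (variation1 (un n) (vn n) phi psi).
    by apply: isp; [have [] := spvar (un n) (vn n)|have [] := h1].
  have i2 : intg I (variation2 (un n) (vn n) phi psi (derive1 phi) (derive1 psi)).
    by apply: isp; [have [] := spvar (un n) (vn n)|have [] := h2].
  have i3 : intg I (variation3 (un n) (vn n) phi psi).
    by apply: isp; [have [] := spvar (un n) (vn n)|have [] := h3].
  have i4 : intg I (variation4 phi psi).
    by apply: isp; [have [] := spvar (un n) (vn n)|have [_ +] := h4].
  have iJ1 : intg I (fun t => gn n t * (t * derive1 phi t)).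
    have [_ lg _] := wu.
    exact: locally_intg_test lg x0 yr (smooth_continuous sdphi) (spd _ spphi).
  have iJ2 : intg I (fun t => hn n t * (t * derive1 psi t)).
    have [_ lg _] := wv.
    exact: locally_intg_test lg x0 yr (smooth_continuous sdpsi) (spd _ sppsi).
  have expand : \int[mu]_(t in I) edens (fun t => un n t + s * phi t)
      (fun t => vn n t + s * psi t) (fun t => gn n t + s * derive1 phi t)
      (fun t => hn n t + s * derive1 psi t) t =
    \int[mu]_(t in I) (edens (un n) (vn n) (gn n) (hn n) t +
    s * (gn n t * (t * derive1 phi t) + hn n t * (t * derive1 psi t))
    + s * variation1 (un n) (vn n) phi psi t
    + s ^+ 2 * variation2 (un n) (vn n) phi psi (derive1 phi) (derive1 psi) t
    + s ^+ 3 * variation3 (un n) (vn n) phi psi t + s ^+ 4 * variation4 phi psi t).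
    apply: eq_Rintegral => t; rewrite inE/= in_itv/= => /andP[t0 _].
    by rewrite energy_density_expansion// gt_eqF.
  have := m_min fe'; rewrite expand.
  rewrite Rintegral_expansion//.
  have EX := weak_derivative_test wu sdphi x0 xy yr (spd _ spphi).
  have EY := weak_derivative_test wv sdpsi x0 xy yr (spd _ sppsi).
  have [s1 s2 s3 s4] := spvar (un n) (vn n).
  rewrite (supported_Rintegral sub s1) (supported_Rintegral sub s2).
  rewrite (supported_Rintegral sub s3) (supported_Rintegral sub s4).
  rewrite EX EY; exact: variation_inequality (E_n n).
pose d1 := \int[mu]_(t in `[x, y]) variation1 u v phi psi t.
pose d2 := \int[mu]_(t in `[x, y])
  variation2 u v phi psi (derive1 phi) (derive1 psi) t.
pose d3 := \int[mu]_(t in `[x, y]) variation3 u v phi psi t.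
pose J' := \int[mu]_(t in `[x, y]) (u t * derive1 (fun t => t * derive1 phi t) t) +
  \int[mu]_(t in `[x, y]) (v t * derive1 (fun t => t * derive1 psi t) t).
have cvc1 : c1 n @[n --> F] --> d1 := @cucvg_integral R F FU x y xy _ _ h1.
have cvc2 : c2 n @[n --> F] --> d2 := @cucvg_integral R F FU x y xy _ _ h2.
have cvc3 : c3 n @[n --> F] --> d3 := @cucvg_integral R F FU x y xy _ _ h3.
have cvJ : J n @[n --> F] --> J'.
  have hw f : smooth_on setT f -> cucvg F x y (fun=> derive1 f) (derive1 f).
    by move=> sf; apply: cucvg_cst => //; apply: within_smooth; exact: smooth_derive1.
  apply: cvgD.
    exact: (@cucvg_integral R F FU x y xy _ _ (cucvgM hu (hw _ sdphi))).
  exact: (@cucvg_integral R F FU x y xy _ _ (cucvgM hv (hw _ sdpsi))).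
have lim0 : d1 - J' = 0.
  apply: (@polynomial4_ge0_linear _ _ d2 d3 c4) => s.
  have cvP : (s * (c1 n - J n) + s ^+ 2 * c2 n + s ^+ 3 * c3 n + s ^+ 4 * c4 + n.+1%:R^-1)
     @[n --> F] --> s * (d1 - J') + s ^+ 2 * d2 + s ^+ 3 * d3 + s ^+ 4 * c4 + 0.
    apply: cvgD; last exact: cvg_harmonic_ultra.
    apply: cvgD; last exact: cvg_cst.
    apply: cvgD; last by apply: cvgM => //; exact: cvg_cst.
    apply: cvgD; last by apply: cvgM => //; exact: cvg_cst.
    by apply: cvgM; [exact: cvg_cst|exact: cvgB].
  rewrite -[leRHS]addr0 -(cvg_lim (@Rhausdorff R) cvP).
  apply: limr_ge; first exact: cvgP cvP.
  by apply: nearW => n; exact: step_n.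
have [s1 _ _ _] := spvar u v.
rewrite (supported_Rintegral sub s1).
have Eu : \int[mu]_(t in I) (u t * derive1 (fun s => s * derive1 phi s) t) =
    \int[mu]_(t in `[x, y]) (u t * derive1 (fun s => s * derive1 phi s) t).
  exact: supported_Rintegral sub (supportedM u (spd2 _ spphi)).
have Ev : \int[mu]_(t in I) (v t * derive1 (fun s => s * derive1 psi s) t) =
    \int[mu]_(t in `[x, y]) (v t * derive1 (fun s => s * derive1 psi s) t).
  exact: supported_Rintegral sub (supportedM v (spd2 _ sppsi)).
apply: (etrans (congr2 +%R Eu Ev)); exact: (esym (subr0_eq lim0)).
Qed.

End first_variation.

(** * The Euler-Lagrange system *)

Section euler_lagrange.
Context {R : realType}.
Notation mu := (@lebesgue_measure R).
Variables (a b c L rad : R) (k : int).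
Hypotheses (rad0 : 0 < rad).
Local Notation I := (`]0, rad[%classic : set R).
Local Notation cK := (k%:~R ^+ 2 : R).
Local Notation potential_dx := (potential_dx a b c L).
Local Notation potential_dy := (potential_dy a b c L).
Implicit Types (u v p q phi psi : R -> R).

(** The unknowns p = t u' and q = t v' remove the second derivatives and
    the singular first order term of the radial Laplacian. *)
Definition el_system u v p q : Prop :=
  [/\ forall t, 0 < t < rad -> is_derive t 1 u (p t / t),
      forall t, 0 < t < rad -> is_derive t 1 v (q t / t),
      forall t, 0 < t < rad ->
        is_derive t 1 p (cK * (u t * t^-1) + t * potential_dx (u t) (v t)) &
      forall t, 0 < t < rad -> is_derive t 1 q (t * potential_dy (u t) (v t))].

Lemma potential_gradient_continuous D u v : {within D, continuous u} ->
  {within D, continuous v} ->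
  {within D, continuous (fun t => potential_dx (u t) (v t))} /\
  {within D, continuous (fun t => potential_dy (u t) (v t))}.
Proof.
move=> cu cv.
have cM := @within_continuousM R D.
have cD (f g : R -> R) cf cg : {within D, continuous (fun t => f t + g t)} :=
  @within_continuousD _ _ _ D f g cf cg.
have cN := @within_continuousN R D; have cc := @within_continuous_cst R D.
have cS (f : R -> R) (cf : {within D, continuous f}) := cM f f cf cf.
split; rewrite /potential_dx /potential_dy.
- exact: (cD _ _ (cD _ _ (cN _ (cM _ _ (cc _) cu))
    (cM _ _ (cM _ _ (cc _) (cD _ _ (cS _ cu) (cS _ cv))) cu))
    (cM _ _ (cM _ _ (cc _) cu) cv)).
- exact: (cD _ _ (cD _ _ (cN _ (cM _ _ (cc _) cv))
    (cM _ _ (cM _ _ (cc _) (cD _ _ (cS _ cu) (cS _ cv))) cv))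
    (cM _ _ (cc _) (cD _ _ (cS _ cu) (cN _ (cS _ cv))))).
Qed.

Lemma el_system_exists u v :
  {within `]0, rad], continuous u} -> {within `]0, rad], continuous v} ->
  (forall phi psi x y, 0 < x -> x < y -> y < rad ->
    smooth_on setT phi -> smooth_on setT psi ->
    supported x y phi -> supported x y psi ->
    \int[mu]_(t in I) (u t * derive1 (fun s => s * derive1 phi s) t) +
    \int[mu]_(t in I) (v t * derive1 (fun s => s * derive1 psi s) t) =
    \int[mu]_(t in I) variation1 a b c L k u v phi psi t) ->
  exists p q : R -> R, [/\ {within `]0, rad], continuous p},
    {within `]0, rad], continuous q} & el_system u v p q].
Proof.
move=> cu cv fv; have [cdx cdy] := potential_gradient_continuous cu cv.
(* the two equations come from perturbing one component at a time *)
have s0 : smooth_on setT (fun _ : R => 0 : R).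
  by apply/smooth_diffn => n; apply: diffn_cst; exact: openT.
have z0 (w : R -> R) : \int[mu]_(t in I)
    (w t * derive1 (fun s => s * derive1 (fun=> 0 : R) s) t) = 0.
  rewrite (@eq_Rintegral _ _ _ _ _ (fun=> 0)) ?Rintegral_cst ?mul0r// => t _.
  rewrite (_ : (fun s => s * derive1 (fun=> 0 : R) s) = (fun=> 0)).
    by rewrite derive1_cst mulr0.
  by apply/funext => s; rewrite derive1_cst mulr0.
have sp0 (x y : R) : supported x y (fun=> 0 : R) by [].
have cid : {within `]0, rad], continuous (fun t : R => t)}.
  by apply: continuous_subspaceT => t; exact: cvg_id.
have cV := @within_continuous_inv R rad.
have [||p [cp du dp]] := @weak_second_order R rad u
    (fun t => cK * (u t * t^-1) + t * potential_dx (u t) (v t)) rad0 cu.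
- move=> t; apply: cvgD; last by apply: cvgM; [exact: cid|exact: cdx].
  apply: cvgM; first exact: cvg_cst.
  by apply: cvgM; [exact: cu|exact: cV].
- move=> phi x y sphi x0 xy yr sp.
  have E := fv phi (fun=> 0) x y x0 xy yr sphi s0 sp (sp0 _ _).
  have {}E := etrans (esym (etrans (congr2 +%R (erefl _) (z0 v)) (addr0 _))) E.
  apply: (etrans E); apply: eq_Rintegral => t _.
  by rewrite /variation1; ring.
have [||q [cq dv dq]] := @weak_second_order R rad v
    (fun t => t * potential_dy (u t) (v t)) rad0 cv.
- by move=> t; apply: cvgM; [exact: cid|exact: cdy].
- move=> psi x y spsi x0 xy yr sp.
  have E := fv (fun=> 0) psi x y x0 xy yr s0 spsi (sp0 _ _) sp.
  have {}E := etrans (esym (etrans (congr2 +%R (z0 u) (erefl _)) (add0r _))) E.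
  apply: (etrans E); apply: eq_Rintegral => t _.
  by rewrite /variation1; ring.
by exists p, q.
Qed.

(** The right-hand sides are polynomials in u, v, p, q, t and
    1/t: each order of differentiability of the unknowns gives one more. *)
Lemma el_system_smooth u v p q : el_system u v p q ->
  [/\ smooth_on I u, smooth_on I v, smooth_on I p & smooth_on I q].
Proof.
move=> [du dv dp dq]; have oI : open I by exact: interval_open.
have inI t : I t -> 0 < t < rad by rewrite /= in_itv.
have dif (f f' : R -> R) : (forall t, 0 < t < rad -> is_derive t 1 f (f' t)) ->
    forall n, diffn I n f' -> diffn I n.+1 f.
  move=> df n dn; split; first by move=> t /inI tr; have [] := df _ tr.
  apply: eq_diffn dn => // t /inI tr; rewrite derive1E.
  by have [_ ->] := df _ tr.
have all n : [/\ diffn I n u, diffn I n v, diffn I n p & diffn I n q].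
  elim: n => [//|n [nu nv np nq]].
  have nid : diffn I n (fun t => t) by exact: diffn_id.
  have nV : diffn I n (fun t => t^-1).
    by apply: diffnV => // t /inI /andP[t0 _]; rewrite gt_eqF.
  have nM (f g : R -> R) : diffn I n f -> diffn I n g -> diffn I n (fun t => f t * g t).
    exact: diffnM.
  have nD (f g : R -> R) : diffn I n f -> diffn I n g -> diffn I n (fun t => f t + g t).
    exact: diffnD.
  have nN (f : R -> R) : diffn I n f -> diffn I n (fun t => - f t) by exact: diffnN.
  have nc (C : R) : diffn I n (fun=> C) by exact: diffn_cst.
  have nS (f : R -> R) : diffn I n f -> diffn I n (fun t => f t ^+ 2) by move=> nf; apply: (nM f f).
  have ndx : diffn I n (fun t => potential_dx (u t) (v t)).
    exact: (nD _ _ (nD _ _ (nN _ (nM _ _ (nc _) nu))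
      (nM _ _ (nM _ _ (nc _) (nD _ _ (nS _ nu) (nS _ nv))) nu))
      (nM _ _ (nM _ _ (nc _) nu) nv)).
  have ndy : diffn I n (fun t => potential_dy (u t) (v t)).
    exact: (nD _ _ (nD _ _ (nN _ (nM _ _ (nc _) nv))
      (nM _ _ (nM _ _ (nc _) (nD _ _ (nS _ nu) (nS _ nv))) nv))
      (nM _ _ (nc _) (nD _ _ (nS _ nu) (nN _ (nS _ nv))))).
  split.
  - by apply: (dif _ _ du); exact: (nM _ _ np nV).
  - by apply: (dif _ _ dv); exact: (nM _ _ nq nV).
  - apply: (dif _ _ dp).
    exact: (nD _ _ (nM _ _ (nc _) (nM _ _ nu nV)) (nM _ _ nid ndx)).
  - by apply: (dif _ _ dq); exact: (nM _ _ nid ndy).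
by split; apply/smooth_diffn => n; have [] := all n.
Qed.

End euler_lagrange.

(** * Lower semicontinuity *)

Section exhaustion.
Context {R : realType}.
Notation mu := (@lebesgue_measure R).
Implicit Types (f chi : R -> R).

Lemma smooth_cutoff f chi x y r : smooth_on `]0, r[ f -> smooth_on setT chi ->
  0 < x -> y < r -> supported x y chi -> smooth_on setT (fun t => chi t * f t).
Proof.
move=> sf sc x0 yr sp; have oI : open (`]0, r[%classic : set R) by exact: interval_open.
have oC : open (~` (`[x, y]%classic : set R)).
  by apply: closed_openC; exact: interval_closed.
have s1 : smooth_on `]0, r[ (fun t => chi t * f t).
  move/smooth_diffn: sf => sf; move/smooth_diffn : sc => sc.
  apply/smooth_diffn => n; apply: diffnM => //.
  by apply: diffn_sub (sc n).
have s2 : smooth_on (~` `[x, y]) (fun t => chi t * f t).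
  apply: (@eq_smooth _ _ (fun=> 0) _ oC) => [t /= /negP tn|].
    by rewrite sp ?mul0r.
  by apply/smooth_diffn => n; exact: diffn_cst.
move=> n t _; have [txy|/negP txy] := boolP (t \in `[x, y]); last exact: s2.
by apply: s1; exact: (segment_sub_oo x0 yr).
Qed.

(** Monotone convergence along the segments [d, r - d]. *)
Lemma intg_exhaust r f (M : R) : 0 < r -> (forall t, 0 < t < r -> 0 <= f t) ->
  measurable_fun `]0, r[ f ->
  (forall x y, 0 < x -> x < y -> y < r -> intg `[x, y] f /\
     \int[mu]_(t in `[x, y]) f t <= M) ->
  intg `]0, r[ f /\ \int[mu]_(t in `]0, r[) f t <= M.
Proof.
move=> r0 f0 mf h.
pose d n : R := r / n.+3%:R.
have d0 n : 0 < d n by rewrite divr_gt0// ltr0n.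
have d3 n : 3 * d n <= r.
  rewrite mulrC -ler_pdivlMr// ler_wpM2l ?(ltW r0)//.
  by rewrite lef_pV2 ?posrE ?ltr0n// ler_nat.
pose G n : set R := `[d n, r - d n]%classic.
have subG n : G n `<=` `]0, r[ by apply: segment_sub_oo => //; rewrite gtrBl.
have UG : \bigcup_n G n = `]0, r[%classic.
  apply/seteqP; split => [t [n _]|t /=]; first exact: subG.
  rewrite in_itv/= => /andP[t0 tr].
  have m0 : 0 < Num.min t (r - t) / r by rewrite divr_gt0// lt_min t0 subr_gt0.
  have [n hn] := ltr_add_invr m0; rewrite add0r in hn.
  exists n; first by [].
  rewrite /G /= in_itv/=.
  have dm : d n <= Num.min t (r - t).
    rewrite /d mulrC -ler_pdivlMr//; apply/ltW/(le_lt_trans _ hn).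
    by rewrite lef_pV2 ?posrE ?ltr0n// ler_nat -addn3 -addn1 leq_add2l.
  by move: dm; rewrite le_min => /andP[h1 h2]; apply/andP; split; lra.
have ndG : nondecreasing_seq G.
  move=> m n mn; rewrite subsetEset => t; rewrite /G /= !in_itv/= => /andP[h1 h2].
  have : d n <= d m.
    by rewrite ler_wpM2l ?(ltW r0)// lef_pV2 ?posrE ?ltr0n// ler_nat !ltnS.
  by move=> dd; apply/andP; split; lra.
have mfe : measurable_fun `]0, r[ (EFin \o f) by exact/measurable_EFinP.
have cv : (\int[mu]_(t in G n) (f t)%:E @[n --> \oo] -->
    \int[mu]_(t in \bigcup_n G n) (f t)%:E)%E.
  apply: (@ge0_nondecreasing_set_cvg_integral _ (measurableTypeR R) R G
    (EFin \o f) mu) => //.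
  - by move=> n; exact: measurable_itv.
  - by move=> n; apply: measurable_funS mfe.
  - move=> n t /subG /=; rewrite in_itv/= => tr.
    by rewrite lee_fin f0.
rewrite UG in cv.
have le_M : (\int[mu]_(t in `]0%R, r[) (f t)%:E <= M%:E)%E.
  rewrite -(cvg_lim _ cv)//; apply: lime_le; first exact: cvgP cv.
  apply: nearW => n.
  have rd : d n < r - d n by have := d3 n; have := d0 n; lra.
  have [ig le1] := h _ _ (d0 n) rd (ltac:(by rewrite gtrBl)).
  have -> := Rintegral_EFin (measurable_itv _) ig.
  by rewrite lee_fin.
have fi : intg `]0, r[ f.
  apply/integrableP; split => //; apply: le_lt_trans (ltry M).
  apply: le_trans le_M; rewrite le_eqVlt; apply/orP; left; apply/eqP.
  apply: eq_integral => t; rewrite inE/= in_itv/= => tr.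
  by rewrite /= ger0_norm// f0.
by split => //; rewrite -lee_fin -Rintegral_EFin.
Qed.

End exhaustion.

(** The factor of X on the left is at most a nonnegative z, and
    X z <= z. *)
Lemma cutoff_algebra (R : realType) (K P Q X U V W g h p2 q2 : R) :
  P - 2^-1 * p2 <= 2^-1 * g -> Q - 2^-1 * q2 <= 2^-1 * h -> - W <= V ->
  0 <= 2^-1 * (K * U) -> 0 <= 2^-1 * g -> 0 <= 2^-1 * h -> 0 <= X -> X <= 1 ->
  X * P + X * Q + X * (- (2^-1 * (p2 + q2)) + 2^-1 * (K * U) + V + W) <=
  2^-1 * (g + h + K * U) + V + W.
Proof.
move: (K * U) => KU h1 h2 h3 h4 h5 h6 X0 X1.
pose z := 2^-1 * (g + h + KU) + V + W.
have z0 : 0 <= z by rewrite /z; lra.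
apply: (@le_trans _ _ (X * z)); last by rewrite -/z ler_piMl.
by rewrite -!mulrDr ler_wpM2l// /z; lra.
Qed.

Lemma ultra_le_limit (R : realType) (F : set_system nat) {FU : UltraFilter F}
    (X Y Z : nat -> R) (x y z m D : R) : \oo `<=` F ->
  X @ F --> x -> Y @ F --> y -> Z @ F --> z ->
  (forall n, - X n + - Y n + Z n <= m + n.+1%:R^-1 + D) -> - x + - y + z <= m + D.
Proof.
move=> Foo cX cY cZ h; have FP : ProperFilter F by exact: ultra_proper.
have cL : - X n + - Y n + Z n - n.+1%:R^-1 @[n --> F] --> - x + - y + z - 0.
  apply: cvgB; last exact: (@cvg_harmonic_ultra R F Foo).
  by apply: cvgD => //; apply: cvgD; exact: cvgN.
rewrite -[leLHS]subr0 -(cvg_lim (@Rhausdorff R) cL).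
apply: limr_le; first exact: cvgP cL.
by apply: nearW => n; rewrite lerBlDr [leRHS]addrAC; exact: h.
Qed.

Lemma RintegralD2 (R : realType) (D : set R) (f g : R -> R) : measurable D ->
  intg D f -> intg D g ->
  \int[@lebesgue_measure R]_(t in D) f t + \int[@lebesgue_measure R]_(t in D) g t =
  \int[@lebesgue_measure R]_(t in D) (f t + g t).
Proof. by move=> mD hf hg; rewrite RintegralD. Qed.

Lemma RintegralD3 (R : realType) (D : set R) (f g h : R -> R) : measurable D ->
  intg D f -> intg D g -> intg D h ->
  intg D (fun t => f t + g t + h t) /\
  \int[@lebesgue_measure R]_(t in D) f t + \int[@lebesgue_measure R]_(t in D) g t
    + \int[@lebesgue_measure R]_(t in D) h t =
  \int[@lebesgue_measure R]_(t in D) (f t + g t + h t).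
Proof.
move=> mD hf hg hh; have hfg := intgD mD hf hg.
split; first exact: (intgD mD hfg hh).
by rewrite (RintegralD2 mD hf hg) (RintegralD2 mD hfg hh).
Qed.

Lemma potential_continuous (R : realType) (a b c L : R) (D : set R) (w1 w2 : R -> R) :
  {within D, continuous w1} ->
  {within D, continuous w2} ->
  {within D, continuous (fun t => potential a b c L (w1 t) (w2 t))}.
Proof.
move=> cw1 cw2.
have cM := @within_continuousM R D.
have cD (f g : R -> R) cf cg : {within D, continuous (fun t => f t + g t)} :=
  @within_continuousD _ _ _ D f g cf cg.
have cN := @within_continuousN R D; have cc := @within_continuous_cst R D.
have cS (f : R -> R) (cf : {within D, continuous f}) := cM f f cf cf.
have c2 := cD _ _ (cS _ cw1) (cS _ cw2).
rewrite /potential.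
exact: (cD _ _ (cD _ _ (cM _ _ (cc _) c2) (cM _ _ (cc _) (cS _ c2)))
  (cN _ (cM _ _ (cc _) (cM _ _ cw2 (cD _ _ (cS _ cw2) (cN _ (cM _ _ (cc _) (cS _ cw1)))))))).
Qed.

Section lower_semicontinuity.
Context {R : realType}.
Notation mu := (@lebesgue_measure R).
Variables (a b c L rad : R) (k : int).
Hypotheses (c0 : 0 < c ^+ 2) (L0 : 0 < L) (rad0 : 0 < rad) (k0 : k != 0).
Local Notation finite_energy := (finite_energy a b c rad).
Local Notation edens := (energy_density a b c L k).
Local Notation potential := (potential a b c L).
Local Notation I := (`]0, rad[%classic : set R).
Local Notation cK := (k%:~R ^+ 2 : R).
Context (F : set_system nat) {FU : UltraFilter F}.
Hypothesis Foo : \oo `<=` F.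
Variables (m : R) (un vn gn hn : nat -> R -> R) (u v p q : R -> R).
Hypothesis fe_n : forall n, finite_energy (un n) (vn n) (gn n) (hn n).
Hypothesis E_n : forall n,
  \int[mu]_(t in I) edens (un n) (vn n) (gn n) (hn n) t <= m + n.+1%:R^-1.
Hypotheses (cu : {within `]0, rad], continuous u})
  (cv : {within `]0, rad], continuous v}).
Hypothesis u_lim : forall x eps : R, 0 < x -> 0 < eps -> \forall n \near F,
  forall t, x <= t -> t <= rad -> `|un n t - u t| <= eps.
Hypothesis v_lim : forall x eps : R, 0 < x -> 0 < eps -> \forall n \near F,
  forall t, x <= t -> t <= rad -> `|vn n t - v t| <= eps.
Hypotheses (cp : {within `]0, rad], continuous p})
  (cq : {within `]0, rad], continuous q}).
Hypothesis sys : el_system a b c L rad k u v p q.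

Lemma el_weak_u : is_weak_derivative `]0, rad[ u (fun t => p t / t).
Proof.
have [du _ _ _] := sys; apply: C1_weak_derivative => //.
apply: within_oc_oo; apply: within_continuousM => //; exact: within_continuous_inv.
Qed.

Lemma el_weak_v : is_weak_derivative `]0, rad[ v (fun t => q t / t).
Proof.
have [_ dv _ _] := sys; apply: C1_weak_derivative => //.
apply: within_oc_oo; apply: within_continuousM => //; exact: within_continuous_inv.
Qed.

(** From t (g - g'/t)^2 >= 0. *)
Lemma young_density (t g g' : R) : 0 < t ->
  t * (g' / t) * g - 2^-1 * (t * (g' / t) ^+ 2) <= 2^-1 * (t * g ^+ 2).
Proof.
move=> t0; have := mulr_ge0 (ltW t0) (sqr_ge0 (g - g' / t)).
move: (g' / t) => z; lra.
Qed.

(** What remains of the lower bound for the energy density, after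
    [young_density] and multiplication by the cutoff, once the terms linear in
    the derivatives of the sequence are removed.  It converges uniformly, and
    the constant C makes the cut-off energy density nonnegative. *)
Definition cutoff_density (C : R) (w1 w2 p q chi : R -> R) (t : R) : R :=
  chi t * (- (2^-1 * (p t * p t * t^-1 + q t * q t * t^-1))
  + 2^-1 * (cK * (w1 t ^+ 2 * t^-1))
  + t * potential (w1 t) (w2 t) + C * t).

(** The energy of the n-th pair is bounded below by
    int p chi g_n + int q chi h_n + int cutoff_density.  Integration by parts
    turns the first two into integrals of u_n and v_n against fixed smooth
    functions, so all three converge; undoing the integration by parts for the
    limit, p chi u' - p^2 chi / (2 t) = t u'^2 chi / 2. *)
Lemma cutoff_lower_semicontinuity C chi x y :
  (forall z w, - C <= potential z w) -> 0 <= C ->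
  smooth_on setT chi -> (forall t, 0 <= chi t <= 1) ->
  0 < x -> x < y -> y < rad -> supported x y chi ->
  \int[mu]_(t in I) (chi t * (edens u v (fun t => p t / t) (fun t => q t / t) t + C * t))
  <= m + \int[mu]_(t in I) (C * t).
Proof.
move=> hC C0 schi chi01 x0 xy yr sp.
have FP : ProperFilter F by exact: ultra_proper.
have sub : `[x, y] `<=` `]0, rad[ by exact: segment_sub_oo.
have [su sv s_p s_q] := el_system_smooth sys.
have sP := smooth_cutoff s_p schi x0 yr sp.
have sQ := smooth_cutoff s_q schi x0 yr sp.
have spP : supported x y (fun t => chi t * p t) by move=> t tn; rewrite sp// mul0r.
have spQ : supported x y (fun t => chi t * q t) by move=> t tn; rewrite sp// mul0r.
have cun n : {within `]0, rad], continuous (un n)} by have [[]] := fe_n n.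
have cvn n : {within `]0, rad], continuous (vn n)} by have [[]] := fe_n n.
have hu : cucvg F x y un u by apply: (limit_cucvg _ _ _ cun cu u_lim).
have hv : cucvg F x y vn v by apply: (limit_cucvg _ _ _ cvn cv v_lim).
have fixd (f : R -> R) : {within `]0, rad], continuous f} -> cucvg F x y (fun=> f) f.
  move=> cf; apply: cucvg_cst => //; apply: continuous_subspaceW cf.
  by move=> t /sub /=; rewrite !in_itv/= => /andP[-> /ltW ->].
have hp := fixd _ cp; have hq := fixd _ cq.
have hchi : cucvg F x y (fun=> chi) chi.
  by apply: fixd; apply: continuous_subspaceT; exact: smooth_continuous.
have hid : cucvg F x y (fun _ t => t) (fun t => t).
  by apply: fixd; apply: continuous_subspaceT => t; exact: cvg_id.
have hV : cucvg F x y (fun _ t => t^-1) (fun t => t^-1).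
  exact: fixd (@within_continuous_inv R rad).
have hc (D : R) : cucvg F x y (fun _ _ => D) (fun=> D).
  by apply: fixd => t; exact: cvg_cst.
have hD : cucvg F x y (fun n => cutoff_density C (un n) (vn n) p q chi)
    (cutoff_density C u v p q chi).
  by rewrite /cutoff_density /potential; cucvg_tac hc.
have wstep n : - (\int[mu]_(t in `[x, y]) (un n t * derive1 (fun t => chi t * p t) t))
    + - (\int[mu]_(t in `[x, y]) (vn n t * derive1 (fun t => chi t * q t) t))
    + (\int[mu]_(t in `[x, y]) cutoff_density C (un n) (vn n) p q chi t)
    <= m + n.+1%:R^-1 + \int[mu]_(t in I) (C * t).
  have [_ [wu wv] _ _ _] := fe_n n.
  have EX := esym (weak_derivative_test wu sP x0 xy yr spP).
  have EY := esym (weak_derivative_test wv sQ x0 xy yr spQ).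
  have spD : supported x y (cutoff_density C (un n) (vn n) p q chi).
    by move=> t tn; rewrite /cutoff_density sp// mul0r.
  have ED : \int[mu]_(t in `[x, y]) cutoff_density C (un n) (vn n) p q chi t =
      \int[mu]_(t in I) cutoff_density C (un n) (vn n) p q chi t.
    exact: esym (supported_Rintegral sub spD).
  have iX : intg I (fun t => gn n t * (chi t * p t)).
    have [_ lg _] := wu; exact: locally_intg_test lg x0 yr (smooth_continuous sP) spP.
  have iY : intg I (fun t => hn n t * (chi t * q t)).
    have [_ lg _] := wv; exact: locally_intg_test lg x0 yr (smooth_continuous sQ) spQ.
  have iD : intg I (cutoff_density C (un n) (vn n) p q chi).
    by apply: (supported_intg _ sub spD) => //; apply: intg_segment; have [] := hD.
  have iE := energy_density_intg k c0 L0 rad0 (fe_n n).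
  have iC := intg_linear_oo rad0 C.
  have [iS ES] := RintegralD3 (measurable_itv _) iX iY iD.
  have SE := congr2 +%R (congr2 +%R EX EY) ED.
  rewrite (etrans SE ES).
  have E1 := RintegralD2 (measurable_itv _) iE iC.
  have iEC := intgD (measurable_itv _) iE iC.
  apply: (le_trans (y := \int[mu]_(t in I)
      (edens (un n) (vn n) (gn n) (hn n) t + C * t))); last first.
    by rewrite -E1 lerD2r.
  apply: le_Rintegral => //.
  move=> t /=; rewrite in_itv/= => /andP[t0 tr].
  have [ch0 ch1] := andP (chi01 t).
  have h1 := young_density (gn n t) (p t) t0.
  have h2 := young_density (hn n t) (q t) t0.
  have tn0 : t != 0 by rewrite gt_eqF.
  have pt : t * (p t / t) = p t by rewrite mulrC divfK.
  have qt : t * (q t / t) = q t by rewrite mulrC divfK.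
  have p2t : t * (p t / t) ^+ 2 = p t * p t * t^-1 by rewrite expr2 mulrA pt mulrA.
  have q2t : t * (q t / t) ^+ 2 = q t * q t * t^-1 by rewrite expr2 mulrA qt mulrA.
  rewrite pt p2t in h1; rewrite qt q2t in h2.
  have h3 : - (C * t) <= t * potential (un n t) (vn n t).
    by rewrite -mulNr mulrC ler_wpM2l// ltW.
  have K0 : 0 <= 2^-1 * (cK * (un n t ^+ 2 * t^-1)).
    by rewrite mulr_ge0// mulr_ge0 ?sqr_ge0// mulr_ge0 ?sqr_ge0// invr_ge0 ltW.
  have g0 : 0 <= 2^-1 * (t * gn n t ^+ 2).
    by rewrite mulr_ge0// mulr_ge0 ?sqr_ge0// ltW.
  have h0 : 0 <= 2^-1 * (t * hn n t ^+ 2).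
    by rewrite mulr_ge0// mulr_ge0 ?sqr_ge0// ltW.
  rewrite /energy_density /cutoff_density.
  move: h1 h2 h3 K0 g0 h0 ch0 ch1.
  set P1 := p t * gn n t; set Q1 := q t * hn n t.
  have -> : gn n t * (chi t * p t) = chi t * P1 by rewrite /P1; ring.
  have -> : hn n t * (chi t * q t) = chi t * Q1 by rewrite /Q1; ring.
  move: (P1) (Q1) (chi t) (un n t ^+ 2 * t^-1) (t * potential _ _) (C * t) => P2 Q2 X U V W.
  move: (t * gn n t ^+ 2) (t * hn n t ^+ 2) (p t * p t * t^-1) (q t * q t * t^-1).
  exact: cutoff_algebra.
pose lim := - (\int[mu]_(t in `[x, y]) (u t * derive1 (fun t => chi t * p t) t))
    + - (\int[mu]_(t in `[x, y]) (v t * derive1 (fun t => chi t * q t) t))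
    + \int[mu]_(t in `[x, y]) cutoff_density C u v p q chi t.
have lim_le : lim <= m + \int[mu]_(t in I) (C * t).
  have hw (f : R -> R) : smooth_on setT f -> cucvg F x y (fun=> derive1 f) (derive1 f).
    move=> sf; apply: fixd; apply: continuous_subspaceT.
    by apply: smooth_continuous; exact: smooth_derive1.
  have cX := @cucvg_integral R F FU x y xy _ _ (cucvgM hu (hw _ sP)).
  have cY := @cucvg_integral R F FU x y xy _ _ (cucvgM hv (hw _ sQ)).
  have cD := @cucvg_integral R F FU x y xy _ _ hD.
  exact: (ultra_le_limit Foo (cX FU) (cY FU) cD wstep).
apply: le_trans lim_le; rewrite le_eqVlt; apply/orP; left; apply/eqP.
have EX := esym (weak_derivative_test el_weak_u sP x0 xy yr spP).
have EY := esym (weak_derivative_test el_weak_v sQ x0 xy yr spQ).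
have spD : supported x y (cutoff_density C u v p q chi).
  by move=> t tn; rewrite /cutoff_density sp// mul0r.
have ED : \int[mu]_(t in `[x, y]) cutoff_density C u v p q chi t =
    \int[mu]_(t in I) cutoff_density C u v p q chi t.
  exact: esym (supported_Rintegral sub spD).
have iX : intg I (fun t => p t / t * (chi t * p t)).
  have [_ lg _] := el_weak_u.
  exact: locally_intg_test lg x0 yr (smooth_continuous sP) spP.
have iY : intg I (fun t => q t / t * (chi t * q t)).
  have [_ lg _] := el_weak_v.
  exact: locally_intg_test lg x0 yr (smooth_continuous sQ) spQ.
have iD : intg I (cutoff_density C u v p q chi).
  by apply: (supported_intg _ sub spD) => //; apply: intg_segment; have [] := hD.
have [_ ES] := RintegralD3 (measurable_itv _) iX iY iD.
have SE := congr2 +%R (congr2 +%R EX EY) ED.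
rewrite /lim (etrans SE ES).
apply: eq_Rintegral => t; rewrite inE/= in_itv/= => /andP[t0 _].
rewrite /energy_density /cutoff_density.
have tn0 : t != 0 by rewrite gt_eqF.
by move: (potential _ _) => V; field.
Qed.

(** Let the cutoff increase to 1: the density plus C t is
    nonnegative, so its integral over the whole interval is finite, and each
    of its nonnegative parts is integrable. *)
Lemma limit_minimises : u rad = s_plus a b c / Num.sqrt 2 ->
  v rad = - (s_plus a b c / Num.sqrt 6) ->
  finite_energy u v (fun t => p t / t) (fun t => q t / t) /\
  \int[mu]_(t in I) edens u v (fun t => p t / t) (fun t => q t / t) t <= m.
Proof.
move=> ur vr; have [C C0 hC] := potential_lower_bound a b c0 L0.
pose P := fun t => t * (p t / t) ^+ 2; pose Q := fun t => t * (q t / t) ^+ 2.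
pose U := fun t => cK * (u t ^+ 2 / t).
pose V := fun t => t * (potential (u t) (v t) + C).
pose e t := 2^-1 * (P t + Q t + U t) + V t.
have eE t : e t = edens u v (fun t => p t / t) (fun t => q t / t) t + C * t.
  by rewrite /e /energy_density -[RHS]addrA; congr (_ + _); rewrite /V mulrDr [t * C]mulrC.
have P0 t : 0 < t < rad -> 0 <= P t by move=> /andP[/ltW t0 _]; rewrite mulr_ge0 ?sqr_ge0.
have Q0 t : 0 < t < rad -> 0 <= Q t by move=> /andP[/ltW t0 _]; rewrite mulr_ge0 ?sqr_ge0.
have U0 t : 0 < t < rad -> 0 <= U t.
  by move=> /andP[/ltW t0 _]; rewrite mulr_ge0 ?sqr_ge0// divr_ge0 ?sqr_ge0.
have V0 t : 0 < t < rad -> 0 <= V t.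
  by move=> /andP[/ltW t0 _]; rewrite mulr_ge0// addrC -lerBlDl sub0r hC.
have e0 t : 0 < t < rad -> 0 <= e t.
  by move=> tr; have := P0 t tr; have := Q0 t tr; have := U0 t tr;
     have := V0 t tr; rewrite /e; lra.
have cM := @within_continuousM R I.
have cD (f g : R -> R) cf cg : {within I, continuous (fun t => f t + g t)} :=
  @within_continuousD _ _ _ I f g cf cg.
have cC := @within_continuous_cst R I.
have cid : {within I, continuous (fun t : R => t)}.
  by apply: continuous_subspaceT => t; exact: cvg_id.
have cinv := within_oc_oo (@within_continuous_inv R rad).
have [cu' cv' cp' cq'] := And4 (within_oc_oo cu) (within_oc_oo cv)
  (within_oc_oo cp) (within_oc_oo cq).
have cpt := cM _ _ cp' cinv; have cqt := cM _ _ cq' cinv.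
have cP : {within I, continuous P} := cM _ _ cid (cM _ _ cpt cpt).
have cQ : {within I, continuous Q} := cM _ _ cid (cM _ _ cqt cqt).
have cuu : {within I, continuous (fun t => u t ^+ 2 / t)} := cM _ _ (cM _ _ cu' cu') cinv.
have cU : {within I, continuous U} := cM _ _ (cC _) cuu.
have cV : {within I, continuous V} :=
  cM _ _ cid (cD _ _ (potential_continuous cu' cv') (cC _)).
have ce : {within I, continuous e} :=
  cD _ _ (cM _ _ (cC _) (cD _ _ (cD _ _ cP cQ) cU)) cV.
have mf (f : R -> R) : {within I, continuous f} -> measurable_fun I f.
  exact: subspace_continuous_measurable_fun.
have [ie le_e] : intg I e /\ \int[mu]_(t in I) e t <= m + \int[mu]_(t in I) (C * t).
  apply: intg_exhaust => //; first exact: mf.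
  move=> x y x0 xy yr.
  (* room for the cutoff to reach 1 on [x, y] with support inside ]0, rad[ *)
  pose d := Num.min (x / 2) ((rad - y) / 2).
  have d0 : 0 < d by rewrite lt_min !divr_gt0// subr_gt0.
  have dx : d <= x / 2 by rewrite ge_min lexx.
  have dy : d <= (rad - y) / 2 by rewrite ge_min lexx orbT.
  have x1 : 0 < x - d by lra.
  have xy1 : x - d < y + d by lra.
  have y1 : y + d < rad by lra.
  have ys : y + d < rad by [].
  have sub : `[x, y] `<=` I by exact: segment_sub_oo.
  have sub1 : `[x - d, y + d] `<=` I by exact: segment_sub_oo.
  pose chi := plateau (x - d) y d.
  have xdy : x - d <= y by lra.
  have xdy2 : x - d + d <= y by lra.
  have sp : supported (x - d) (y + d) chi by move=> t tn; apply: plateau_out.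
  have := cutoff_lower_semicontinuity hC C0 (@smooth_plateau _ (x - d) y d)
    (fun t => plateau_01 t d0 xdy2) x1 xy1 y1 sp.
  have -> : \int[mu]_(t in I) (plateau (x - d) y d t *
      (edens u v (fun t => p t / t) (fun t => q t / t) t + C * t)) =
      \int[mu]_(t in I) (chi t * e t).
    by apply: eq_Rintegral => t _; rewrite eE.
  move=> le1.
  have cce : {within `[x - d, y + d], continuous (fun t => chi t * e t)}.
    have cc : {within I, continuous chi}.
      by apply: continuous_subspaceT; apply: smooth_continuous; exact: smooth_plateau.
    by apply: continuous_subspaceW (cM _ _ cc ce).
  have spe : supported (x - d) (y + d) (fun t => chi t * e t).
    by move=> t tn; rewrite sp// mul0r.
  have ice : intg I (fun t => chi t * e t).
    by apply: (supported_intg _ sub1 spe) => //; exact: intg_segment.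
  have ixy : intg `[x, y] e by apply: intg_segment; apply: continuous_subspaceW ce.
  split => //; apply: (le_trans _ le1).
  have -> : \int[mu]_(t in `[x, y]) e t = \int[mu]_(t in `[x, y]) (chi t * e t).
    apply: eq_Rintegral => t; rewrite inE/= in_itv/= => /andP[xt ty].
    by rewrite /chi plateau_in ?mul1r// subrK xt ty.
  apply: Rintegral_subset_ge0 => // t /=; rewrite in_itv/= => tr.
  by rewrite mulr_ge0 ?e0//; have /andP[] := plateau_01 t d0 xdy2.
have small (f : R -> R) (D : R) : {within I, continuous f} ->
    (forall t, 0 < t < rad -> 0 <= f t <= D * e t) -> intg I f.
  move=> cf h; apply: (@intg_le _ _ _ (fun t => D * e t)) => //; first exact: mf.
    move=> t /=; rewrite in_itv/= => tr.
    by have /andP[f0 fe1] := h t tr; rewrite ger0_norm.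
  exact: intgZ.
have iP : intg I P.
  apply: (@small _ 2) => // t tr; rewrite P0//=.
  by have := Q0 t tr; have := U0 t tr; have := V0 t tr; rewrite /e; lra.
have iQ : intg I Q.
  apply: (@small _ 2) => // t tr; rewrite Q0//=.
  by have := P0 t tr; have := U0 t tr; have := V0 t tr; rewrite /e; lra.
have iU : intg I U.
  apply: (@small _ 2) => // t tr; rewrite U0//=.
  by have := P0 t tr; have := Q0 t tr; have := V0 t tr; rewrite /e; lra.
have K0 : cK != 0 by rewrite expf_neq0// intr_eq0.
have fe : finite_energy u v (fun t => p t / t) (fun t => q t / t).
  split => //; first by split; [exact: el_weak_u|exact: el_weak_v].
  apply: (@eq_intg _ _ (fun t => cK^-1 * U t)) => //; last exact: intgZ.
  by move=> t _; rewrite mulKf.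
split => //.
have iE := energy_density_intg k c0 L0 rad0 fe.
have iC := intg_linear_oo rad0 C.
have E1 := RintegralD2 (measurable_itv _) iE iC.
rewrite -(lerD2r (\int[mu]_(t in I) (C * t))) E1; apply: le_trans le_e.
by rewrite le_eqVlt; apply/orP; left; apply/eqP; apply: eq_Rintegral => t _; rewrite eE.
Qed.

End lower_semicontinuity.

(** * Behaviour at the axis *)

Section axis.
Context {R : realType}.
Notation mu := (@lebesgue_measure R).
Implicit Types (f g w u v q H : R -> R) (r l x y t eps : R).

Definition axis_limit r w l := forall eps, 0 < eps ->
  exists2 x, 0 < x < r & forall t, 0 < t -> t <= x -> `|w t - l| <= eps.

Definition axis_extension w l t := if t <= 0 then l else w t.

Lemma axis_extensionE w l t : 0 < t -> axis_extension w l t = w t.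
Proof. by move=> t0; rewrite /axis_extension leNgt t0. Qed.

Lemma axis_extension0 w l : axis_extension w l 0 = l.
Proof. by rewrite /axis_extension lexx. Qed.

Lemma axis_extension_within r w l : 0 < r -> {within `]0, r], continuous w} ->
  axis_limit r w l -> {within `[0, r], continuous (axis_extension w l)}.
Proof.
move=> r0 cw lw; apply/subspace_continuousP => t /=; rewrite in_itv/= => /andP[t0 tr].
apply/cvgrPdist_le => eps eps0; rewrite near_withinE.
suff : \forall s \near t, s \in `[0, r] ->
  `|axis_extension w l t - axis_extension w l s| <= eps by [].
move: t0; rewrite le_eqVlt => /predU1P[t0|t0].
  have [x /andP[x0 xr] hx] := lw _ eps0.
  rewrite -t0 axis_extension0; near=> s.
  rewrite in_itv/= => /andP[s0 sr].
  move: s0; rewrite le_eqVlt => /predU1P[<-|s0].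
    by rewrite axis_extension0 subrr normr0 ltW.
  rewrite axis_extensionE// distrC; apply: hx => //; apply: ltW.
  by near: s; exact: lt_nbhsl.
move/subspace_continuousP : cw => /(_ t); rewrite /= in_itv/= t0 tr => /(_ isT).
move/cvgrPdist_le => /(_ _ eps0); rewrite near_withinE => h.
near=> s; rewrite in_itv/= => /andP[_ sr].
have s0 : 0 < s by near: s; exact: lt_nbhsr.
rewrite !axis_extensionE//.
have : s \in `]0, r] by rewrite in_itv/= s0 sr.
by near: s; exact: h.
Unshelve. all: by end_near. Qed.

(** By the mean value theorem a difference quotient
    is a value of g at an intermediate point; this covers the one-sided
    derivatives at both ends. *)
Lemma has_derivative_within_segment r f g : {within `[0, r], continuous f} ->
  {within `[0, r], continuous g} ->
  (forall t, 0 < t < r -> is_derive t 1 f (g t)) ->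
  forall x, x \in `[0, r] -> has_derivative_within `[0, r] f x (g x).
Proof.
move=> cf cg df x xr.
have mvt y z : 0 <= y -> y < z -> z <= r -> exists2 s, y < s < z &
    (f z - f y) / (z - y) = g s.
  move=> y0 yz zr.
  have [||s] := @MVT _ f g y z yz.
  - by move=> t; rewrite in_itv/= => /andP[t1 t2]; apply: df; apply/andP; split; lra.
  - by apply: continuous_subspaceW cf => t /=; rewrite !in_itv/= => /andP[t1 t2];
      apply/andP; split; lra.
  rewrite in_itv/= => hs E; exists s => //.
  by rewrite E mulfK// subr_eq0 gt_eqF.
apply/cvgrPdist_le => eps eps0.
move/subspace_continuousP : cg => /(_ x xr) /cvgrPdist_le /(_ _ eps0).
rewrite near_withinE => /nbhs_ballP [d /= d0 hd].
rewrite /has_derivative_within near_withinE /dnbhs near_withinE.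
near=> y => yx yr; have [x0 xr'] := andP (xr : 0 <= x <= r).
have [y0 yr'] := andP (yr : 0 <= y <= r).
have xyd : `|x - y| < d by near: y; apply: cvgr_dist_lt => //; exact: cvg_id.
have close s : 0 <= s -> s <= r -> `|x - s| < d -> `|g x - g s| <= eps.
  by move=> s0 sr sd; apply: hd; rewrite ?/ball//= in_itv/= s0 sr.
have [xy|yx'|xy] := ltgtP x y; last by rewrite xy eqxx in yx.
  have [s /andP[s1 s2] ->] := mvt x y x0 xy yr'.
  apply: close; [lra|lra|].
  by move: xyd; rewrite !ltr_norml => /andP[h1 h2]; apply/andP; split; lra.
have [s /andP[s1 s2] E] := mvt y x y0 yx' xr'.
have -> : (f y - f x) / (y - x) = g s.
  by rewrite -E -opprB -[y - x]opprB invrN mulrNN.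
apply: close; [lra|lra|].
by move: xyd; rewrite !ltr_norml => /andP[h1 h2]; apply/andP; split; lra.
Unshelve. all: by end_near. Qed.

(** The limit is v r - int_0^r g: the distance of v t to it is
    int_0^t g, which is O(t). *)
Lemma axis_limit_primitive r v g : 0 < r -> {within `]0, r], continuous v} ->
  {within `[0, r], continuous g} ->
  (forall t, 0 < t < r -> is_derive t 1 v (g t)) ->
  exists l, axis_limit r v l.
Proof.
move=> r0 cv cg dv; have [K hK] := within_segment_bounded r0 cg.
pose J := \int[mu]_(s in `[0, r]) g s.
have ig := intg_segment cg.
exists (v r - J) => eps eps0.
have K1 : 0 < `|K| + 1 by rewrite ltr_pwDr.
have d0 : 0 < Num.min (eps / (`|K| + 1)) (r / 2) by rewrite lt_min !divr_gt0.
exists (Num.min (eps / (`|K| + 1)) (r / 2)).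
  by rewrite d0/= gt_min; apply/orP; right; lra.
move=> t t0; rewrite le_min => /andP[te tr].
have tr' : t < r by lra.
have E : \int[mu]_(s in `[t, r]) g s = v r - v t.
  apply: (FTC2_within tr') => [||s].
  - by apply: continuous_subspaceW cg; apply: subset_itvr; rewrite bnd_simp ltW.
  - by apply: continuous_subspaceW cv; apply: subset_itvr; rewrite bnd_simp.
  - by rewrite in_itv/= => /andP[s1 s2]; apply: dv; apply/andP; split; lra.
have ig0 : intg `[0, t] g.
  by apply: intgS ig => //; apply: subset_itvl; rewrite bnd_simp ltW.
have E2 : J - \int[mu]_(s in `[0, t]) g s = \int[mu]_(s in `[t, r]) g s.
  rewrite (@Rintegral_itvB _ g (BLeft 0) (BRight r) t)//; last 2 first.
  - by rewrite bnd_simp ltW.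
  - by rewrite bnd_simp ltW.
  rewrite Rintegral_itv_obnd_cbnd//; apply: intgS ig => //.
  by apply: subset_itvr; rewrite bnd_simp ltW.
have -> : v t - (v r - J) = \int[mu]_(s in `[0, t]) g s by lra.
apply: (le_trans (le_Rintegral_bound (K := `|K| + 1) (ltW t0) ig0 _)).
  move=> s; rewrite in_itv/= => /andP[s0 st].
  apply: (le_trans (hK s _)); first by rewrite in_itv/= s0; lra.
  by apply: (le_trans (ler_norm K)); rewrite lerDl.
by rewrite subr0 mulrC -ler_pdivlMr.
Qed.

Lemma C1_axis_extension r v g : 0 < r -> {within `]0, r], continuous v} ->
  {within `]0, r], continuous g} -> axis_limit r g 0 ->
  (forall t, 0 < t < r -> is_derive t 1 v (g t)) ->
  exists l, C1_within `[0, r] (axis_extension v l) /\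
    has_derivative_within `[0, r] (axis_extension v l) 0 0.
Proof.
move=> r0 cv cg lg dv; have cG := axis_extension_within r0 cg lg.
have [l lv] : exists l, axis_limit r v l.
  apply: (@axis_limit_primitive r v (axis_extension g 0)) => // t tr.
  have [t0 _] := andP tr; rewrite axis_extensionE//; exact: dv.
exists l; have cV := axis_extension_within r0 cv lv.
have D := has_derivative_within_segment cV cG.
have {}D x : x \in `[0, r] ->
    has_derivative_within `[0, r] (axis_extension v l) x (axis_extension g 0 x).
  apply: D => t /andP[t0 tr]; rewrite axis_extensionE//.
  have dvt : is_derive t 1 v (g t) by apply: dv; rewrite t0.
  apply: (@near_eq_is_derive _ _ _ v) => //.
  near=> s; apply/esym/axis_extensionE; near: s; exact: lt_nbhsr.
split; first by exists (axis_extension g 0).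
by have := D 0; rewrite axis_extension0; apply; rewrite in_itv/= lexx ltW.
Unshelve. all: by end_near. Qed.

End axis.
Section axis_decay.
Context {R : realType}.
Notation mu := (@lebesgue_measure R).
Implicit Types (f g w u v q h : R -> R) (r l x y t eps : R).

(** Otherwise f t / t >= eps / t near 0, and 1/t is not integrable
    there. *)
Lemma small_near_axis r f x eps : 0 < r ->
  (forall t, 0 < t < r -> 0 <= f t) -> intg `]0, r[ (fun t => f t / t) ->
  0 < x -> x < r -> 0 < eps -> exists2 y, 0 < y < x & f y < eps.
Proof.
move=> r0 f0 fi x0 xr eps0; apply: contrapT => H.
have big t : 0 < t -> t < x -> eps <= f t.
  move=> t0 tx; rewrite leNgt; apply/negP => ft; apply: H; exists t => //.
  by rewrite t0.
pose J := \int[mu]_(t in `]0, r[) (f t / t).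
have J0 : 0 <= J.
  apply: Rintegral_ge0 => t /=; rewrite in_itv/= => /andP[t0 tr].
  by rewrite divr_ge0 ?f0 ?t0// ltW.
pose z := x / 2; have z0 : 0 < z by rewrite divr_gt0.
have zx : z < x by rewrite /z; lra.
(* chosen so that the integral of eps / t over [y, z] is J + eps *)
pose y := z * expR (- (J / eps + 1)).
have y0 : 0 < y by rewrite mulr_gt0 ?expR_gt0.
have yz : y <= z.
  rewrite ger_pMr// -[leRHS]expR0 ler_expR oppr_le0.
  by rewrite addr_ge0// divr_ge0// ltW.
have [iV EV] := intg_inv y0 yz.
have sub : `[y, z] `<=` (`]0, r[%classic : set R).
  by apply: segment_sub_oo => //; exact: lt_trans zx _.
have fi' : intg `[y, z] (fun t => f t / t) by apply: intgS fi.
have L1 : \int[mu]_(t in `[y, z]) (f t / t) <= J.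
  apply: Rintegral_subset_ge0 => // t /=; rewrite in_itv/= => /andP[t0 tr].
  by rewrite divr_ge0 ?f0 ?t0// ltW.
have L2 : \int[mu]_(t in `[y, z]) (eps * t^-1) <= \int[mu]_(t in `[y, z]) (f t / t).
  apply: le_Rintegral => //; first exact: intgZ.
  move=> t /=; rewrite in_itv/= => /andP[t1 t2].
  have t0 : 0 < t by exact: lt_le_trans t1.
  by rewrite ler_wpM2r ?invr_ge0 ?(ltW t0)// big// (le_lt_trans t2).
have L3 : \int[mu]_(t in `[y, z]) (eps * t^-1) = J + eps.
  rewrite RintegralZl// EV /y lnM ?posrE ?expR_gt0// expRK opprD opprK addrA subrr add0r.
  by rewrite mulrDr mulr1 mulrC divfK ?gt_eqF.
by move: L1 L2; rewrite L3; lra.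
Qed.

(** If the integral over [x, y] is within eps of the total, at most eps is
    left for the segments to the left of x. *)
Lemma small_tail r f eps : 0 < r -> (forall t, 0 < t < r -> 0 <= f t) ->
  intg `]0, r[ f -> 0 < eps ->
  exists2 x, 0 < x < r & forall y z, 0 < y -> y <= z -> z <= x ->
    \int[mu]_(t in `[y, z]) f t <= eps.
Proof.
move=> r0 f0 fi eps0; pose J := \int[mu]_(t in `]0, r[) f t.
have mono (D E : set R) : measurable D -> measurable E -> D `<=` E ->
    E `<=` `]0, r[ -> \int[mu]_(t in D) f t <= \int[mu]_(t in E) f t.
  move=> mD mE DE EI; apply: Rintegral_subset_ge0 => //; first exact: intgS fi.
  by move=> t /EI /=; rewrite in_itv/=; exact: f0.
have [x [y [x0 xy yr xyJ]]] : exists x y, [/\ 0 < x, x < y, y < r &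
    J - eps < \int[mu]_(t in `[x, y]) f t].
  apply: contrapT => H.
  have [||_] := @intg_exhaust R r f (J - eps) r0 f0.
  - exact: intg_measurable fi.
  - move=> x y x0 xy yr; split.
      by apply: intgS fi => //; exact: segment_sub_oo.
    by rewrite leNgt; apply/negP => h; apply: H; exists x, y.
  by rewrite -/J; lra.
exists x; first by rewrite x0 (lt_trans xy).
move=> y' z y'0 y'z zx.
have sub : `[y', y] `<=` (`]0, r[%classic : set R) by exact: segment_sub_oo.
have E : \int[mu]_(t in `[y', y]) f t - \int[mu]_(t in `[y', x]) f t =
    \int[mu]_(t in `[x, y]) f t.
  rewrite (@Rintegral_itvB _ f (BLeft y') (BRight y) x)//; last 3 first.
  - exact: intgS fi.
  - by rewrite bnd_simp (le_trans y'z).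
  - by rewrite bnd_simp ltW.
  rewrite Rintegral_itv_obnd_cbnd//; apply: intgS fi => //.
  by apply: subset_trans sub; apply: subset_itv; rewrite bnd_simp// (le_trans y'z).
have L1 : \int[mu]_(t in `[y', z]) f t <= \int[mu]_(t in `[y', x]) f t.
  apply: mono => //; first by apply: subset_itvl; rewrite bnd_simp.
  by apply: subset_trans sub; apply: subset_itvl; rewrite bnd_simp ltW.
have L2 : \int[mu]_(t in `[y', y]) f t <= J by exact: mono.
by lra.
Qed.

(** The derivative 2 u g of u^2 is at most u^2/t + t g^2 in absolute
    value, whose integral near 0 is small, and by [small_near_axis] u^2 is small
    at points arbitrarily close to 0. *)
Lemma axis_vanishing r u g : 0 < r ->
  (forall t, 0 < t < r -> is_derive t 1 u (g t)) ->
  {within `]0, r[, continuous g} ->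
  intg `]0, r[ (fun t => u t ^+ 2 / t) -> intg `]0, r[ (fun t => t * g t ^+ 2) ->
  axis_limit r u 0.
Proof.
move=> r0 du cg iu ig eps eps0.
have cu : {within `]0, r[, continuous u}.
  by apply: (@is_derive_continuous_oo _ _ _ g) => t; rewrite in_itv/=; exact: du.
pose f t := u t ^+ 2 / t + t * g t ^+ 2.
have fi : intg `]0, r[ f by exact: intgD.
have f0 t : 0 < t < r -> 0 <= f t.
  move=> /andP[/ltW t0 _]; apply: addr_ge0; first by rewrite divr_ge0 ?sqr_ge0.
  by rewrite mulr_ge0 ?sqr_ge0.
(* half of eps^2 for the tail of the integral, half for u^2 at the chosen point *)
have e20 : 0 < eps ^+ 2 / 2 by rewrite divr_gt0// exprn_gt0.
have [x /andP[x0 xr] hx] := small_tail r0 f0 fi e20.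
exists x; first by rewrite x0.
move=> t t0 tx; have tr : t < r by exact: le_lt_trans tx xr.
have [y /andP[y0 yt] uy] := small_near_axis r0
  (fun s _ => sqr_ge0 (u s)) iu t0 tr e20.
rewrite subr0.
have sub : `[y, t] `<=` (`]0, r[%classic : set R) by exact: segment_sub_oo.
have cM := @within_continuousM R `]0, r[%classic.
have c2 : {within `]0, r[, continuous (fun s => 2 * (u s * g s))}.
  exact: (cM _ _ (@within_continuous_cst R _ 2) (cM _ _ cu cg)).
have c2' : {within `[y, t], continuous (fun s => 2 * (u s * g s))}.
  by apply: continuous_subspaceW c2.
have E : \int[mu]_(s in `[y, t]) (2 * (u s * g s)) = u t ^+ 2 - u y ^+ 2.
  apply: (@FTC2_within R y t _ (fun s => u s ^+ 2) yt c2') => [|s]; first exact: continuous_subspaceW (cM _ _ cu cu).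
  rewrite in_itv/= => /andP[s1 s2].
  have ds : is_derive s 1 u (g s) by apply: du; apply/andP; split; lra.
  by apply: (is_derive_eq (is_deriveM ds ds)); rewrite /GRing.scale/=; ring.
have L : \int[mu]_(s in `[y, t]) (2 * (u s * g s)) <= \int[mu]_(s in `[y, t]) f s.
  apply: le_Rintegral => //; [exact: intg_segment|exact: intgS fi|].
  move=> s /sub /=; rewrite in_itv/= => /andP[s0 _].
  have := mulr_ge0 (ltW s0) (sqr_ge0 (u s / s - g s)).
  rewrite /f; have -> : u s ^+ 2 / s = s * (u s / s) ^+ 2.
    by field; rewrite gt_eqF.
  have -> : u s * g s = s * (u s / s) * g s by field; rewrite gt_eqF.
  by move: (u s / s) => z; nra.
have L2 := hx _ _ y0 (ltW yt) tx.
have : u t ^+ 2 <= eps ^+ 2.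
  rewrite -(subrK (u y ^+ 2) (u t ^+ 2)) -E [leRHS]splitr lerD//.
    exact: (le_trans L).
  exact: ltW.
by rewrite -(@real_normK _ (u t)) ?num_real// ler_pXn2r ?nnegrE// ltW.
Qed.

(** As q^2/t is integrable, q is small at points arbitrarily close to 0;
    integrating |q'| <= C sqrt t from such points gives |q t| <= C t sqrt t. *)
Lemma axis_flux r q h (C : R) : 0 < r ->
  (forall t, 0 < t < r -> is_derive t 1 q (h t)) ->
  (forall t, 0 < t < r -> `|h t| <= C * Num.sqrt t) ->
  intg `]0, r[ (fun t => t * (q t / t) ^+ 2) ->
  axis_limit r (fun t => q t / t) 0.
Proof.
move=> r0 dq hC iq.
have C0 : 0 <= C.
  have := hC (r / 2) (ltac:(lra)); move/(le_trans (normr_ge0 _)).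
  by rewrite pmulr_lge0// sqrtr_gt0; lra.
have iq2 : intg `]0, r[ (fun t => q t ^+ 2 / t).
  apply: eq_intg iq => // t /=; rewrite in_itv/= => /andP[t0 _].
  by field; rewrite gt_eqF.
have cq : {within `]0, r[, continuous q}.
  by apply: (@is_derive_continuous_oo _ _ _ h) => t; rewrite in_itv/=; exact: dq.
have bound t : 0 < t -> t < r -> `|q t| <= C * Num.sqrt t * t.
  move=> t0 tr; apply/ler_addgt0Pr => e e0.
  have [y /andP[y0 yt] qy] := small_near_axis r0
    (fun s _ => sqr_ge0 (q s)) iq2 t0 tr (exprn_gt0 2 e0).
  have {}qy : `|q y| <= e.
    move: (ltW qy); rewrite -(@real_normK _ (q y)) ?num_real//.
    by rewrite ler_pXn2r ?nnegrE// ltW.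
  have [||s] := @MVT _ q h y t yt.
  - by move=> s; rewrite in_itv/= => /andP[s1 s2]; apply: dq; apply/andP; split; lra.
  - by apply: continuous_subspaceW cq; exact: segment_sub_oo.
  rewrite in_itv/= => /andP[s1 s2] E.
  have -> : q t = h s * (t - y) + q y by rewrite -E; ring.
  apply: (le_trans (ler_normD _ _)); apply: lerD => //.
  rewrite normrM (@ger0_norm _ (t - y)) ?subr_ge0 ?(ltW yt)//.
  have hs : `|h s| <= C * Num.sqrt t.
    apply: (le_trans (hC s _)); first by apply/andP; split; lra.
    by rewrite ler_wpM2l// ler_wsqrtr// ltW.
  apply: ler_pM => //; first by rewrite subr_ge0 ltW.
  by rewrite gerBl ltW.
move=> eps eps0.
have C1 : 0 < C + 1 by lra.
(* C sqrt t <= eps for t <= x; C + 1 avoids a division by zero *)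
pose x := Num.min ((eps / (C + 1)) ^+ 2) (r / 2).
have x0 : 0 < x by rewrite lt_min exprn_gt0 ?divr_gt0.
have xr : x < r by rewrite gt_min; apply/orP; right; lra.
exists x; first by rewrite x0.
move=> t t0 tx; rewrite subr0 normrM normfV (gtr0_norm t0) ler_pdivrMr//.
apply: (le_trans (bound t t0 (le_lt_trans tx xr))).
rewrite ler_wpM2r ?(ltW t0)//.
have st : Num.sqrt t <= eps / (C + 1).
  rewrite -[leRHS]ger0_norm; last by rewrite divr_ge0// ltW.
  rewrite -sqrtr_sqr; apply: ler_wsqrtr.
  by apply: (le_trans tx); rewrite ge_min lexx.
rewrite ler_pdivlMr// in st; rewrite mulrC; apply: le_trans st.
by rewrite ler_wpM2l ?sqrtr_ge0// lerDl.
Qed.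

End axis_decay.

(** * The regular minimiser *)

Section minimiser.
Context {R : realType}.
Notation mu := (@lebesgue_measure R).
Variables (a b c L rad : R) (k : int).
Hypotheses (c0 : 0 < c ^+ 2) (L0 : 0 < L) (rad0 : 0 < rad) (k0 : k != 0).
Local Notation finite_energy := (finite_energy a b c rad).
Local Notation edens := (energy_density a b c L k).
Local Notation I := (`]0, rad[%classic : set R).

Lemma energy_bound : exists M : R, forall m u v gu gv (n : nat),
  finite_energy u v gu gv ->
  \int[mu]_(t in I) edens u v gu gv t <= m + n.+1%:R^-1 ->
  \int[mu]_(t in I) (t * gu t ^+ 2) <= 2 * m + M /\
  \int[mu]_(t in I) (t * gv t ^+ 2) <= 2 * m + M.
Proof.
have [C C0 hC] := @coercive R a b c L rad k c0 L0 rad0.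
exists (2 * C + 2) => m u v gu gv n fe E.
have := hC _ _ _ _ fe.
have ge0 (f : R -> R) : (forall t, 0 < t -> 0 <= f t) -> 0 <= \int[mu]_(t in I) f t.
  move=> f0; apply: Rintegral_ge0 => t /=; rewrite in_itv/= => /andP[t0 _].
  exact: f0.
have G0 : 0 <= \int[mu]_(t in I) (t * gu t ^+ 2).
  by apply: ge0 => t /ltW t0; rewrite mulr_ge0 ?sqr_ge0.
have H0 : 0 <= \int[mu]_(t in I) (t * gv t ^+ 2).
  by apply: ge0 => t /ltW t0; rewrite mulr_ge0 ?sqr_ge0.
have U0 : 0 <= k%:~R ^+ 2 * \int[mu]_(t in I) (u t ^+ 2 / t).
  by rewrite mulr_ge0 ?sqr_ge0//; apply: ge0 => t /ltW t0; rewrite divr_ge0 ?sqr_ge0.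
have n1 : n.+1%:R^-1 <= 1 :> R by rewrite invf_le1 ?ler1n ?ltr0n.
move: E n1 G0 H0 U0.
move: (\int[mu]_(t in I) _) (\int[mu]_(t in I) _) (\int[mu]_(t in I) _) (_ * _) (_^-1).
by move=> A B D E F h1 h2 h3 h4 h5 h6; split; lra.
Qed.

Lemma el_minimiser_exists : exists u v p q, 
  [/\ finite_energy u v (fun t => p t / t) (fun t => q t / t),
      {within `]0, rad], continuous p} /\ {within `]0, rad], continuous q},
      el_system a b c L rad k u v p q &
      forall u1 v1 g1 h1, finite_energy u1 v1 g1 h1 ->
        \int[mu]_(t in I) edens u v (fun t => p t / t) (fun t => q t / t) t <=
        \int[mu]_(t in I) edens u1 v1 g1 h1 t].
Proof.
have [F [FU Foo]] := @ultraFilterLemma nat \oo _.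
have [m [m_min [un [vn [gn [hn fE]]]]]] := @minimising_sequence R a b c L rad k c0 L0 rad0.
have fe n := (fE n).1; have En n := (fE n).2.
have [M hM] := energy_bound.
have cun n : {within `]0, rad], continuous (un n)} by have [[]] := fe n.
have cvn n : {within `]0, rad], continuous (vn n)} by have [[]] := fe n.
have wun n : is_weak_derivative I (un n) (gn n) by have [_ []] := fe n.
have wvn n : is_weak_derivative I (vn n) (hn n) by have [_ []] := fe n.
have iun n : intg I (fun t => t * gn n t ^+ 2) by have [_ _ []] := fe n.
have ivn n : intg I (fun t => t * hn n t ^+ 2) by have [_ _ []] := fe n.
have ubn n : un n rad = s_plus a b c / Num.sqrt 2 by have [_ _ _ _ []] := fe n.
have vbn n : vn n rad = - (s_plus a b c / Num.sqrt 6) by have [_ _ _ _ []] := fe n.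
have bun n := (hM _ _ _ _ _ n (fe n) (En n)).1.
have bvn n := (hM _ _ _ _ _ n (fe n) (En n)).2.
have [u [cu ur u_lim]] := @weighted_ultra_limit R F FU _ _ _ _ _ rad0 cun wun iun bun ubn.
have [v [cv vr v_lim]] := @weighted_ultra_limit R F FU _ _ _ _ _ rad0 cvn wvn ivn bvn vbn.
have fv := @first_variation R a b c L rad k c0 L0 rad0 F FU Foo m un vn gn hn u v
  m_min fe En cu cv u_lim v_lim.
have [p [q [cp cq sys]]] := el_system_exists rad0 cu cv fv.
exists u, v, p, q.
have [feu le_m] := @limit_minimises R a b c L rad k c0 L0 rad0 k0 F FU Foo m un vn gn hn
  u v p q fe En cu cv u_lim v_lim cp cq sys ur vr.
split => // u1 v1 g1 h1 fe1; exact: le_trans le_m (m_min _ _ _ _ fe1).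
Qed.

(** Cubic growth, stated with the quartic weight that
    [weighted_growth] controls. *)
Lemma potential_dy_growth : exists2 D, 0 <= D &
  forall x y, `|potential_dy a b c L x y| <= D * (1 + x ^+ 4 + y ^+ 4).
Proof.
have [A0 Q0 B0] := potential_coef_ge0 a b c0 L0; rewrite /potential_dy.
move: (a ^+ 2 / _) (c ^+ 2 / _) (b ^+ 2 / _) A0 Q0 B0 => A Q B A0 Q0 B0.
exists (2 * A + 8 * Q + 3 * B); first by lra.
move=> x y; rewrite (exprM x 2 2) (exprM y 2 2).
set m := 1 + _ + _.
have ym : `|y| <= m.
  have := sqr_ge0 (`|y| - 1); have := sqr_ge0 (y ^+ 2 - 1).
  have := sqr_ge0 (x ^+ 2); rewrite /m -(@real_normK _ y) ?num_real//.
  by move: (`|y|) => z; nra.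
have qm : `|(x ^+ 2 + y ^+ 2) * y| <= 2 * m.
  rewrite normrM ger0_norm ?addr_ge0 ?sqr_ge0// /m -(@real_normK _ y) ?num_real//.
  move: (`|y|) => z; have := sqr_ge0 (x ^+ 2 + z ^+ 2 - z).
  by have := sqr_ge0 (x ^+ 2 - z ^+ 2); have := sqr_ge0 (z ^+ 2 - 1); nra.
have dm : `|x ^+ 2 - y ^+ 2| <= m.
  have := sqr_ge0 (x ^+ 2 - 1); have := sqr_ge0 (y ^+ 2 - 1).
  rewrite ler_norml /m; move: (sqr_ge0 x) (sqr_ge0 y); move: (x ^+ 2) (y ^+ 2).
  by move=> X Y; nra.
move: qm dm ym; rewrite -[4 * Q * _ * y]mulrA.
move: (_ * y) (x ^+ 2 - _) m => S T m.
rewrite !ler_norml => /andP[s1 s2] /andP[t1 t2] /andP[y1 y2].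
have := ler_wpM2l (ltW Q0) s1; have := ler_wpM2l (ltW Q0) s2; have := ler_wpM2l B0 t1.
have := ler_wpM2l B0 t2; have := ler_wpM2l A0 y1; have := ler_wpM2l A0 y2.
by move=> h1 h2 h3 h4 h5 h6; apply/andP; split; lra.
Qed.

(** t u^4 = sqrt t (u^4 sqrt t), and the second factor is bounded
    by [weighted_growth]. *)
Lemma weighted_potential_dy u v gu gv : finite_energy u v gu gv ->
  exists C : R, forall t, 0 < t < rad ->
    `|t * potential_dy a b c L (u t) (v t)| <= C * Num.sqrt t.
Proof.
move=> [[cu cv] [wu wv] [iu iv] _ _]; have [D D0 hD] := potential_dy_growth.
have hu := weighted_growth rad0 cu wu iu (lexx _).
have hv := weighted_growth rad0 cv wv iv (lexx _).
set Bu := _ * Num.sqrt rad in hu; set Bv := _ * Num.sqrt rad in hv.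
exists (D * (Num.sqrt rad + Bu + Bv)) => t /andP[t0 tr].
rewrite normrM gtr0_norm// -[X in X * _]sqr_sqrtr ?(ltW t0)//.
rewrite expr2 mulrC mulrA ler_wpM2r ?sqrtr_ge0//.
apply: (le_trans (ler_wpM2r (sqrtr_ge0 t) (hD _ _))).
rewrite -mulrA ler_wpM2l// !mulrDl mul1r !lerD ?hu ?hv ?ltW//.
by rewrite ltr_sqrt.
Qed.

(** With P = t w' the radial Laplacian is P' / t. *)
Lemma radial_laplacian (w P h : R -> R) r :
  (forall t, 0 < t < rad -> is_derive t 1 w (P t / t)) ->
  (forall t, 0 < t < rad -> is_derive t 1 P (h t)) -> 0 < r < rad ->
  derive1n 2 w r + derive1 w r / r = h r / r.
Proof.
move=> dw dP rI; have [r0 rr] := andP rI.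
have r1 : r != 0 by rewrite gt_eqF.
have D1 t : 0 < t < rad -> derive1 w t = P t / t.
  by move=> /dw [_ E]; rewrite derive1E.
have dV : is_derive r 1 (fun t : R => t^-1) (- r ^- 2).
  have := @is_deriveV R id r 1 1 r1 (is_derive_id _ _).
  by rewrite /GRing.scale/= mulr1.
have dPr := dP _ rI.
have D2 : is_derive r 1 (derive1 w) (h r / r - P r / r ^+ 2).
  have oI : open I by exact: interval_open.
  apply: (@near_eq_is_derive _ _ _ (fun t => P t * t^-1)).
    by apply: (near_open_eq oI) => [t|] /=; rewrite in_itv//= => /D1 ->.
  apply: (is_derive_eq (is_deriveM dPr dV)); rewrite /GRing.scale/=.
  by field.
have -> : derive1n 2 w r = h r / r - P r / r ^+ 2.
  by rewrite /derive1n /= derive1E; have [_ ->] := D2.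
by rewrite D1//; field.
Qed.

(** Lets the functions be redefined for t <= 0. *)
Lemma el_system_eq u v u1 v1 p q : (forall t, 0 < t -> u1 t = u t) ->
  (forall t, 0 < t -> v1 t = v t) -> el_system a b c L rad k u v p q ->
  el_system a b c L rad k u1 v1 p q.
Proof.
move=> uE vE [du dv dp dq].
have near_pos (w w1 : R -> R) (t : R) : (forall s, 0 < s -> w1 s = w s) -> 0 < t ->
    \forall s \near t, w s = w1 s.
  by move=> wE t0; near=> s; apply/esym/wE; near: s; exact: lt_nbhsr.
split => t tI; have [t0 _] := andP tI.
- by apply: near_eq_is_derive (du _ tI); exact: near_pos.
- by apply: near_eq_is_derive (dv _ tI); exact: near_pos.
- by rewrite uE// vE//; exact: dp.
- by rewrite uE// vE//; exact: dq.
Unshelve. all: by end_near. Qed.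

Lemma finite_energy_eq u v u1 v1 p q : (forall t, 0 < t -> u1 t = u t) ->
  (forall t, 0 < t -> v1 t = v t) ->
  el_system a b c L rad k u v p q ->
  {within `]0, rad], continuous p} -> {within `]0, rad], continuous q} ->
  finite_energy u v (fun t => p t / t) (fun t => q t / t) ->
  finite_energy u1 v1 (fun t => p t / t) (fun t => q t / t) /\
  \int[mu]_(t in I) edens u1 v1 (fun t => p t / t) (fun t => q t / t) t =
  \int[mu]_(t in I) edens u v (fun t => p t / t) (fun t => q t / t) t.
Proof.
move=> uE vE sys cp cq [[cu cv] _ [iu iv] iut [ur vr]].
have sys1 := el_system_eq uE vE sys.
have cE (w w1 : R -> R) : (forall s, 0 < s -> w1 s = w s) ->
    {within `]0, rad], continuous w} -> {within `]0, rad], continuous w1}.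
  move=> wE; apply: subspace_eq_continuous => s; rewrite inE/= in_itv/= => /andP[s0 _].
  exact: (esym (wE _ s0)).
split; last first.
  apply: eq_Rintegral => t; rewrite inE/= in_itv/= => /andP[t0 _].
  by rewrite /energy_density uE// vE.
split; rewrite ?uE ?vE//.
- by split; [exact: cE cu|exact: cE cv].
- split; [exact: (@el_weak_u _ a b c L rad k rad0 u1 v1 p q)|].
  exact: (@el_weak_v _ a b c L rad k rad0 u1 v1 p q).
- apply: eq_intg iut => // t; rewrite /= in_itv/= => /andP[t0 _].
  by rewrite uE.
Qed.

Lemma sqrt23 : Num.sqrt (2 / 3) = 2 / Num.sqrt 6 :> R.
Proof.
have s6 : 0 < Num.sqrt 6 :> R by rewrite sqrtr_gt0.
have h : (2 / Num.sqrt 6) ^+ 2 = 2 / 3 :> R.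
  by rewrite expr_div_n sqr_sqrtr//; field.
by rewrite -h sqrtr_sqr ger0_norm// divr_ge0// ltW.
Qed.

Lemma el_systemP u v p q : el_system a b c L rad k u v p q ->
  forall r : R, 0 < r < rad ->
  derive1n 2 u r + derive1 u r / r - k%:~R ^+ 2 * u r / r ^+ 2 =
    u r / L * (- a ^+ 2 + Num.sqrt (2 / 3) * b ^+ 2 * v r
               + c ^+ 2 * (u r ^+ 2 + v r ^+ 2)) /\
  derive1n 2 v r + derive1 v r / r =
    v r / L * (- a ^+ 2 - (Num.sqrt 6)^-1 * b ^+ 2 * v r
               + c ^+ 2 * (u r ^+ 2 + v r ^+ 2))
    + (Num.sqrt 6 * L)^-1 * b ^+ 2 * u r ^+ 2.
Proof.
move=> [du dv dp dq] r rI; have [r0 rr] := andP rI.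
have r1 : r != 0 by rewrite gt_eqF.
have L1 : L != 0 by rewrite gt_eqF.
have s6 : Num.sqrt 6 != 0 :> R by rewrite gt_eqF// sqrtr_gt0.
have Eu := radial_laplacian du dp rI; have Ev := radial_laplacian dv dq rI.
split; [rewrite Eu|rewrite Ev]; rewrite /potential_dx /potential_dy ?sqrt23.
  by field; rewrite r1 L1 s6.
by field; rewrite r1 L1 s6.
Qed.

End minimiser.

Theorem theorem3p2 (R : realType) (a b c : R) (k : int)
    (ha : 0 < a ^+ 2) (hc : 0 < c ^+ 2) (hb : 0 <= b ^+ 2) (hk : k != 0)
    (L rad : R) (hL : 0 < L) (hrad : 0 < rad) :
  exists u v : R -> R,
    [/\ global_minimiser a b c L rad k u v,
        smooth_on `]0, rad[ u /\ {within `[0, rad], continuous u},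
        smooth_on `]0, rad[ v /\ C1_within `[0, rad] v,
        (forall r : R, 0 < r < rad ->
           derive1n 2 u r + derive1 u r / r - k%:~R ^+ 2 * u r / r ^+ 2 =
             u r / L * (- a ^+ 2 + Num.sqrt (2 / 3) * b ^+ 2 * v r
                        + c ^+ 2 * (u r ^+ 2 + v r ^+ 2)) /\
           derive1n 2 v r + derive1 v r / r =
             v r / L * (- a ^+ 2 - (Num.sqrt 6)^-1 * b ^+ 2 * v r
                        + c ^+ 2 * (u r ^+ 2 + v r ^+ 2))
             + (Num.sqrt 6 * L)^-1 * b ^+ 2 * u r ^+ 2) &
        [/\ u 0 = 0, has_derivative_within `[0, rad] v 0 0,
            u rad = (Num.sqrt 2)^-1 * s_plus a b c &
            v rad = - ((Num.sqrt 6)^-1 * s_plus a b c)]].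
Proof.
have [u [v [p [q [fe [cp cq] sys mn]]]]] := el_minimiser_exists a b hc hL hrad hk.
have [[cu cv] _ [iu iv] iut [ur vr]] := fe.
have [du dv dp dq] := sys.
have c_div (w : R -> R) (cw : {within `]0, rad], continuous w}) :=
  within_continuousM cw (@within_continuous_inv R rad).
have lu : axis_limit rad u 0.
  exact: axis_vanishing hrad du (within_oc_oo (c_div _ cp)) iut iu.
have [C hC] := weighted_potential_dy hc hL hrad fe.
have lq := axis_flux hrad dq hC iv.
have [l [C1v v'0]] := C1_axis_extension hrad cv (c_div _ cq) lq dv.
have uE t : 0 < t -> axis_extension u 0 t = u t by exact: axis_extensionE.
have vE t : 0 < t -> axis_extension v l t = v t by exact: axis_extensionE.
exists (axis_extension u 0), (axis_extension v l).
have sys1 := el_system_eq uE vE sys.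
have [fe1 E1] := finite_energy_eq hrad uE vE sys cp cq fe.
have [su sv _ _] := el_system_smooth sys1.
split.
- split.
    apply/(admissibleP a b k hc hL hrad).
    by exists (fun t => p t / t), (fun t => q t / t).
  move=> u1 v1 /(admissibleP a b k hc hL hrad)[g1 [h1 fe2]].
  by rewrite (energyE k hc hL hrad fe1) (energyE k hc hL hrad fe2) lee_fin E1; exact: mn.
- by split => //; exact: axis_extension_within.
- by [].
- exact: (el_systemP hL sys1).
- split => //; first exact: axis_extension0.
  + by rewrite uE// ur mulrC.
  + by rewrite vE// vr mulrC.
Qed.
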